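(* Let $k$ be an algebraically closed field, let $X$ be a variety over $k$, and let $f: X\to X$ be a flat and finite endomorphism. If the field extension $k(X)/f^*k(X)$ is separable, then for every $x\in X(k)$ such that $\bigcup_{i\geq 0}f^{-i}(x)$ is Zariski dense in $X$, $$\lim_{n\to\infty}(\#f^{-n}(x))^{1/n}=d_f.$$
   Context: A variety is an irreducible, reduced, separated scheme of finite type over a field. $d_f:=[k(X):f^*k(X)]$ is the topological degree of $f$. $f^{-n}(x)$ is the set-theoretic preimage of $x$ under $f^n$, and $\#$ denotes cardinality (no multiplicities). *)

(* Defs.v *)
(* Rings of sections may be zero (over the empty set), hence [comPzRingType]. *)
From HB Require Import structures.
From mathcomp Require Import all_boot all_order all_algebra all_field.
From mathcomp Require Import generic_quotient.
From mathcomp Require Import all_classical all_reals all_analysis.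
Set Implicit Arguments.
Unset Strict Implicit.
Unset Printing Implicit Defensive.
Import GRing.Theory.
Local Open Scope classical_set_scope.
Local Open Scope ring_scope.
Local Open Scope quotient_scope.

Definition invertible (A : comPzRingType) (a : A) : Prop := exists b, a * b = 1.

Definition prime_ideal (A : comPzRingType) (p : set A) : Prop :=
  [/\ p 0, (forall a b, p a -> p b -> p (a + b)),
      (forall a b, p b -> p (a * b)), ~ p 1
    & forall a b, p (a * b) -> p a \/ p b].

(* [u : A -> B] exhibits [B] as the localization [A_g]. *)
Definition is_localization (A B : comPzRingType) (g : A) (u : A -> B) : Prop :=
  [/\ invertible (u g),
      (forall b, exists n a, b * u g ^+ n = u a)
    & forall a, u a = 0 -> exists n, g ^+ n * a = 0].

Definition module_finite (A B : comPzRingType) (u : A -> B) : Prop :=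
  exists n (e : 'I_n -> B), forall b, exists a : 'I_n -> A,
    b = \sum_(i < n) u (a i) * e i.

(* [B] is generated as a ring by the image of [u] and finitely many elements. *)
Definition finitely_generated_algebra (A B : comPzRingType) (u : A -> B)
    : Prop :=
  exists e : seq B, forall P : set B,
    (forall a, P (u a)) -> (forall b, b \in e -> P b) ->
    (forall a b, P a -> P b -> P (a + b)) ->
    (forall a b, P a -> P b -> P (a * b)) ->
    forall b, P b.

(* The tensor product [B (x)_A N] ([B] an [A]-algebra through [u]), presented by
   generators and relations: the list [:: (b1, n1); ...; (br, nr)] stands for
   [b1 (x) n1 + ... + br (x) nr], and two lists are identified when they
   represent the same tensor. *)
Inductive tensor_eq (A B : comPzRingType) (u : A -> B) (N : lmodType A) :
    seq (B * N) -> seq (B * N) -> Prop :=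
| tensor_refl s : tensor_eq u s s
| tensor_sym s t : tensor_eq u s t -> tensor_eq u t s
| tensor_trans s t r : tensor_eq u s t -> tensor_eq u t r -> tensor_eq u s r
| tensor_cat s s' t t' :
    tensor_eq u s s' -> tensor_eq u t t' -> tensor_eq u (s ++ t) (s' ++ t')
| tensor_comm s t : tensor_eq u (s ++ t) (t ++ s)
| tensor_zero n : tensor_eq u [:: (0, n)] [::]
| tensor_addl b b' n : tensor_eq u [:: (b + b', n)] [:: (b, n); (b', n)]
| tensor_addr b n n' : tensor_eq u [:: (b, n + n')] [:: (b, n); (b, n')]
| tensor_scale a b n : tensor_eq u [:: (u a * b, n)] [:: (b, a *: n)].

Definition flat_ring_map (A B : comPzRingType) (u : A -> B) : Prop :=
  forall (N' N : lmodType A) (i : {linear N' -> N}), injective i ->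
  forall s : seq (B * N'),
    tensor_eq u [seq (x.1, i x.2) | x <- s] [::] -> tensor_eq u s [::].

Definition extension_basis (L : fieldType) (F : set L) (d : nat)
    (e : 'I_d -> L) : Prop :=
  forall z, exists! a : 'I_d -> L,
    (forall i, F (a i)) /\ z = \sum_(i < d) a i * e i.

(* Extensions [L / F] have their subfield [F] given as a subset of [L]; an
   infinite extension gets degree 0. *)
Definition extension_degree (L : fieldType) (F : set L) : nat :=
  xget 0%N [set d : nat | exists e : 'I_d -> L, extension_basis F e].

Definition poly_over (L : fieldType) (F : set L) (p : {poly L}) : Prop :=
  forall i : nat, F p`_i.

Definition minimal_poly (L : fieldType) (F : set L) (z : L) (p : {poly L})
    : Prop :=
  [/\ p \is monic, poly_over F p, root p z
    & forall q, q != 0 -> poly_over F q -> root q z -> (size p <= size q)%N].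

Definition separable_extension (L : fieldType) (F : set L) : Prop :=
  forall z, exists2 p, minimal_poly F z p & separable_poly p.

Record opens (T : topologicalType) :=
  Opens { oset :> set T; oset_open : open oset }.

Definition opensT (T : topologicalType) : opens T := Opens openT.

Definition opensI (T : topologicalType) (U V : opens T) : opens T :=
  Opens (openI (oset_open U) (oset_open V)).

Record ringed_space := RingedSpace {
  space :> topologicalType;
  sec : opens space -> comPzRingType;
  res : forall U V : opens space, V `<=` U -> {rmorphism sec U -> sec V};
  res_id : forall (U : opens space) (h : U `<=` U) s, res h s = s;
  res_comp : forall (U V W : opens space) (hVU : V `<=` U) (hWV : W `<=` V)
    (hWU : W `<=` U) s, res hWV (res hVU s) = res hWU s;
  sheaf_glue : forall (I : Type) (U : I -> opens space) (V : opens space)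
    (hU : forall i, U i `<=` V), V `<=` \bigcup_i U i ->
    forall s : (forall i, sec (U i)),
    (forall i j, res (@subIsetl _ (U i) (U j) : opensI (U i) (U j) `<=` U i)
                   (s i)
               = res (@subIsetr _ (U i) (U j) : opensI (U i) (U j) `<=` U j)
                   (s j)) ->
    exists! t : sec V, forall i, res (hU i) t = s i
}.
Arguments sec {X} U : rename.
Arguments res {X U V} h : rename.
Arguments res_id {X U} h s : rename.
Arguments res_comp {X U V W} hVU hWV hWU s : rename.

Record pregerm (X : ringed_space) (x : X) :=
  PreGerm { pg_dom : opens X; pg_mem : oset pg_dom x; pg_sec : sec pg_dom }.
HB.instance Definition _ (X : ringed_space) (x : X) :=
  gen_eqMixin (pregerm x).
HB.instance Definition _ (X : ringed_space) (x : X) :=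
  gen_choiceMixin (pregerm x).

Definition same_germ_prop (X : ringed_space) (x : X) (g h : pregerm x) : Prop :=
  exists (W : opens X) (hg : W `<=` pg_dom g) (hh : W `<=` pg_dom h),
    oset W x /\ res hg (pg_sec g) = res hh (pg_sec h).

Definition same_germ (X : ringed_space) (x : X) (g h : pregerm x) : bool :=
  `[< same_germ_prop g h >].

Lemma same_germ_refl (X : ringed_space) (x : X) : reflexive (@same_germ X x).
Proof.
move=> [U Ux s]; apply/asboolP.
by exists U, (@subset_refl _ U), (@subset_refl _ U).
Qed.

Lemma same_germ_sym (X : ringed_space) (x : X) : symmetric (@same_germ X x).
Proof.
by move=> g h; apply/asboolP/asboolP => -[W [a [b [Wx e]]]];
  exists W, b, a; split.
Qed.

Lemma same_germ_trans (X : ringed_space) (x : X) : transitive (@same_germ X x).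
Proof.
move=> h g k /asboolP[W [a [b [Wx e]]]] /asboolP[W' [a' [b' [Wx' e']]]].
apply/asboolP.
pose I := opensI W W'.
have l : I `<=` W by apply: subIsetl.
have r : I `<=` W' by apply: subIsetr.
exists I, (subset_trans l a), (subset_trans r b'); split=> //.
rewrite -(res_comp a l) -(res_comp b' r) e -e'.
by rewrite (res_comp b l (subset_trans l b)) (res_comp a' r (subset_trans l b)).
Qed.

Canonical same_germ_equiv (X : ringed_space) (x : X) :=
  EquivRel (@same_germ X x) (@same_germ_refl X x) (@same_germ_sym X x)
    (@same_germ_trans X x).

Definition stalk (X : ringed_space) (x : X) : Type :=
  {eq_quot (same_germ_equiv x)}.
HB.instance Definition _ (X : ringed_space) (x : X) :=
  Choice.copy (stalk x) {eq_quot (same_germ_equiv x)}.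

Definition germ (X : ringed_space) (x : X) (U : opens X) (Ux : oset U x)
    (s : sec U) : stalk x :=
  \pi_({eq_quot (same_germ_equiv x)}) (PreGerm Ux s).
Arguments germ {X x U} Ux s.

Lemma germ_eq (X : ringed_space) (x : X) (U V : opens X) (Ux : oset U x)
    (Vx : oset V x) (s : sec U) (t : sec V) :
  germ Ux s = germ Vx t <->
  exists (W : opens X) (hU : W `<=` U) (hV : W `<=` V),
    oset W x /\ res hU s = res hV t.
Proof.
split=> [/eqP|h]; last by apply/eqP; rewrite eqmodE; apply/asboolP.
by rewrite eqmodE => /asboolP.
Qed.

Lemma germ_res (X : ringed_space) (x : X) (U V : opens X) (Ux : oset U x)
    (Vx : oset V x) (h : V `<=` U) (s : sec U) :
  germ Vx (res h s) = germ Ux s.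
Proof.
by apply/germ_eq; exists V, (@subset_refl _ V), h; rewrite res_id.
Qed.

Lemma germ_irr (X : ringed_space) (x : X) (U : opens X) (Ux Ux' : oset U x)
    (s : sec U) : germ Ux s = germ Ux' s.
Proof. by rewrite (Prop_irrelevance Ux Ux'). Qed.

Lemma germP (X : ringed_space) (x : X) (a : stalk x) :
  exists (U : opens X) (Ux : oset U x) (s : sec U), a = germ Ux s.
Proof. by elim/quotW: a => -[U Ux s]; exists U, Ux, s. Qed.

Lemma germP2 (X : ringed_space) (x : X) (a b : stalk x) :
  exists (U : opens X) (Ux : oset U x) (s t : sec U),
    a = germ Ux s /\ b = germ Ux t.
Proof.
have [U [Ux [s ->]]] := germP a; have [V [Vx [t ->]]] := germP b.
pose I := opensI U V; have Ix : oset I x by split.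
have l : I `<=` U by apply: subIsetl.
have r : I `<=` V by apply: subIsetr.
by exists I, Ix, (res l s), (res r t); rewrite !germ_res.
Qed.

Lemma germP3 (X : ringed_space) (x : X) (a b c : stalk x) :
  exists (U : opens X) (Ux : oset U x) (s t r : sec U),
    [/\ a = germ Ux s, b = germ Ux t & c = germ Ux r].
Proof.
have [U [Ux [s [t [-> ->]]]]] := germP2 a b; have [V [Vx [w ->]]] := germP c.
pose I := opensI U V; have Ix : oset I x by split.
have l : I `<=` U by apply: subIsetl.
have r : I `<=` V by apply: subIsetr.
by exists I, Ix, (res l s), (res l t), (res r w); rewrite !germ_res.
Qed.

Definition stalk_op2 (X : ringed_space) (x : X)
    (op : forall U : opens X, sec U -> sec U -> sec U) (a b : stalk x)
    : stalk x :=
  let g := repr a in let h := repr b in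
  germ (conj (pg_mem g) (pg_mem h) : oset (opensI (pg_dom g) (pg_dom h)) x)
    (op _ (res (@subIsetl _ (pg_dom g) (pg_dom h)
                : opensI (pg_dom g) (pg_dom h) `<=` pg_dom g) (pg_sec g))
          (res (@subIsetr _ (pg_dom g) (pg_dom h)
                : opensI (pg_dom g) (pg_dom h) `<=` pg_dom h) (pg_sec h))).

Lemma stalk_op2E (X : ringed_space) (x : X)
    (op : forall U : opens X, sec U -> sec U -> sec U)
    (opr : forall (U V : opens X) (h : V `<=` U) (s t : sec U),
       res h (op U s t) = op V (res h s) (res h t))
    (U : opens X) (Ux : oset U x) (s t : sec U) :
  stalk_op2 op (germ Ux s) (germ Ux t) = germ Ux (op U s t).
Proof.
rewrite /stalk_op2; set a := germ Ux s; set b := germ Ux t.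
have ea : germ (pg_mem (repr a)) (pg_sec (repr a)) = germ Ux s.
  by rewrite -/a -[RHS]reprK /germ; case: (repr a).
have eb : germ (pg_mem (repr b)) (pg_sec (repr b)) = germ Ux t.
  by rewrite -/b -[RHS]reprK /germ; case: (repr b).
case: (repr a) ea => /= A Ax p; case: (repr b) eb => /= B Bx q.
move=> /germ_eq[W [hB [hU [Wx e]]]] /germ_eq[W' [hA' [hU' [Wx' e']]]].
pose I := opensI W W'.
have l : I `<=` W by apply: subIsetl.
have r : I `<=` W' by apply: subIsetr.
have hAB : I `<=` opensI A B by move=> y [/hB ? /hA' ?].
have hIU := subset_trans l hU.
apply/germ_eq; exists I, hAB, hIU; split=> //; rewrite !opr; congr op.
  rewrite (res_comp _ _ (subset_trans r hA')) -(res_comp hA' r) e'.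
  exact: res_comp.
rewrite (res_comp _ _ (subset_trans l hB)) -(res_comp hB l) e.
exact: res_comp.
Qed.

Definition stalk_add (X : ringed_space) (x : X) : stalk x -> stalk x -> stalk x :=
  stalk_op2 (fun U => @GRing.add (sec U)).
Definition stalk_mul (X : ringed_space) (x : X) : stalk x -> stalk x -> stalk x :=
  stalk_op2 (fun U => @GRing.mul (sec U)).
Definition stalk_opp (X : ringed_space) (x : X) (a : stalk x) : stalk x :=
  germ (pg_mem (repr a)) (- pg_sec (repr a)).
Definition stalk_zero (X : ringed_space) (x : X) : stalk x :=
  germ (I : oset (opensT X) x) 0.
Definition stalk_one (X : ringed_space) (x : X) : stalk x :=
  germ (I : oset (opensT X) x) 1.

Lemma stalk_addE (X : ringed_space) (x : X) (U : opens X) (Ux : oset U x)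
    (s t : sec U) :
  stalk_add (germ Ux s) (germ Ux t) = germ Ux (s + t).
Proof. by apply: stalk_op2E => V W h a b; rewrite rmorphD. Qed.

Lemma stalk_mulE (X : ringed_space) (x : X) (U : opens X) (Ux : oset U x)
    (s t : sec U) :
  stalk_mul (germ Ux s) (germ Ux t) = germ Ux (s * t).
Proof. by apply: stalk_op2E => V W h a b; rewrite rmorphM. Qed.

Lemma stalk_oppE (X : ringed_space) (x : X) (U : opens X) (Ux : oset U x)
    (s : sec U) :
  stalk_opp (germ Ux s) = germ Ux (- s).
Proof.
rewrite /stalk_opp; set a := germ Ux s.
have ea : germ (pg_mem (repr a)) (pg_sec (repr a)) = germ Ux s.
  by rewrite -/a -[RHS]reprK /germ; case: (repr a).
case: (repr a) ea => /= A Ax p /germ_eq[W [hA [hU [Wx e]]]].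
by apply/germ_eq; exists W, hA, hU; rewrite !rmorphN e.
Qed.

Lemma stalk_zeroE (X : ringed_space) (x : X) (U : opens X) (Ux : oset U x) :
  stalk_zero x = germ Ux 0.
Proof. by rewrite -[LHS](germ_res _ Ux (@subsetT _ U : U `<=` opensT X)) rmorph0. Qed.

Lemma stalk_oneE (X : ringed_space) (x : X) (U : opens X) (Ux : oset U x) :
  stalk_one x = germ Ux 1.
Proof. by rewrite -[LHS](germ_res _ Ux (@subsetT _ U : U `<=` opensT X)) rmorph1. Qed.

Lemma stalk_addA (X : ringed_space) (x : X) : associative (@stalk_add X x).
Proof.
move=> a b c; have [U [Ux [s [t [r [-> -> ->]]]]]] := germP3 a b c.
by rewrite !stalk_addE addrA.
Qed.

Lemma stalk_addC (X : ringed_space) (x : X) : commutative (@stalk_add X x).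
Proof.
move=> a b; have [U [Ux [s [t [-> ->]]]]] := germP2 a b.
by rewrite !stalk_addE addrC.
Qed.

Lemma stalk_add0 (X : ringed_space) (x : X) :
  left_id (stalk_zero x) (@stalk_add X x).
Proof.
move=> a; have [U [Ux [s ->]]] := germP a.
by rewrite (stalk_zeroE Ux) stalk_addE add0r.
Qed.

Lemma stalk_addN (X : ringed_space) (x : X) :
  left_inverse (stalk_zero x) (@stalk_opp X x) (@stalk_add X x).
Proof.
move=> a; have [U [Ux [s ->]]] := germP a.
by rewrite (stalk_zeroE Ux) stalk_oppE stalk_addE addNr.
Qed.

Lemma stalk_mulA (X : ringed_space) (x : X) : associative (@stalk_mul X x).
Proof.
move=> a b c; have [U [Ux [s [t [r [-> -> ->]]]]]] := germP3 a b c.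
by rewrite !stalk_mulE mulrA.
Qed.

Lemma stalk_mulC (X : ringed_space) (x : X) : commutative (@stalk_mul X x).
Proof.
move=> a b; have [U [Ux [s [t [-> ->]]]]] := germP2 a b.
by rewrite !stalk_mulE mulrC.
Qed.

Lemma stalk_mul1 (X : ringed_space) (x : X) :
  left_id (stalk_one x) (@stalk_mul X x).
Proof.
move=> a; have [U [Ux [s ->]]] := germP a.
by rewrite (stalk_oneE Ux) stalk_mulE mul1r.
Qed.

Lemma stalk_mulDl (X : ringed_space) (x : X) :
  left_distributive (@stalk_mul X x) (@stalk_add X x).
Proof.
move=> a b c; have [U [Ux [s [t [r [-> -> ->]]]]]] := germP3 a b c.
by rewrite !(stalk_mulE, stalk_addE) mulrDl.
Qed.

HB.instance Definition _ (X : ringed_space) (x : X) :=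
  GRing.isZmodule.Build (stalk x) (@stalk_addA X x) (@stalk_addC X x)
    (@stalk_add0 X x) (@stalk_addN X x).
HB.instance Definition _ (X : ringed_space) (x : X) :=
  GRing.Zmodule_isComPzRing.Build (stalk x) (@stalk_mulA X x) (@stalk_mulC X x)
    (@stalk_mul1 X x) (@stalk_mulDl X x).

Lemma germD (X : ringed_space) (x : X) (U : opens X) (Ux : oset U x)
    (s t : sec U) : germ Ux (s + t) = germ Ux s + germ Ux t.
Proof. by rewrite -stalk_addE. Qed.

Lemma germM (X : ringed_space) (x : X) (U : opens X) (Ux : oset U x)
    (s t : sec U) : germ Ux (s * t) = germ Ux s * germ Ux t.
Proof. by rewrite -stalk_mulE. Qed.

Lemma germN (X : ringed_space) (x : X) (U : opens X) (Ux : oset U x)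
    (s : sec U) : germ Ux (- s) = - germ Ux s.
Proof. by rewrite -stalk_oppE. Qed.

Lemma germ0 (X : ringed_space) (x : X) (U : opens X) (Ux : oset U x) :
  germ Ux 0 = 0.
Proof. by rewrite -stalk_zeroE. Qed.

Lemma germ1 (X : ringed_space) (x : X) (U : opens X) (Ux : oset U x) :
  germ Ux 1 = 1.
Proof. by rewrite -stalk_oneE. Qed.

Definition opens_preim (S T : topologicalType) (f : S -> T)
    (cf : continuous f) (V : opens T) : opens S :=
  Opens ((@continuousP _ _ f).1 cf _ (oset_open V)).

Record ringed_map (X Y : ringed_space) := RingedMap {
  map_fun :> X -> Y;
  map_cont : continuous map_fun;
  comor : forall V : opens Y,
    {rmorphism sec V -> sec (opens_preim map_cont V)};
  comor_res : forall (V W : opens Y) (h : W `<=` V)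
    (h' : opens_preim map_cont W `<=` opens_preim map_cont V) (s : sec V),
    comor W (res h s) = res h' (comor V s)
}.
Arguments comor {X Y} f V : rename.
Arguments comor_res {X Y} f {V W} h h' s : rename.

Definition mpreim (X Y : ringed_space) (f : ringed_map X Y) (V : opens Y)
    : opens X := opens_preim (@map_cont X Y f) V.

(* The induced map [O_(Y, f x) -> O_(X, x)], sending the germ of [s] at [f x]
   to the germ of [f^# s] at [x] (see [stalk_mapE]). *)
Definition stalk_map (X Y : ringed_space) (f : ringed_map X Y) (x : X)
    (a : stalk (f x)) : stalk x :=
  germ (pg_mem (repr a) : oset (mpreim f (pg_dom (repr a))) x)
    (comor f _ (pg_sec (repr a))).

Lemma stalk_mapE (X Y : ringed_space) (f : ringed_map X Y) (x : X)
    (V : opens Y) (Vx : oset V (f x)) (s : sec V) :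
  stalk_map (germ Vx s) = germ (Vx : oset (mpreim f V) x) (comor f V s).
Proof.
rewrite /stalk_map; set a := germ Vx s.
have ea : germ (pg_mem (repr a)) (pg_sec (repr a)) = germ Vx s.
  by rewrite -/a -[RHS]reprK /germ; case: (repr a).
case: (repr a) ea => /= A Ax p /germ_eq[W [hA [hV [Wx e]]]].
have hA' : mpreim f W `<=` mpreim f A by move=> y; apply: hA.
have hV' : mpreim f W `<=` mpreim f V by move=> y; apply: hV.
apply/germ_eq; exists (mpreim f W), hA', hV'; split=> //.
by rewrite -!comor_res e.
Qed.

Lemma stalk_map_zmod_morphism (X Y : ringed_space) (f : ringed_map X Y)
    (x : X) : zmod_morphism (@stalk_map X Y f x).
Proof.
move=> a b; have [U [Ux [s [t [-> ->]]]]] := germP2 a b.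
by rewrite -germN -germD !stalk_mapE rmorphB germD germN.
Qed.

Lemma stalk_map_monoid_morphism (X Y : ringed_space) (f : ringed_map X Y)
    (x : X) : monoid_morphism (@stalk_map X Y f x).
Proof.
split=> [|a b].
  have Tx : oset (opensT Y) (f x) by [].
  by rewrite -(germ1 Tx) stalk_mapE rmorph1 germ1.
have [U [Ux [s [t [-> ->]]]]] := germP2 a b.
by rewrite -germM !stalk_mapE rmorphM germM.
Qed.

HB.instance Definition _ (X Y : ringed_space) (f : ringed_map X Y) (x : X) :=
  GRing.isZmodMorphism.Build _ _ (@stalk_map X Y f x)
    (@stalk_map_zmod_morphism X Y f x).
HB.instance Definition _ (X Y : ringed_space) (f : ringed_map X Y) (x : X) :=
  GRing.isMonoidMorphism.Build _ _ (@stalk_map X Y f x)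
    (@stalk_map_monoid_morphism X Y f x).

(* The open subspace [U] is isomorphic to [Spec A]: [p] is a homeomorphism from
   [U] onto the set of prime ideals of [A] with its Zariski topology, under
   which the sheaf of [U] is the structure sheaf of [Spec A], i.e. the sheaf
   with sections [A_g] over each distinguished open [D(g)]. *)
Definition affine_open (X : ringed_space) (U : opens X) : Prop :=
  exists (A : comPzRingType) (phi : {rmorphism A -> sec U}) (p : X -> set A),
    [/\ forall x, oset U x -> prime_ideal (p x),
        forall q, prime_ideal q -> exists! x, oset U x /\ p x = q,
        forall V : set X, V `<=` U ->
          (open V <-> exists E : set A,
             V = [set x | oset U x /\ ~ (E `<=` p x)])
      & forall (g : A) (V : opens X) (h : V `<=` U),
          oset V = [set x | oset U x /\ ~ p x g] ->
          is_localization g (fun a => res h (phi a))].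

Record scheme := Scheme {
  scheme_space :> ringed_space;
  scheme_affine : forall x : scheme_space,
    exists2 U : opens scheme_space, oset U x & affine_open U
}.

Record scheme_map (X Y : scheme) := SchemeMap {
  scheme_map_ringed :> ringed_map X Y;
  scheme_map_local : forall x (a : stalk (scheme_map_ringed x)),
    invertible (stalk_map a) -> invertible a
}.

(* Equality of morphisms, stated up to restriction because the two
   comorphisms take values over syntactically different open sets. *)
Definition same_map (X Y : ringed_space) (f g : ringed_map X Y) : Prop :=
  (forall x, f x = g x) /\
  (forall (V : opens Y) (s : sec V) (W : opens X)
     (hf : W `<=` mpreim f V) (hg : W `<=` mpreim g V),
     res hf (comor f V s) = res hg (comor g V s)).

(* [g] after [f] is [h]. *)
Definition is_comp (X Y Z : ringed_space) (f : ringed_map X Y)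
    (g : ringed_map Y Z) (h : ringed_map X Z) : Prop :=
  (forall x, g (f x) = h x) /\
  (forall (V : opens Z) (s : sec V) (W : opens X)
     (hgf : W `<=` mpreim f (mpreim g V)) (hh : W `<=` mpreim h V),
     res hgf (comor f _ (comor g V s)) = res hh (comor h V s)).

Definition is_identity (X : ringed_space) (f : ringed_map X X) : Prop :=
  (forall x, f x = x) /\
  (forall (V : opens X) (s : sec V) (W : opens X)
     (hf : W `<=` mpreim f V) (hV : W `<=` V),
     res hf (comor f V s) = res hV s).

Definition closed_immersion (X Y : scheme) (f : scheme_map X Y) : Prop :=
  [/\ closed (range f), injective f,
      forall U : set X, open U -> exists2 V : set Y, open V & U = f @^-1` V
    & forall (V : opens Y) (s : sec (mpreim f V)) (y : Y), oset V y ->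
        exists (W : opens Y) (h : mpreim f W `<=` mpreim f V) (t : sec W),
          oset W y /\ comor f W t = res h s].

Definition affine_map (X Y : scheme) (f : scheme_map X Y) : Prop :=
  forall V : opens Y, affine_open V -> affine_open (mpreim f V).

Definition finite_map (X Y : scheme) (f : scheme_map X Y) : Prop :=
  affine_map f /\
  forall V : opens Y, affine_open V -> module_finite (comor f V).

Definition flat_map (X Y : scheme) (f : scheme_map X Y) : Prop :=
  forall x, flat_ring_map (@stalk_map X Y f x).

(* A morphism [X -> Spec k] is the same thing as a ring morphism from [k] to
   the global sections of [X]. *)
Record kscheme (k : fieldType) := KScheme {
  kscheme_scheme :> scheme;
  kstr : {rmorphism k -> sec (opensT kscheme_scheme)}
}.

Definition kconst (k : fieldType) (X : kscheme k) (U : opens X) (c : k)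
    : sec U :=
  res (@subsetT _ U : U `<=` opensT X) (kstr X c).

Record kmap (k : fieldType) (X Y : kscheme k) := KMap {
  kmap_map :> scheme_map X Y;
  kmap_kstr : forall c,
    comor kmap_map (opensT Y) (kstr Y c) = kconst (mpreim kmap_map (opensT Y)) c
}.

Definition is_product (k : fieldType) (X Y P : kscheme k)
    (p1 : kmap P X) (p2 : kmap P Y) : Prop :=
  forall (T : kscheme k) (a : kmap T X) (b : kmap T Y),
    (exists h : kmap T P, is_comp h p1 a /\ is_comp h p2 b) /\
    (forall h h' : kmap T P, is_comp h p1 a -> is_comp h p2 b ->
       is_comp h' p1 a -> is_comp h' p2 b -> same_map h h').

Definition is_diagonal (k : fieldType) (X P : kscheme k)
    (p1 p2 : kmap P X) (D : kmap X P) : Prop :=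
  exists i : kmap X X, [/\ is_identity i, is_comp D p1 i & is_comp D p2 i].

Definition separated (k : fieldType) (X : kscheme k) : Prop :=
  exists (P : kscheme k) (p1 p2 : kmap P X) (D : kmap X P),
    [/\ is_product p1 p2, is_diagonal p1 p2 D & closed_immersion D].

Definition finite_type (k : fieldType) (X : kscheme k) : Prop :=
  exists (n : nat) (U : 'I_n -> opens X),
    (forall x, exists i, oset (U i) x) /\
    forall i, affine_open (U i) /\
      finitely_generated_algebra (@kconst k X (U i)).

Definition reduced (X : ringed_space) : Prop :=
  forall (U : opens X) (s : sec U) n, s ^+ n = 0 -> s = 0.

Definition irreducible_space (T : topologicalType) : Prop :=
  [set: T] !=set0 /\
  forall A B : set T, closed A -> closed B -> A `|` B = setT ->
    A = setT \/ B = setT.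

Record variety (k : fieldType) := Variety {
  variety_kscheme :> kscheme k;
  variety_irreducible : irreducible_space variety_kscheme;
  variety_reduced : reduced variety_kscheme;
  variety_separated : separated variety_kscheme;
  variety_finite_type : finite_type variety_kscheme
}.

(* A point of [X(k)]: a point of [X] with residue field [k], i.e. such that
   every germ is a constant modulo the maximal ideal of non-invertible germs. *)
Definition rational_point (k : fieldType) (X : kscheme k) (x : X) : Prop :=
  forall a : stalk x, exists c : k,
    ~ invertible (a - germ (I : oset (opensT X) x) (kstr X c)).

Definition generic_point (T : topologicalType) (x : T) : Prop :=
  closure [set x] = setT.

Lemma sec_empty (X : ringed_space) (U : opens X) (s t : sec U) :
  oset U = set0 -> s = t.
Proof.
move=> U0.
have cov : U `<=` \bigcup_(i : void) oset (of_void (opens X) i).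
  by rewrite U0.
have [r [_ un]] := @sheaf_glue X void (of_void (opens X)) U
  (fun i => match i with end) cov (fun i => match i with end)
  (fun i => match i with end).
by rewrite -(un s) ?(un t) // => -[].
Qed.

Lemma irreducible_meet (T : topologicalType) (A B : set T) :
  irreducible_space T -> open A -> open B -> A !=set0 -> B !=set0 ->
  A `&` B !=set0.
Proof.
move=> [_ irr] oA oB A0 B0; apply/set0P/eqP => AB.
have := irr (~` A) (~` B) (open_closedC oA) (open_closedC oB).
rewrite -setCI AB setC0 => /(_ erefl)[] /(congr1 setC);
  rewrite setCK setCT => E; [case: A0 => z | case: B0 => z]; by rewrite E.
Qed.

(* On an affine open subset of a reduced ringed space, a nonempty distinguished
   open subset is one defined by a nonzero function. *)
Lemma distinguished_open (X : ringed_space) (U : opens X) (A : comPzRingType)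
    (phi : {rmorphism A -> sec U}) (p : X -> set A) :
  reduced X ->
  (forall x, oset U x -> prime_ideal (p x)) ->
  (forall V : set X, V `<=` U ->
     (open V <-> exists E : set A,
        V = [set x | oset U x /\ ~ (E `<=` p x)])) ->
  (forall (g : A) (V : opens X) (h : V `<=` U),
     oset V = [set x | oset U x /\ ~ p x g] ->
     is_localization g (fun a => res h (phi a))) ->
  forall g : A,
    open [set x | oset U x /\ ~ p x g] /\
    ([set x | oset U x /\ ~ p x g] = set0 -> g = 0).
Proof.
move=> red pr top loc.
have oD g : open [set x | oset U x /\ ~ p x g].
  apply/top; first by move=> x [].
  exists [set g]; apply/seteqP; split=> x /= [Ux np]; split=> //.
    by apply: contra_not np => /(_ g erefl).
  by apply: contra_not np => pg _ ->.
move=> g; split=> // D0.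
have inj a : phi a = 0 -> a = 0.
  move=> pa; have := loc 1 U (@subset_refl _ U).
  case=> [|_ _ /(_ a)].
    apply/seteqP; split=> x /= => [Ux|[]//]; split=> //.
    by case: (pr x Ux).
  by rewrite pa rmorph0 => /(_ erefl)[n]; rewrite expr1n mul1r.
have sV : Opens (oD g) `<=` U by move=> x [].
have [_ _ /(_ 1)] := loc g (Opens (oD g)) sV erefl.
case=> [|n]; first exact: sec_empty.
rewrite mulr1 => gn; apply/inj/(red _ _ n).
by rewrite -rmorphXn gn rmorph0.
Qed.

Lemma generic_point_exists (k : fieldType) (X : variety k) :
  exists x : X, generic_point x.
Proof.
have irr := variety_irreducible X; have red := @variety_reduced _ X.
have [x0 _] : [set: X] !=set0 by case: irr.
have [U Ux0 [A [phi [p [pr pbij top loc]]]]] := scheme_affine x0.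
have dist := distinguished_open red pr top loc.
have prime0 : prime_ideal [set 0 : A].
  split=> /=.
  - by [].
  - by move=> a b -> ->; rewrite addr0.
  - by move=> a b ->; rewrite mulr0.
  - move=> A0; have [_ _ _ np1 _] := pr _ Ux0; apply: np1.
    by rewrite A0; case: (pr _ Ux0).
  - move=> a b ab; apply: contrapT => /not_orP[a0 b0].
    have [oa ea] := dist a; have [ob eb] := dist b.
    have [] := irreducible_meet irr oa ob.
    + by apply/set0P/eqP => /ea.
    + by apply/set0P/eqP => /eb.
    + move=> x [[Ux npa] [_ npb]].
      have [p0 _ _ _ /(_ a b)] := pr _ Ux.
      by rewrite ab => /(_ p0)[].
have [eta [[Ueta peta] _]] := pbij _ prime0.
exists eta; rewrite /generic_point; apply/seteqP; split=> // y _ B.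
rewrite nbhsE => -[V [oV Vy] VB]; exists eta; split=> //; apply: VB.
have [z [Vz Uz]] := irreducible_meet irr oV (oset_open U)
  (ex_intro _ y Vy) (ex_intro _ x0 Ux0).
have /top : open (V `&` U) by apply: openI => //; apply: oset_open.
case=> [|E VUE]; first exact: subIsetr.
have : (V `&` U) z by [].
rewrite VUE => -[_ nE].
suff : (V `&` U) eta by case.
rewrite VUE; split=> // Ee; apply: nE => a /Ee.
by rewrite peta => ->; case: (pr _ Uz).
Qed.

Definition generic_pt (k : fieldType) (X : variety k) : X :=
  projT1 (cid (generic_point_exists X)).

Lemma generic_ptP (k : fieldType) (X : variety k) :
  generic_point (generic_pt X).
Proof. exact: projT2 (cid (generic_point_exists X)). Qed.

Lemma generic_point_open (T : topologicalType) (x : T) (V : set T) :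
  generic_point x -> open V -> V !=set0 -> V x.
Proof.
move=> gx oV [y Vy]; have : closure [set x] y by rewrite gx.
by move=> /(_ V (open_nbhs_nbhs (conj oV Vy)))[_ [-> ]].
Qed.

(* The function field [k(X)] is the stalk at the generic point. *)
Definition function_field (k : fieldType) (X : variety k) : Type :=
  stalk (generic_pt X).
HB.instance Definition _ (k : fieldType) (X : variety k) :=
  GRing.ComPzRing.copy (function_field X) (stalk (generic_pt X)).

Lemma function_field_invertible (k : fieldType) (X : variety k)
    (a : function_field X) : a <> 0 -> invertible a.
Proof.
set eta := generic_pt X; have geta : generic_point eta := generic_ptP X.
have red := @variety_reduced _ X.
have [U Ueta [A [phi [p [pr pbij top loc]]]]] := scheme_affine eta.
have dist := distinguished_open red pr top loc.
have [V [Veta [s ->]]] := germP (a : stalk eta) => nz.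
have /top : open (V `&` U) by apply: openI; apply: oset_open.
case=> [|E VUE]; first exact: subIsetr.
have : (V `&` U) eta by [].
rewrite {1}VUE => -[_ /existsNP[g /not_implyP[Eg npg]]].
pose D g := Opens (dist g).1.
have DU h : D h `<=` U by move=> x [].
have DV : D g `<=` V.
  move=> x [Ux npx]; suff : (V `&` U) x by case.
  by rewrite VUE; split=> // /(_ g Eg).
have Dg : oset (D g) eta by [].
have [[r gr] lsurj _] := loc g (D g) (DU g) erefl.
have [n [b sb]] := lsurj (res DV s).
have [b0|/eqP nb0] := eqVneq b 0.
  case: nz; rewrite -(germ_res Veta Dg DV).
  have -> : res DV s = 0; last by rewrite germ0.
  rewrite -[LHS]mulr1 -(expr1n _ n) -gr exprMn mulrA sb b0.
  by rewrite !rmorph0 mul0r.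
have Db : oset (D b) eta.
  apply: (generic_point_open geta); first exact: oset_open.
  by apply/set0P/eqP => /((dist b).2).
have [[r' br] _ _] := loc b (D b) (DU b) erefl.
exists (germ Dg (res (DU g) (phi g) ^+ n) * germ Db r').
rewrite mulrA -(germ_res Veta Dg DV) -germM sb germ_res.
by rewrite -(germ_res Ueta Db (DU b)) -germM br germ1.
Qed.

Lemma function_field_nonzero (k : fieldType) (X : variety k) :
  (1 : function_field X) != 0.
Proof.
set eta := generic_pt X.
have [U Ueta [A [phi [p [pr pbij top loc]]]]] := scheme_affine eta.
apply/eqP; rewrite -(germ1 Ueta) -(germ0 Ueta) => /germ_eq.
move=> [W [hW [hW' [Weta]]]]; rewrite rmorph1 rmorph0 => W10.
have /top : open (W : set X) by apply: oset_open.
case=> [|E WE]; first exact: hW.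
have : oset W eta by [].
rewrite WE => -[_ /existsNP[g /not_implyP[Eg npg]]].
have oD : open [set x | oset U x /\ ~ p x g].
  apply/top; first by move=> x [].
  exists [set g]; apply/seteqP; split=> x /= [Ux np]; split=> //.
    by apply: contra_not np => /(_ g erefl).
  by apply: contra_not np => pg _ ->.
have DU : Opens oD `<=` U by move=> x [].
have DW : Opens oD `<=` W.
  by move=> x [Ux npx]; rewrite WE; split=> // /(_ g Eg).
have [_ _ /(_ 1)] := loc g (Opens oD) DU erefl.
case=> [|n].
  by rewrite rmorph1 rmorph1 -(rmorph1 (res DW)) W10 rmorph0.
rewrite mulr1 => gn; have [p0 _ _ np1 pM] := pr _ Ueta.
have {gn} : p eta (g ^+ n) by rewrite gn.
by elim: n => [|n IH]; rewrite ?expr0 // exprS => /pM[].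
Qed.

HB.instance Definition _ (k : fieldType) (X : variety k) :=
  GRing.PzSemiRing_isNonZero.Build (function_field X)
    (function_field_nonzero X).

Definition function_field_inv (k : fieldType) (X : variety k)
    (a : function_field X) : function_field X :=
  if pselect (invertible a) is left h then projT1 (cid h) else 0.

Lemma function_field_mulVf (k : fieldType) (X : variety k)
    (a : function_field X) : a != 0 -> function_field_inv a * a = 1.
Proof.
move=> /eqP/function_field_invertible ia; rewrite /function_field_inv.
by case: pselect => // h; case: cid => b /= <-; rewrite mulrC.
Qed.

Lemma function_field_inv0 (k : fieldType) (X : variety k) :
  function_field_inv (0 : function_field X) = 0.
Proof.
rewrite /function_field_inv; case: pselect => // -[b b0]; exfalso.
by have /eqP := function_field_nonzero X; apply; rewrite -b0 mul0r.
Qed.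

HB.instance Definition _ (k : fieldType) (X : variety k) :=
  GRing.ComNzRing_isField.Build (function_field X)
    (@function_field_mulVf k X) (@function_field_inv0 k X).

(* [f^* k(X)], the image of the pullback of rational functions.  A finite flat
   [f] is dominant, hence fixes the generic point [eta], and [f^*] is the map
   [O_(X, f eta) -> O_(X, eta)]. *)
Definition pullback_field (k : fieldType) (X : variety k) (f : kmap X X)
    : set (function_field X) :=
  range (@stalk_map X X f (generic_pt X)).

Definition topological_degree (k : fieldType) (X : variety k) (f : kmap X X)
    : nat :=
  extension_degree (pullback_field f).

(* Main.v *)
(* The walk started at [x] which jumps from [y] to a uniformly chosen point of
   [f^-1 y] has entropy at most [ln #f^-n(x)] after [n] steps, and a step
   contributes [ln d_f] whenever it starts in the dense open set [U] over which
   [f] has [d_f] points in its fibres. As fibres never have more than [d_f]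
   points, it suffices that the walk visits a proper closed set [Z0] with
   asymptotic frequency zero. Otherwise an ultrafilter limit of the frequencies
   of visits is a finitely additive [f]-invariant [mu] with [mu Z0 > 0]. Let [Z]
   be minimal among the closed subsets of [Z0] with [mu Z > 0]. By recurrence
   and minimality [Z] is contained in [f^-p Z] for some [p > 0], and then
   [f^-p Z \ Z] is [mu]-null. If it were not empty, going down and going up
   would give [mu]-almost every point of [Z] an [f^p]-preimage outside [Z], which
   the walk reaches with probability at least [d_f^-p]: a contradiction. Hence
   [f^-p Z = Z], and the backward orbit of [x] is contained in the union of the
   [f^-i Z] with [i < p], which contradicts its density. *)

Require Import Defs.
From HB Require Import structures.
From mathcomp Require Import all_boot all_order all_algebra all_field.
From mathcomp Require Import fingroup perm generic_quotient.
From mathcomp Require Import finmap all_classical all_reals all_analysis.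
From mathcomp Require Import ring lra zify.
Import Order.TTheory GRing.Theory Num.Theory numFieldNormedType.Exports.
Set Implicit Arguments.
Unset Strict Implicit.
Unset Printing Implicit Defensive.
Local Open Scope classical_set_scope.
Local Open Scope ring_scope.

(** * Ideals *)

(** [X] need not be normal, so the bound of a fibre by [d_f] must come from flatness: the
    normalization of a nodal curve is finite of degree 1 and has a fibre with two points. Flatness,
    given on stalks, is used through one consequence: if [b u(a)] lies in [I B], then [b] lies in
    [(I : a) B]. It yields the injectivity of [f^#], going down, and the linear independence of as
    many functions as a fibre has points. Separability gives the converse bound: over a dense open
    set the minimal polynomial of a primitive element specializes to one with [d_f] distinct roots
    in [k]. Being an ultrafilter limit, [mu] is only finitely additive, so every argument about it
    is finite: recurrence is a counting argument, and the minimal [Z] exists because [X] is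
    noetherian. The walk lives on rational points, while going down and up produce points such as
    the generic point of [Z], which the walk may never visit. Hence an escaping preimage of that
    generic point has to be spread to all points of [Z] off a proper closed subset, by a form of
    openness derived from finiteness. *)

Definition is_ideal (A : comPzRingType) (I : set A) : Prop :=
  [/\ I 0, forall a b, I a -> I b -> I (a + b) & forall a b, I b -> I (a * b)].

Section Ideals.
Context {A : comPzRingType}.
Implicit Types (I : set A) (a b : A).

Lemma prime_is_ideal (p : set A) : prime_ideal p -> is_ideal p.
Proof. by case. Qed.

Lemma idl0 I : is_ideal I -> I 0. Proof. by case. Qed.

Lemma idlD I a b : is_ideal I -> I a -> I b -> I (a + b).
Proof. by case=> _ + _; apply. Qed.

Lemma idlMl I a b : is_ideal I -> I b -> I (a * b).
Proof. by case=> _ _; apply. Qed.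

Lemma idlMr I a b : is_ideal I -> I a -> I (a * b).
Proof. by rewrite mulrC; apply: idlMl. Qed.

Lemma idlN I a : is_ideal I -> I a -> I (- a).
Proof. by move=> iI Ia; rewrite -mulN1r; apply: idlMl. Qed.

Lemma idlB I a b : is_ideal I -> I a -> I b -> I (a - b).
Proof. by move=> iI Ia Ib; apply: idlD => //; apply: idlN. Qed.

Lemma idlBr I a b : is_ideal I -> I (a - b) -> I b -> I a.
Proof. by move=> iI Iab Ib; rewrite -(subrK b a); apply: idlD. Qed.

Lemma idl_sum I (T : Type) (r : seq T) (P : pred T) (F : T -> A) :
  is_ideal I -> (forall i, P i -> I (F i)) -> I (\sum_(i <- r | P i) F i).
Proof.
by move=> iI IF; apply: big_ind => //; [exact: idl0 | move=> *; exact: idlD].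
Qed.

Lemma idl_prodB I (T : Type) (r : seq T) (F G : T -> A) :
  is_ideal I -> (forall i, I (F i - G i)) ->
  I (\prod_(i <- r) F i - \prod_(i <- r) G i).
Proof.
move=> iI FG; elim: r => [|i r IH]; first by rewrite !big_nil subrr; apply: idl0.
rewrite !big_cons.
have -> : F i * \prod_(j <- r) F j - G i * \prod_(j <- r) G j =
  (\prod_(j <- r) F j) * (F i - G i)
  + G i * (\prod_(j <- r) F j - \prod_(j <- r) G j) by ring.
by apply: idlD => //; apply: idlMl.
Qed.

Lemma prime_prod (p : set A) (T : eqType) (r : seq T) (F : T -> A) :
  prime_ideal p -> p (\prod_(i <- r) F i) -> exists2 i, i \in r & p (F i).
Proof.
case=> _ _ _ np1 pM; elim: r => [|i r IH]; first by rewrite big_nil.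
rewrite big_cons => /pM[pF|/IH[j jr pF]]; first by exists i; rewrite ?mem_head.
by exists j; rewrite // inE jr orbT.
Qed.

Lemma prime_exp (p : set A) a n : prime_ideal p -> p (a ^+ n) -> p a.
Proof.
case=> _ _ _ np1 pM; elim: n => [|n IH]; first by rewrite expr0.
by rewrite exprS => /pM[|/IH].
Qed.

Lemma prime_nmul (p : set A) a b : prime_ideal p -> ~ p a -> ~ p b -> ~ p (a * b).
Proof. by case=> _ _ _ _ pM pa pb /pM[]. Qed.

End Ideals.

Definition colon (A : comPzRingType) (I : set A) (a : A) : set A :=
  [set c | I (c * a)].

Lemma colon_ideal (A : comPzRingType) (I : set A) (a : A) :
  is_ideal I -> is_ideal (colon I a).
Proof.
move=> iI; split; rewrite /colon /=.
- by rewrite mul0r; apply: idl0.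
- by move=> b c Ib Ic; rewrite mulrDl; apply: idlD.
- by move=> b c Ic; rewrite -mulrA; apply: idlMl.
Qed.

(* The ideal [I B], as an intersection of ideals so that no sums occur. *)
Definition ext (A B : comPzRingType) (u : A -> B) (I : set A) : set B :=
  [set b | forall J, is_ideal J -> (forall a, I a -> J (u a)) -> J b].

Lemma ext_ideal (A B : comPzRingType) (u : A -> B) (I : set A) :
  is_ideal (ext u I).
Proof.
split=> /=.
- by move=> J iJ _; apply: idl0.
- by move=> a b ha hb J iJ h; apply: idlD; [|apply: ha|apply: hb].
- by move=> a b hb J iJ h; apply: idlMl => //; apply: hb.
Qed.

Lemma ext_in (A B : comPzRingType) (u : A -> B) (I : set A) a :
  I a -> ext u I (u a).
Proof. by move=> Ia J _; apply. Qed.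

Lemma ext_sub (A B : comPzRingType) (u : A -> B) (I : set A) (J : set B) :
  is_ideal J -> I `<=` u @^-1` J -> ext u I `<=` J.
Proof. by move=> iJ IJ b; apply. Qed.

(** Combinations with coefficients in [I] form an ideal: a product [c * e i] is expanded again in
    the generators. They contain [u a] for [a] in [I], by expanding 1. *)
Lemma ext_span (A B : comPzRingType) (u : {rmorphism A -> B}) n
    (e : 'I_n -> B) (I : set A) :
  is_ideal I -> (forall b, exists a : 'I_n -> A, b = \sum_i u (a i) * e i) ->
  forall b, ext u I b ->
  exists2 a : 'I_n -> A, (forall i, I (a i)) & b = \sum_i u (a i) * e i.
Proof.
move=> iI gen b eb.
apply: (eb [set b | exists2 a : 'I_n -> A, (forall i, I (a i))
  & b = \sum_i u (a i) * e i]); first split=> /=.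
- exists (fun=> 0) => [_|]; first exact: idl0.
  by rewrite big1 // => i _; rewrite rmorph0 mul0r.
- move=> _ _ [a Ia ->] [a' Ia' ->]; exists (fun i => a i + a' i).
    by move=> i; apply: idlD.
  by rewrite -big_split; apply: eq_bigr => i _; rewrite rmorphD mulrDl.
- move=> c _ [a Ia ->].
  have /choice[m hm] : forall i, exists m : 'I_n -> A, c * e i = \sum_j u (m j) * e j.
    by move=> i; apply: gen.
  exists (fun j => \sum_i a i * m i j).
    by move=> j; apply: idl_sum => // i _; apply: idlMr.
  rewrite mulr_sumr (eq_bigr (fun i => \sum_j u (a i * m i j) * e j)).
    rewrite exchange_big; apply: eq_bigr => j _.
    by rewrite rmorph_sum mulr_suml.
  move=> i _; rewrite mulrCA hm mulr_sumr.
  by apply: eq_bigr => j _; rewrite rmorphM mulrA.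
- move=> a Ia; have [c ec] := gen 1; exists (fun i => a * c i).
    by move=> i; apply: idlMr.
  rewrite -[LHS]mulr1 ec mulr_sumr.
  by apply: eq_bigr => i _; rewrite rmorphM mulrA.
Qed.

(** Krull: an ideal that is maximal among those containing [I] and disjoint from the multiplicative
    set [S] is prime. *)
Lemma prime_avoiding (A : comPzRingType) (I S : set A) :
  is_ideal I -> S 1 -> (forall a b, S a -> S b -> S (a * b)) ->
  (forall a, I a -> ~ S a) ->
  exists p, [/\ prime_ideal p, I `<=` p & forall a, p a -> ~ S a].
Proof.
move=> iI S1 SM IS.
pose P J := J = set0 \/ [/\ is_ideal J, I `<=` J & forall a, J a -> ~ S a].
have [F FP Ftot|M [PM Mmax]] := @Zorn_bigcup A P.
  have [[J0 FJ0 [a0 J0a0]]|noJ] := pselect (exists2 J, F J & J !=set0); last first.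
    left; apply/seteqP; split=> // a [J FJ Ja]; apply: noJ.
    by exists J => //; exists a.
  have idF J a : F J -> J a ->
    [/\ is_ideal J, I `<=` J & forall a, J a -> ~ S a].
    by move=> /FP[->|].
  right; split.
  - split.
    + by exists J0 => //; have [/idl0] := idF _ _ FJ0 J0a0.
    + move=> a b [J FJ Ja] [K FK Kb].
      have [iJ _ _] := idF _ _ FJ Ja; have [iK _ _] := idF _ _ FK Kb.
      by case: (Ftot _ _ FJ FK) => sub; [exists K|exists J] => //;
        apply: idlD => //; apply: sub.
    + move=> a b [J FJ Jb]; exists J => //; apply: idlMl => //.
      by have [] := idF _ _ FJ Jb.
  - move=> a Ia; exists J0 => //; have [_ + _] := idF _ _ FJ0 J0a0; exact.
  - by move=> a [J FJ Ja]; have [_ _] := idF _ _ FJ Ja; apply.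
have {PM}[iM IM MS] : [/\ is_ideal M, I `<=` M & forall a, M a -> ~ S a].
  case: PM => // M0; exfalso; apply: (Mmax I); last by right; split.
  by rewrite M0; apply/properW_neq || split=> //; move=> /(_ 0 (idl0 iI)).
have ext1 a : ~ M a -> exists c m, M m /\ S (m + c * a).
  move=> nMa; apply: contrapT => nS; apply: (Mmax [set m + c * a | m in M & c in setT]).
    split=> [m Mm|sub]; first by exists m => //; exists 0 => //; rewrite mul0r addr0.
    apply/nMa/sub; exists 0; first exact: idl0.
    by exists 1 => //; rewrite add0r mul1r.
  right; split.
  - split.
    + by exists 0; [exact: idl0|exists 0 => //; rewrite mul0r addr0].
    + move=> _ _ [m Mm [c _ <-]] [m' Mm' [c' _ <-]].
      exists (m + m'); first exact: idlD.
      by exists (c + c') => //; ring.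
    + move=> b _ [m Mm [c _ <-]]; exists (b * m); first exact: idlMl.
      by exists (b * c) => //; ring.
  - move=> m /IM Mm; exists m => //; exists 0 => //; ring.
  - by move=> _ [m Mm [c _ <-]] Ss; apply: nS; exists c, m.
exists M; split=> //; split.
- exact: idl0.
- by move=> a b; apply: idlD.
- by move=> a b; apply: idlMl.
- by move=> /MS.
- move=> a b Mab; apply: contrapT => /not_orP[/ext1[c [m [Mm Sm]]] /ext1[d [k [Mk Sk]]]].
  apply: (MS _ _ (SM _ _ Sm Sk)).
  have -> : (m + c * a) * (k + d * b) =
    (k + d * b) * m + (c * a) * k + (c * d) * (a * b) by ring.
  by apply: idlD => //; [apply: idlD => //|]; apply: idlMl.
Qed.

(** Multiplication by the adjugate: the determinant trick behind Cayley-Hamilton, with the relations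
    required only modulo [q]. *)
Lemma det_ideal (A B : comPzRingType) (u : {rmorphism A -> B}) (q : set B) n
    (M : 'M[A]_n) (v : 'I_n -> B) :
  is_ideal q -> (forall i, q (\sum_j u (M i j) * v j)) ->
  forall j, q (u (\det M) * v j).
Proof.
move=> iq Mv j.
have -> : u (\det M) * v j = \sum_i u ((\adj M) j i) * \sum_l u (M i l) * v l.
  under eq_bigr => i _ do rewrite mulr_sumr.
  rewrite exchange_big /= (bigD1 j) //= [X in _ + X]big1 ?addr0.
    have := congr1 (fun N : 'M[A]_n => N j j) (mul_adj_mx M).
    rewrite [LHS]mxE [RHS]mxE eqxx mulr1n.
    move=> <-; rewrite rmorph_sum mulr_suml.
    by apply: eq_bigr => i _; rewrite rmorphM mulrA.
  move=> l lj; have := congr1 (fun N : 'M[A]_n => N j l) (mul_adj_mx M).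
  rewrite [LHS]mxE [RHS]mxE eq_sym (negPf lj) mulr0n => /(congr1 u).
  rewrite rmorph0 rmorph_sum.
  move=> /(congr1 (fun b => b * v l)); rewrite mul0r mulr_suml => E.
  by rewrite -[RHS]E; apply: eq_bigr => i _; rewrite rmorphM mulrA.
by apply: idl_sum => // i _; apply: idlMl.
Qed.

(** Modulo [I] only the identity survives in the Leibniz formula: every other permutation moves an
    index and so picks an off-diagonal entry. *)
Lemma det_diagonal_mod (A : comPzRingType) (I : set A) n (M : 'M[A]_n)
    (s : 'I_n -> A) :
  is_ideal I -> (forall i j, I (M i j - (i == j)%:R * s i)) ->
  I (\det M - \prod_i s i).
Proof.
move=> iI MI; rewrite /determinant (bigD1 (1%g : 'S_n)) //= odd_perm1 expr0 mul1r addrAC.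
apply: idlD => //.
  apply: idl_prodB => // i; have := MI i i.
  by rewrite perm1 eqxx mul1r.
apply: idl_sum => // g g1; apply: idlMl => //.
have [i gi] : exists i, g i != i.
  apply/existsP; apply: contra_neqT g1 => /existsPn fix_g.
  by apply/permP => i; rewrite perm1; apply/eqP; have := fix_g i; rewrite negbK.
rewrite (bigD1 i) //=; apply: idlMr => //.
by have := MI i (g i); rewrite eq_sym (negPf gi) mul0r subr0.
Qed.

(** Sections form a [comPzRingType], while the results on polynomials are stated over a
    [comNzRingType]. An equality of structures lets all data over [A] be carried along by
    rewriting. *)
Lemma nonzero_ring (A : comPzRingType) :
  (1 : A) <> 0 -> exists A' : comNzRingType, A = A'.
Proof.
move=> /eqP A1.
pose A' : comNzRingType := HB.pack (GRing.ComPzRing.sort A)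
  (GRing.PzSemiRing_isNonZero.Build (GRing.ComPzRing.sort A) A1).
by exists A'; case: A A1 @A' => T [? ? ? ? ? ? ? ?].
Qed.

Lemma prime_neq0 (A : comPzRingType) (p : set A) : prime_ideal p -> (1 : A) <> 0.
Proof. by case=> p0 _ _ np1 _ E; apply: np1; rewrite E. Qed.

(** By [prime_avoiding] it suffices that [q + m B] does not meet the image of the complement of [m].
    If [u s = x + y] with [x] in [q] and [y] in [m B], multiplication by [y] has a matrix with
    entries in [m]. The determinant of [s] minus this matrix is [s ^+ n] modulo [m]; it multiplies
    [B] into [q], hence lies in [m], and so does [s]. *)
Lemma going_up (A B : comPzRingType) (u : {rmorphism A -> B}) (q : set B)
    (m : set A) :
  module_finite u -> prime_ideal q -> prime_ideal m -> u @^-1` q `<=` m ->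
  exists q', [/\ prime_ideal q', q `<=` q' & u @^-1` q' = m].
Proof.
move=> [n [e gen]] pq pm qm.
have iq := prime_is_ideal pq; have im := prime_is_ideal pm.
have ie := ext_ideal u m.
have [m0 _ _ nm1 mM] := pm.
pose I := [set x + y | x in q & y in ext u m].
have iI : is_ideal I.
  split.
  - by exists 0; [exact: idl0|exists 0; [exact: (idl0 ie)|rewrite addr0]].
  - move=> _ _ [x qx [y ey <-]] [x' qx' [y' ey' <-]].
    exists (x + x'); first exact: idlD.
    by exists (y + y'); [exact: (idlD ie)|ring].
  - move=> b _ [x qx [y ey <-]]; exists (b * x); first exact: idlMl.
    by exists (b * y); [exact: (idlMl _ ie)|ring].
have IS b : I b -> ~ (u @` ~` m) b.
  move=> [x qx [y ey <-]] [s nms us].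
  have /choice[c hc] : forall i, exists c : 'I_n -> A,
      (forall j, m (c j)) /\ y * e i = \sum_j u (c j) * e j.
    by move=> i; have [c mc ec] := ext_span im gen (idlMr (e i) ie ey); exists c.
  pose M : 'M[A]_n := s%:M - \matrix_(i, j) c i j.
  have detM j : q (u (\det M) * e j).
    apply: (det_ideal iq) => i.
    have -> : \sum_j u (M i j) * e j = x * e i; last exact: idlMr.
    have [_ yc] := hc i; have -> : x = u s - y by rewrite us addrK.
    rewrite mulrBl yc (eq_bigr (fun j => u (s *+ (i == j)) * e j - u (c i j) * e j)).
      rewrite sumrB; congr (_ - _); rewrite (bigD1 i) //= eqxx mulr1n big1 ?addr0 //.
      by move=> l li; rewrite eq_sym (negPf li) mulr0n rmorph0 mul0r.
    by move=> l _; rewrite !mxE rmorphB mulrBl.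
  have mdet : m (\det M).
    apply: qm => /=; have [a ea] := gen 1; rewrite -[X in q X]mulr1 ea mulr_sumr.
    by apply: idl_sum => // i _; rewrite mulrCA; apply: idlMl.
  have dM : m (\det M - \prod_(i < n) s).
    apply: (det_diagonal_mod im) => i j.
    have [mc _] := hc i; have -> : M i j - (i == j)%:R * s = - c i j.
      by rewrite !mxE mulr_natl addrAC subrr add0r.
    exact: idlN.
  suff ms : m s by exact: (nms ms).
  apply: (prime_exp (n := n)) => //; rewrite -(card_ord n) -prodr_const.
  by rewrite -[X in m X](subKr (\det M)); apply: idlB.
have [|a b [s ns <-] [t nt <-]|q' [pq' Iq' q'S]] := prime_avoiding iI _ _ IS.
- by exists 1; rewrite // rmorph1.
- by exists (s * t); [exact: prime_nmul|rewrite rmorphM].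
exists q'; split=> //.
  by move=> x qx; apply: Iq'; exists x => //; exists 0; [exact: (idl0 ie)|rewrite addr0].
apply/seteqP; split=> a /= qa.
  by apply: contrapT => nma; apply: (q'S _ qa); exists a.
by apply: Iq'; exists 0; [exact: idl0|exists (u a); [exact: ext_in|rewrite add0r]].
Qed.

(** * Integrality and flatness *)

Definition peval (A B : comNzRingType) (u : {rmorphism A -> B}) (b : B) :=
  horner_morph (fun x => mulrC b (u x)).
HB.instance Definition _ (A B : comNzRingType) (u : {rmorphism A -> B}) (b : B) :=
  GRing.RMorphism.copy (peval u b) (horner_morph (fun x => mulrC b (u x))).

Lemma pevalC (A B : comNzRingType) (u : {rmorphism A -> B}) (b : B) a :
  peval u b a%:P = u a.
Proof. exact: horner_morphC. Qed.

Lemma pevalX (A B : comNzRingType) (u : {rmorphism A -> B}) (b : B) :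
  peval u b 'X = b.
Proof. exact: horner_morphX. Qed.

(** The characteristic polynomial of multiplication by [b]: the determinant trick is applied over
    [{poly A}], with ['X] acting as [b]. *)
Lemma integral_equation (A B : comNzRingType) (u : {rmorphism A -> B}) (b : B) :
  module_finite u -> exists2 p : {poly A}, p \is monic & peval u b p = 0.
Proof.
move=> [n [e gen]].
have /choice[c hc] : forall i, exists c : 'I_n -> A, b * e i = \sum_j u (c j) * e j.
  by move=> i; apply: gen.
pose M := char_poly_mx (\matrix_(i, j) c i j).
exists (\det M); first exact: char_poly_monic.
have i0 : is_ideal [set 0 : B].
  by split=> // [x y -> ->|x y ->]; rewrite ?addr0 ?mulr0.
have detM := @det_ideal _ _ (peval u b) _ _ M e i0.
have [a ea] := gen 1; rewrite -[LHS]mulr1 ea mulr_sumr big1 // => j _.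
rewrite mulrCA [X in _ * X]detM ?mulr0 // => i /=.
rewrite (eq_bigr (fun j => (b *+ (i == j)) * e j - u (c i j) * e j)); last first.
  move=> l _; rewrite !mxE rmorphB rmorphMn /= pevalX pevalC.
  by rewrite mulrBl.
rewrite sumrB -hc (bigD1 i) //= eqxx mulr1n big1 ?addr0 ?subrr //.
by move=> l li; rewrite eq_sym (negPf li) mulr0n mul0r.
Qed.

(* [B / q] is a domain integral over the image of [A], so that a nonzero
   element of it divides a nonzero element of the image of [A]. *)
Lemma integral_multiple (A B : comPzRingType) (u : {rmorphism A -> B})
    (q : set B) (b : B) :
  module_finite u -> prime_ideal q -> ~ q b ->
  exists c a, ~ q (u a) /\ q (b * c - u a).
Proof.
move=> fu pq nqb.
have A1 : (1 : A) <> 0.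
  move=> E; apply: (prime_neq0 pq).
  by rewrite -(rmorph1 u) E rmorph0.
have [A' EA] := nonzero_ring A1.
have [B' EB] := nonzero_ring (prime_neq0 pq).
case: _ / (esym EA) u fu A1 => u fu _; move: q b pq nqb u fu.
case: _ / (esym EB) => q b pq nqb u fu.
have [p pm pb] := integral_equation b fu.
have iq := prime_is_ideal pq.
have : q (peval u b p) by rewrite pb; apply: idl0.
have : exists i, ~ q (u p`_i).
  exists (size p).-1; have /eqP := monicP pm; rewrite lead_coefE => /eqP ->.
  by rewrite rmorph1; case: pq.
(* Constant terms lying in [q] are stripped: then [peval u b p * b] is in [q] and [b] is not, so the
   relation passes to [p]. The first constant term outside [q] is, modulo [q], the wanted multiple
   of [b]. *)
move: {pb pm} p; apply: poly_ind => [|p a IH].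
  by move=> [i]; rewrite coef0 rmorph0 => /(_ (idl0 iq)).
move=> [i nqi]; rewrite rmorphD rmorphM /= pevalX pevalC => qpa.
have [qa|nqa] := pselect (q (u a)); last first.
  exists (- peval u b p), a; split=> //.
  have -> : b * - peval u b p - u a = - (peval u b p * b + u a) by ring.
  exact: idlN.
apply: IH; last first.
  have [_ _ _ _ qM] := pq.
  have /qM[] : q (peval u b p * b) by apply: (idlBr iq _ (idlN iq qa)); rewrite opprK.
  - by [].
  - by [].
case: i nqi => [|i]; first by rewrite coefD coefMX coefC eqxx add0r.
by rewrite coefD coefMX coefC /= addr0; exists i.
Qed.

(** * Quotient modules and their tensor products *)

Section QuotientModule.
Variables (A : comPzRingType) (I : set A) (iI : is_ideal I).
Local Open Scope quotient_scope.

Let cong (a b : A) : bool := `[< I (a - b) >].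

Let cong_refl : reflexive cong.
Proof. by move=> a; apply/asboolP; rewrite subrr; apply: idl0. Qed.

Let cong_sym : symmetric cong.
Proof.
by move=> a b; apply/asboolP/asboolP => h; rewrite -opprB; apply: idlN.
Qed.

Let cong_trans : transitive cong.
Proof.
move=> b a c /asboolP h /asboolP k; apply/asboolP.
by rewrite -(subrK b a) -addrA; apply: idlD.
Qed.

Canonical cong_equiv := EquivRel cong cong_refl cong_sym cong_trans.

(** Made into an [A]-module below, since [flat_ring_map] tests injective linear maps of modules. *)
Definition quot : Type := {eq_quot cong_equiv}.
HB.instance Definition _ := Choice.copy quot {eq_quot cong_equiv}.

Definition qpi (a : A) : quot := \pi_({eq_quot cong_equiv}) a.

Lemma qpi_eq a b : qpi a = qpi b <-> I (a - b).
Proof.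
split=> [/eqP|h]; last by apply/eqP; rewrite eqmodE; apply/asboolP.
by rewrite eqmodE => /asboolP.
Qed.

Definition qrepr (x : quot) : A := repr x.

Lemma qreprK x : qpi (qrepr x) = x.
Proof. exact: reprK. Qed.

Lemma qpiP x : exists a, x = qpi a.
Proof. by exists (qrepr x); rewrite qreprK. Qed.

Lemma qrepr_pi a : I (qrepr (qpi a) - a).
Proof. by apply/qpi_eq; rewrite qreprK. Qed.

Definition quot_add x y := qpi (qrepr x + qrepr y).
Definition quot_opp x := qpi (- qrepr x).
Definition quot_scale a x := qpi (a * qrepr x).

Lemma quot_addE a b : quot_add (qpi a) (qpi b) = qpi (a + b).
Proof.
apply/qpi_eq; have -> : qrepr (qpi a) + qrepr (qpi b) - (a + b) =
  (qrepr (qpi a) - a) + (qrepr (qpi b) - b) by ring.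
by apply: idlD => //; apply: qrepr_pi.
Qed.

Lemma quot_oppE a : quot_opp (qpi a) = qpi (- a).
Proof.
apply/qpi_eq; have -> : - qrepr (qpi a) - - a = - (qrepr (qpi a) - a) by ring.
by apply: idlN => //; apply: qrepr_pi.
Qed.

Lemma quot_scaleE a b : quot_scale a (qpi b) = qpi (a * b).
Proof.
by apply/qpi_eq; rewrite -mulrBr; apply: idlMl => //; apply: qrepr_pi.
Qed.

Lemma quot_addA : associative quot_add.
Proof.
move=> x y z; have [a ->] := qpiP x; have [b ->] := qpiP y; have [c ->] := qpiP z.
by rewrite !quot_addE addrA.
Qed.

Lemma quot_addC : commutative quot_add.
Proof.
move=> x y; have [a ->] := qpiP x; have [b ->] := qpiP y.
by rewrite !quot_addE addrC.
Qed.

Lemma quot_add0 : left_id (qpi 0) quot_add.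
Proof. by move=> x; have [a ->] := qpiP x; rewrite quot_addE add0r. Qed.

Lemma quot_addN : left_inverse (qpi 0) quot_opp quot_add.
Proof. by move=> x; have [a ->] := qpiP x; rewrite quot_oppE quot_addE addNr. Qed.

HB.instance Definition _ :=
  GRing.isZmodule.Build quot quot_addA quot_addC quot_add0 quot_addN.

Lemma qpiD a b : qpi (a + b) = qpi a + qpi b.
Proof. by rewrite -quot_addE. Qed.

Lemma qpiN a : qpi (- a) = - qpi a.
Proof. by rewrite -quot_oppE. Qed.

Lemma quot_scaleA a b x : quot_scale a (quot_scale b x) = quot_scale (a * b) x.
Proof. by have [c ->] := qpiP x; rewrite !quot_scaleE mulrA. Qed.

Lemma quot_scale1 : left_id 1 quot_scale.
Proof. by move=> x; have [c ->] := qpiP x; rewrite quot_scaleE mul1r. Qed.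

Lemma quot_scaleDr : right_distributive quot_scale +%R.
Proof.
move=> a x y; have [b ->] := qpiP x; have [c ->] := qpiP y.
by rewrite -qpiD !quot_scaleE -qpiD mulrDr.
Qed.

Lemma quot_scaleDl x : {morph quot_scale^~ x : a b / a + b}.
Proof.
by move=> a b; have [c ->] := qpiP x; rewrite !quot_scaleE -qpiD mulrDl.
Qed.

HB.instance Definition _ := GRing.Zmodule_isLmodule.Build A quot
  quot_scaleA quot_scale1 quot_scaleDr quot_scaleDl.

Lemma qpiZ a b : qpi (a * b) = a *: qpi b.
Proof. by rewrite -quot_scaleE. Qed.

Lemma qpi0 a : qpi a = 0 <-> I a.
Proof. by rewrite -[a in I a]subr0; apply: qpi_eq. Qed.

End QuotientModule.

Section ColonMap.
Variables (A : comPzRingType) (I : set A) (iI : is_ideal I) (a : A).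

Definition colon_map (x : quot (colon_ideal a iI)) : quot iI :=
  qpi iI (qrepr x * a).

Lemma colon_mapE c : colon_map (qpi _ c) = qpi iI (c * a).
Proof.
by apply/qpi_eq; rewrite -mulrBl; apply: (qrepr_pi (colon_ideal a iI) c).
Qed.

Lemma colon_map_inj : injective colon_map.
Proof.
move=> x y; have [b ->] := qpiP x; have [c ->] := qpiP y.
by rewrite !colon_mapE => /qpi_eq; rewrite -mulrBl => h; apply/qpi_eq.
Qed.

Lemma colon_map_zmod_morphism : zmod_morphism colon_map.
Proof.
move=> x y; have [b ->] := qpiP x; have [c ->] := qpiP y.
by rewrite -qpiN -qpiD !colon_mapE -qpiN -qpiD mulrBl.
Qed.

Lemma colon_map_scalable : scalable colon_map.
Proof.
by move=> c x; have [b ->] := qpiP x; rewrite -qpiZ !colon_mapE -qpiZ mulrA.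
Qed.

HB.instance Definition _ := GRing.isZmodMorphism.Build _ _ colon_map
  colon_map_zmod_morphism.
HB.instance Definition _ := GRing.isScalable.Build _ _ _ _ colon_map
  colon_map_scalable.

End ColonMap.

Section TensorQuotient.
Variables (A B : comPzRingType) (u : {rmorphism A -> B}).

Lemma tensor_mull (N : lmodType A) c (s t : seq (B * N)) :
  tensor_eq u s t ->
  tensor_eq u [seq (c * x.1, x.2) | x <- s] [seq (c * x.1, x.2) | x <- t].
Proof.
elim=> {s t} [s|s t _ h|s t r _ h _ k|s s' t t' _ h _ k|s t|n|b b' n|b n n'|a b n] /=.
- exact: tensor_refl.
- exact: tensor_sym.
- exact: tensor_trans h k.
- by rewrite !map_cat; apply: tensor_cat.
- by rewrite !map_cat; apply: tensor_comm.
- by rewrite mulr0; apply: tensor_zero.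
- by rewrite mulrDr; apply: tensor_addl.
- exact: tensor_addr.
- by rewrite mulrCA; apply: tensor_scale.
Qed.

Variables (I : set A) (iI : is_ideal I).

Lemma tensor_ext b :
  ext u I b -> tensor_eq u [:: (b, qpi iI 1)] [::].
Proof.
move=> eb; apply: (eb [set b | tensor_eq u [:: (b, qpi iI 1)] [::]]).
  split=> /= [|c d hc hd|c d /(tensor_mull c)//].
    exact: tensor_zero.
  apply: tensor_trans (tensor_addl _ _ _ _) _.
  by rewrite -[X in tensor_eq _ X]cat1s -[X in tensor_eq _ _ X]cat0s; apply: tensor_cat.
move=> a Ia /=; rewrite -[u a]mulr1; apply: tensor_trans (tensor_scale _ _ _ _) _.
rewrite -qpiZ mulr1 (qpi0 iI a).2 //.
have := tensor_scale u 0 1 (0 : quot iI); rewrite scale0r rmorph0 mul0r => h.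
exact: tensor_trans (tensor_sym h) (tensor_zero _ _).
Qed.

(** The map from [B (x) A / I] to [B / I B] sending [b (x) a] to [b u(a)] is well defined; [qrepr]
    is additive and linear only up to elements of [I]. With [tensor_ext], this decides when
    [b (x) 1] vanishes. *)
Lemma tensor_quot_ext (s t : seq (B * quot iI)) :
  tensor_eq u s t ->
  ext u I (\sum_(x <- s) x.1 * u (qrepr x.2) - \sum_(x <- t) x.1 * u (qrepr x.2)).
Proof.
have iE := ext_ideal u I; have inE a := @ext_in _ _ u I a.
elim=> {s t} [s|s t _|s t r _ h _ k|s s' t t' _ h _ k|s t|n|b b' n|b n n'|a b n] /=.
- by rewrite subrr; apply: (idl0 iE).
- by move=> h; rewrite -opprB; apply: (idlN iE).
- rewrite -(subrK (\sum_(x <- t) x.1 * u (qrepr x.2)) (\sum_(x <- s) _)) -addrA.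
  exact: (idlD iE).
- by rewrite !big_cat opprD addrACA; apply: (idlD iE).
- by rewrite !big_cat /= [X in _ - X]addrC subrr; apply: (idl0 iE).
- by rewrite big_seq1 big_nil mul0r subrr; apply: (idl0 iE).
- rewrite big_cons big_nil !big_cons big_nil /= mulrDl !addr0 subrr.
  exact: (idl0 iE).
- rewrite big_cons big_nil !big_cons big_nil /= !addr0 -mulrDr -mulrBr.
  rewrite -!rmorphD -rmorphB; apply: (idlMl _ iE); apply: inE.
  by apply/(qpi_eq iI); rewrite qreprK qpiD !qreprK.
- rewrite big_cons big_nil big_cons big_nil /= !addr0.
  rewrite [u a * b]mulrC -mulrA -rmorphM -mulrBr -rmorphB.
  apply: (idlMl _ iE); apply: inE.
  by apply/(qpi_eq iI); rewrite qreprK qpiZ !qreprK.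
Qed.

End TensorQuotient.

(* Multiplication by [a] embeds [A / (I : a)] into [A / I]; this remains so after
   tensoring with a flat algebra. *)
Lemma flat_colon (A B : comPzRingType) (u : {rmorphism A -> B}) (I : set A) a b :
  flat_ring_map u -> is_ideal I -> ext u I (b * u a) -> ext u (colon I a) b.
Proof.
move=> fu iI /(tensor_ext iI) tI.
pose iC := colon_ideal a iI.
have t1 : tensor_eq u [:: (b, qpi iI (1 * a))] [::].
  apply: tensor_trans tI; apply: tensor_sym.
  rewrite mulrC; apply: tensor_trans (tensor_scale _ _ _ _) _.
  by rewrite -qpiZ mulr1 mul1r; apply: tensor_refl.
have := fu _ _ (@colon_map A I iI a) (@colon_map_inj _ _ iI a) [:: (b, qpi iC 1)].
rewrite /= colon_mapE => /(_ t1)/tensor_quot_ext.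
rewrite big_seq1 big_nil subr0 /= => h.
have iE := ext_ideal u (colon I a).
have -> : b = b * u (1 - qrepr (qpi iC 1)) + b * u (qrepr (qpi iC 1)).
  by rewrite -mulrDr -rmorphD subrK rmorph1 mulr1.
apply: (idlD iE) => //; apply: (idlMl _ iE).
by apply: ext_in; apply/(qpi_eq iC); rewrite qreprK.
Qed.

(** * Affine open sets and their primes *)

(* The prime of [sec U] corresponding to [x], when [U] is affine and contains
   [x]; all of [sec U] when [x] is not in [U]. *)
Definition van (X : ringed_space) (U : opens X) (x : X) : set (sec U) :=
  [set s | forall Ux : oset U x, ~ invertible (germ Ux s)].

Lemma vanE (X : ringed_space) (U : opens X) (x : X) (Ux : oset U x) (s : sec U) :
  van x s <-> ~ invertible (germ Ux s).
Proof.
split=> [|ns]; first exact.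
by move=> Ux'; rewrite (germ_irr Ux' Ux).
Qed.

Lemma nvanE (X : ringed_space) (U : opens X) (x : X) (Ux : oset U x) (s : sec U) :
  ~ van x s <-> invertible (germ Ux s).
Proof. by rewrite (vanE Ux) notK. Qed.

(** The ring [A] and the map [p] of a chart are replaced by [sec U] and [van]. As [U] is the
    distinguished open set of 1, [phi] is bijective. If [a] is outside [p x], it is invertible on
    its distinguished open set. Conversely, an inverse of its germ is a fraction [c / g ^+ n] near
    [x], and [g ^+ n - a * c] is killed by a power of [g], which keeps [a] out of [p x]. *)
Lemma affine_van (X : ringed_space) (U : opens X) :
  affine_open U ->
  [/\ forall x, oset U x -> prime_ideal (@van X U x),
      forall q, prime_ideal q -> exists! x, oset U x /\ @van X U x = q,
      forall V : set X, V `<=` U ->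
        (open V <-> exists E : set (sec U),
           V = [set x | oset U x /\ ~ (E `<=` van x)])
    & forall (g : sec U) (V : opens X) (h : V `<=` U),
        oset V = [set x | oset U x /\ ~ van x g] -> is_localization g (res h)].
Proof.
move=> [A [phi [p [pr pbij top loc]]]].
have oD g : open [set x | oset U x /\ ~ p x g].
  apply/top; first by move=> x [].
  exists [set g]; apply/seteqP; split=> x /= [Ux np]; split=> //.
    by apply: contra_not np => /(_ g erefl).
  by apply: contra_not np => pg _ ->.
have DU g : Opens (oD g) `<=` U by move=> x [].
have U1 : oset U = [set x | oset U x /\ ~ p x 1].
  apply/seteqP; split=> x /= => [Ux|[]//]; split=> //.
  by case: (pr x Ux).
have [_ surj1 inj1] := loc 1 U (@subset_refl _ U) U1.
have phi_inj a : phi a = 0 -> a = 0.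
  by move=> pa; have [|n] := inj1 a; rewrite ?pa ?rmorph0 // expr1n mul1r.
have phi_surj s : exists a, s = phi a.
  have [n [a]] := surj1 s; rewrite res_id rmorph1 expr1n mulr1 res_id => ->.
  by exists a.
have vanp x a : oset U x -> van x (phi a) <-> p x a.
  move=> Ux; have [p0 pD pMl np1 pM] := pr x Ux; rewrite (vanE Ux); split.
    apply: contra_notP => npa.
    have [[r ar] _ _] := loc a (Opens (oD a)) (DU a) erefl.
    have Dx : oset (Opens (oD a)) x by [].
    exists (germ Dx r).
    by rewrite -(germ_res Ux Dx (DU a)) -germM ar germ1.
  move=> pa [b]; have [W [Wx [t ->]]] := germP b.
  pose UW := opensI U W; have UWx : oset UW x by [].
  have hU : UW `<=` U by apply: subIsetl.
  have hW : UW `<=` W by apply: subIsetr.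
  rewrite -(germ_res Ux UWx hU) -(germ_res Wx UWx hW) -germM -(germ1 UWx).
  move=> /germ_eq[W' [k [k' [W'x]]]].
  rewrite rmorphM rmorph1.
  have W'U := subset_trans k hU.
  have [E W'E] := (top _ W'U).1 (oset_open W').
  have : oset W' x by [].
  rewrite W'E => -[_ /existsNP[g /not_implyP[Eg npg]]].
  have DW' : Opens (oD g) `<=` W'.
    by move=> y [Uy npy]; rewrite W'E; split=> // /(_ g Eg).
  move=> /(congr1 (res DW')); rewrite rmorphM rmorph1 => at1.
  have [[r gr] surj inj] := loc g (Opens (oD g)) (DU g) erefl.
  have [n [c tc]] := surj (res DW' (res k (res hW t))).
  have [|m] := inj (g ^+ n - a * c).
    rewrite rmorphB rmorphM rmorphB rmorphM /= rmorphXn rmorphXn -tc.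
    rewrite mulrA -[res (DU g) (phi a)](res_comp W'U DW' (DU g)).
    by rewrite -(res_comp hU k W'U) at1 mul1r subrr.
  rewrite mulrBr -exprD => /eqP; rewrite subr_eq0 => /eqP E0.
  have : p x (g ^+ (m + n)).
    by rewrite E0; apply: (pMl); rewrite mulrC; apply: pMl.
  by move=> /(prime_exp (pr x Ux)).
split.
- move=> x Ux; have [p0 pD pMl np1 pM] := pr x Ux; split.
  + by rewrite -(rmorph0 phi); apply/vanp.
  + move=> s t; have [a ->] := phi_surj s; have [b ->] := phi_surj t.
    by rewrite -rmorphD !vanp //; apply: pD.
  + move=> s t; have [a ->] := phi_surj s; have [b ->] := phi_surj t.
    by rewrite -rmorphM !vanp //; apply: pMl.
  + by rewrite -(rmorph1 phi) vanp.
  + move=> s t; have [a ->] := phi_surj s; have [b ->] := phi_surj t.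
    by rewrite -rmorphM !vanp //; apply: pM.
- move=> q [q0 qD qMl nq1 qM].
  have pq : prime_ideal (phi @^-1` q).
    split=> /=; rewrite ?rmorph0 ?rmorph1 //.
    + by move=> a b; rewrite rmorphD; apply: qD.
    + by move=> a b; rewrite rmorphM; apply: qMl.
    + by move=> a b; rewrite rmorphM; apply: qM.
  have [x [[Ux px] uniq_x]] := pbij _ pq; exists x; split.
    split=> //; apply/seteqP; split=> s; have [a ->] := phi_surj s.
      by rewrite vanp // px.
    by move=> qa; rewrite vanp // px.
  move=> y [Uy vy]; apply: uniq_x; split=> //.
  by apply/seteqP; split=> a /=; rewrite -vy vanp.
- move=> V VU; rewrite top //; split=> -[E ->].
    exists (phi @` E); apply/seteqP; split=> x /= [Ux nE]; split=> //.
      by apply: contra_not nE => sub a Ea; apply/vanp => //; apply: sub; exists a.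
    apply: contra_not nE => sub _ [a Ea <-].
    by apply/vanp => //; apply: sub.
  exists (phi @^-1` E); apply/seteqP; split=> x /= [Ux nE]; split=> //.
    apply: contra_not nE => sub s; have [a ->] := phi_surj s.
    by move=> Ea; apply/vanp => //; apply: sub.
  by apply: contra_not nE => sub a Ea; apply/vanp => //; apply: sub.
- move=> g V h; have [a ->] := phi_surj g => Va.
  have [|inv surj inj] := loc a V h.
    by rewrite Va; apply/seteqP; split=> x /= [Ux npa]; split=> //; rewrite vanp // in npa *.
  split=> // [s|s].
    by have [n [c e]] := surj s; exists n, (phi c).
  have [c ->] := phi_surj s => /inj[n ac0]; exists n.
  by rewrite -rmorphXn -rmorphM ac0 rmorph0.
Qed.

Section AffineStalk.
Variables (X : ringed_space) (U : opens X) (aU : affine_open U).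

Lemma van_prime x : oset U x -> prime_ideal (@van X U x).
Proof. by have [h _ _ _] := affine_van aU; apply: h. Qed.

Lemma van_ideal x : oset U x -> is_ideal (@van X U x).
Proof. by move=> Ux; apply/prime_is_ideal/van_prime. Qed.

Lemma van_onto q : prime_ideal q -> exists2 x, oset U x & @van X U x = q.
Proof.
by have [_ h _ _] := affine_van aU => /h[x [[Ux vx] _]]; exists x.
Qed.

Lemma van_inj x y : oset U x -> oset U y -> @van X U x = @van X U y -> x = y.
Proof.
move=> Ux Uy vxy; have [_ h _ _] := affine_van aU.
have [z [_ uz]] := h _ (van_prime Ux).
by rewrite -(uz x) // -(uz y).
Qed.

Lemma affine_open_sets (E : set (sec U)) :
  open [set x | oset U x /\ ~ (E `<=` van x)].
Proof. by have [_ _ top _] := affine_van aU; apply/top; [move=> x []|exists E]. Qed.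

Lemma affine_distinguished (g : sec U) : open [set x | oset U x /\ ~ van x g].
Proof.
rewrite (_ : mkset _ = [set x | oset U x /\ ~ ([set g] `<=` @van X U x)]).
  exact: affine_open_sets.
apply/seteqP; split=> x /= [Ux np]; split=> //.
  by apply: contra_not np => /(_ g erefl).
by apply: contra_not np => pg _ ->.
Qed.

Lemma affine_basis x (V : set X) : open V -> V x -> oset U x ->
  exists g : sec U, ~ van x g /\ forall y, oset U y -> ~ van y g -> V y.
Proof.
move=> oV Vx Ux; have [_ _ top _] := affine_van aU.
have /top : open (V `&` U) by apply: openI => //; apply: oset_open.
case=> [|E VUE]; first exact: subIsetr.
have : (V `&` U) x by [].
rewrite {1}VUE => -[_ /existsNP[g /not_implyP[Eg npg]]].
exists g; split=> // y Uy npy; suff : (V `&` U) y by case.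
by rewrite VUE; split=> // /(_ g Eg).
Qed.

Lemma affine_specialize x y : oset U x -> oset U y ->
  closure [set x] y <-> @van X U x `<=` van y.
Proof.
move=> Ux Uy; split=> [cl g vg|sub].
  apply: contrapT => nvg.
  have /cl[_ [->]] : nbhs y [set z | oset U z /\ ~ van z g].
    by apply: open_nbhs_nbhs; split=> //; apply: affine_distinguished.
  by case.
move=> N; rewrite nbhsE => -[V [oV Vy] VN]; exists x; split=> //; apply: VN.
have [g [nvg gV]] := affine_basis oV Vy Uy.
by apply: gV => //; apply: contra_not nvg; apply: sub.
Qed.

(** With [affine_germ0]: the stalk at [x] is the localization of [sec U] at the prime [van x]. *)
Lemma affine_stalk_frac x (Ux : oset U x) (a : stalk x) :
  exists s z : sec U, ~ van x s /\ a * germ Ux s = germ Ux z.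
Proof.
have [V [Vx [t ->]]] := germP a.
have [g [nvg gV]] := affine_basis (oset_open V) Vx Ux.
pose D := Opens (affine_distinguished g).
have DU : D `<=` U by move=> y [].
have DV : D `<=` V by move=> y [Uy /gV]; apply.
have Dx : oset D x by [].
have [_ _ _ loc] := affine_van aU.
have [_ surj _] := loc g D DU erefl.
have [n [z e]] := surj (res DV t); exists (g ^+ n), z; split.
  by move=> /(prime_exp (van_prime Ux)).
by rewrite -(germ_res Vx Dx DV) -!(germ_res Ux Dx DU) -germM -e rmorphXn.
Qed.

Lemma affine_germ0 x (Ux : oset U x) (z : sec U) :
  germ Ux z = 0 -> exists2 s, ~ van x s & s * z = 0.
Proof.
rewrite -(germ0 Ux) => /germ_eq[V [h [h' [Vx]]]]; rewrite rmorph0 => z0.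
have [g [nvg gV]] := affine_basis (oset_open V) Vx Ux.
pose D := Opens (affine_distinguished g).
have DU : D `<=` U by move=> y [].
have DV : D `<=` V by move=> y [Uy /gV]; apply.
have [_ _ _ loc] := affine_van aU.
have [_ _ inj] := loc g D DU erefl.
have [|n gz] := inj z; first by rewrite -(res_comp h DV DU) z0 rmorph0.
by exists (g ^+ n) => // /(prime_exp (van_prime Ux)).
Qed.

End AffineStalk.

Lemma van_comor (X Y : scheme) (f : scheme_map X Y) (V : opens Y) (y : X)
    (s : sec V) : oset V (f y) ->
  van (U := mpreim f V) y (comor f V s) <-> van (f y) s.
Proof.
move=> Vy; rewrite (vanE (Vy : oset (mpreim f V) y)) (vanE Vy).
rewrite -(stalk_mapE Vy); split; apply: contra_not => -[b e].
  by exists (stalk_map b); rewrite -rmorphM e rmorph1.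
by apply: (scheme_map_local (s := f)); exists b.
Qed.

(** Flatness on stalks brought down to a chart: [flat_colon] is applied to the local rings at [f y]
    and [y], and clearing denominators costs a factor [t] that does not vanish at [y]. *)
Lemma flat_colon_affine (X Y : scheme) (f : scheme_map X Y) (V : opens Y)
    (I : set (sec V)) (a : sec V) (b : sec (mpreim f V)) (y : X) :
  flat_map f -> affine_open V -> affine_open (mpreim f V) -> oset V (f y) ->
  is_ideal I -> ext (comor f V) I (b * comor f V a) ->
  exists2 t, ~ van y t & ext (comor f V) (colon I a) (t * b).
Proof.
move=> ff aV aW Vy iI eb.
have Wy : oset (mpreim f V) y := Vy.
have pV := van_prime aV Vy; have pW := van_prime aW Wy.
have [_ _ _ np1 _] := pV; have [_ _ _ nq1 _] := pW.
pose S := @stalk_map X Y f y.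
have Sg s : S (germ Vy s) = germ Wy (comor f V s) by rewrite /S stalk_mapE; apply: germ_irr.
(* The extension of [I] to the local ring at [f y], as a set of fractions. *)
pose Ie : set (stalk (f y)) :=
  [set c | exists s z, [/\ ~ van (f y) s, I z & c * germ Vy s = germ Vy z]].
have iIe : is_ideal Ie.
  split=> /=.
  - exists 1, 0; split=> //; first exact: idl0.
    by rewrite mul0r germ0.
  - move=> c c' [s [z [ns Iz e]]] [s' [z' [ns' Iz' e']]].
    exists (s * s'), (s' * z + s * z'); split; first exact: prime_nmul.
      by apply: idlD => //; apply: idlMl.
    rewrite germD !germM -e -e'; ring.
  - move=> d c [s [z [ns Iz e]]].
    have [r [w [nr er]]] := affine_stalk_frac aV Vy d.
    exists (s * r), (w * z); split; [exact: prime_nmul|exact: idlMl|].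
    rewrite !germM -e -er; ring.
have h1 : ext S Ie (germ Wy b * S (germ Vy a)).
  rewrite Sg -germM; have iE := ext_ideal S Ie.
  apply: (eb [set b | ext S Ie (germ Wy b)]) => [|z Iz] /=.
    split=> /= [|c d|c d].
    - by rewrite germ0; apply: (idl0 iE).
    - by rewrite germD; apply: (idlD iE).
    - by rewrite germM; apply: (idlMl _ iE).
  rewrite -Sg; apply: ext_in; exists 1, z; split=> //.
  by rewrite germ1 mulr1.
pose C := colon I a; have iC : is_ideal C by apply: colon_ideal.
have iEC := ext_ideal (comor f V) C.
have /(_ [set d | exists t c, [/\ ~ van y t, ext (comor f V) C c
    & d * germ Wy t = germ Wy c]]) := flat_colon (u := S) (ff y) iIe h1.
case.
- split=> /=.
  + exists 1, 0; split=> //; first exact: (idl0 iEC).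
    by rewrite mul0r germ0.
  + move=> d d' [t [c [nt Ec e]]] [t' [c' [nt' Ec' e']]].
    exists (t * t'), (t' * c + t * c'); split; first exact: prime_nmul.
      by apply: (idlD iEC); apply: (idlMl _ iEC).
    rewrite germD !germM -e -e'; ring.
  + move=> g d [t [c [nt Ec e]]].
    have [r [w [nr er]]] := affine_stalk_frac aW Wy g.
    exists (t * r), (w * c); split; [exact: prime_nmul|exact: (idlMl _ iEC)|].
    rewrite !germM -e -er; ring.
- move=> c [s [z [ns Iz e]]].
  have [r [w [nr er]]] := affine_stalk_frac aV Vy c.
  have [|v nv e0] := @affine_germ0 _ _ aV _ Vy (w * a * s - z * r).
    rewrite germD germN !germM -e -er.
    by apply/eqP; rewrite subr_eq0; apply/eqP; ring.
  exists (comor f V (r * s * v)), (comor f V (w * s * v)); split.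
  + by rewrite van_comor //; do !apply: prime_nmul.
  + apply: ext_in; rewrite /C /colon /=.
    have -> : w * s * v * a = (v * r) * z + v * (w * a * s - z * r) by ring.
    by rewrite e0 addr0; apply: idlMl.
  + by rewrite -!Sg -rmorphM !germM -er; congr (S _); ring.
- move=> t [c [nt Ec]]; rewrite -germM => e.
  have [|v nv e0] := @affine_germ0 _ _ aW _ Wy (b * t - c).
    by rewrite germD germN e subrr.
  exists (v * t); first exact: prime_nmul.
  have -> : v * t * b = v * c + v * (b * t - c) by ring.
  by rewrite e0 addr0; apply: (idlMl _ iEC).
Qed.

(** * Noetherian spaces and generic points *)

Section Noetherian.
Variable B : comPzRingType.
Implicit Types (S I J : set B) (e : B).

Definition is_subring S : Prop :=
  [/\ S 1, forall a b, S a -> S b -> S (a - b) & forall a b, S a -> S b -> S (a * b)].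

Definition ideal_of S I : Prop :=
  [/\ I `<=` S, I 0, forall a b, I a -> I b -> I (a + b)
    & forall a b, S a -> I b -> I (a * b)].

(** The chain condition is stated for subrings of one fixed ring, so that generators can be adjoined
    one at a time inside [B]. *)
Definition noetherian S : Prop :=
  forall I : nat -> set B, (forall n, ideal_of S (I n)) ->
  (forall n, I n `<=` I n.+1) -> exists N, forall n, (N <= n)%N -> I n = I N.

Definition poly_span S e n : set B :=
  [set b | exists c : nat -> B, (forall i, S (c i)) /\ b = \sum_(i < n) c i * e ^+ i].

Definition adjoin S e : set B := [set b | exists n, poly_span S e n b].

Lemma subring0 S : is_subring S -> S 0.
Proof. by case=> S1 SB _; rewrite -(subrr 1); apply: SB. Qed.

Lemma subringN S a : is_subring S -> S a -> S (- a).
Proof.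
move=> sS Sa; have [_ SB _] := sS; rewrite -sub0r; apply: SB => //.
exact: subring0.
Qed.

Lemma subringD S a b : is_subring S -> S a -> S b -> S (a + b).
Proof.
move=> sS Sa Sb; have [_ SB _] := sS; rewrite -[b]opprK; apply: SB => //.
exact: subringN.
Qed.

Lemma chain_mono (F : nat -> set B) :
  (forall n, F n `<=` F n.+1) -> forall m n, (m <= n)%N -> F m `<=` F n.
Proof.
move=> FS m n /subnKC <-; elim: (n - m)%N => [|d IH]; first by rewrite addn0.
by rewrite addnS; apply: subset_trans IH (FS _).
Qed.

Section Adjoin.
Variables (S : set B) (e : B).
Hypothesis sS : is_subring S.

Lemma poly_spanB n b c :
  poly_span S e n b -> poly_span S e n c -> poly_span S e n (b - c).
Proof.
move=> [x [Sx ->]] [y [Sy ->]]; exists (fun i => x i - y i); split.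
  by move=> i; have [_ SB _] := sS; apply: SB.
by rewrite -sumrB; apply: eq_bigr => i _; rewrite mulrBl.
Qed.

Lemma poly_spanW m n b : (m <= n)%N -> poly_span S e m b -> poly_span S e n b.
Proof.
move=> mn [x [Sx ->]]; exists (fun i => if (i < m)%N then x i else 0); split.
  by move=> i; case: ifP => // _; apply: subring0.
rewrite (big_ord_widen n (fun i => x i * e ^+ i) mn) big_mkcond /=.
by apply: eq_bigr => i _; case: ifP => // _; rewrite mul0r.
Qed.

Lemma poly_spanZ n a b : S a -> poly_span S e n b -> poly_span S e n (a * b).
Proof.
move=> Sa [x [Sx ->]]; exists (fun i => a * x i); split.
  by move=> i; have [_ _ SM] := sS; apply: SM.
by rewrite mulr_sumr; apply: eq_bigr => i _; rewrite mulrA.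
Qed.

Lemma poly_spanX n b : poly_span S e n b -> poly_span S e n.+1 (e * b).
Proof.
move=> [x [Sx ->]]; exists (fun i => if i is j.+1 then x j else 0); split.
  by case=> [|i] //; apply: subring0.
rewrite big_ord_recl mul0r add0r mulr_sumr.
by apply: eq_bigr => i _; rewrite mulrCA -exprS.
Qed.

Lemma poly_span0 n : poly_span S e n 0.
Proof.
exists (fun=> 0); split; first by move=> _; apply: subring0.
by rewrite big1 // => i _; rewrite mul0r.
Qed.

Lemma poly_spanD n b c :
  poly_span S e n b -> poly_span S e n c -> poly_span S e n (b + c).
Proof.
move=> hb hc; rewrite -[c]opprK; apply: poly_spanB => //.
by rewrite -sub0r; apply: poly_spanB => //; apply: poly_span0.
Qed.

Lemma poly_spanM m n b c :
  poly_span S e m b -> poly_span S e n c -> poly_span S e (m + n) (b * c).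
Proof.
move=> [x [Sx ->]] hc; rewrite mulr_suml.
apply: big_ind => [||i _]; [exact: poly_span0|exact: poly_spanD|].
rewrite -mulrA; apply: poly_spanZ => //; case: i => i /= im.
apply: (@poly_spanW (i + n)); first by rewrite leq_add2r ltnW.
elim: i {im} => [|i IH]; first by rewrite expr0 mul1r.
by rewrite exprS -mulrA addSn; apply: poly_spanX.
Qed.

Lemma sub_adjoin : S `<=` adjoin S e.
Proof.
move=> a Sa; exists 1%N, (fun=> a); split=> //.
by rewrite big_ord1 expr0 mulr1.
Qed.

Lemma mem_adjoin : adjoin S e e.
Proof.
have [S1 _ _] := sS; exists 2, (fun i => if i == 1 then 1 else 0); split.
  by move=> i; case: ifP => // _; apply: subring0.
by rewrite !big_ord_recl big_ord0 /= mul0r add0r addr0 expr1 mul1r.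
Qed.

Lemma adjoin_subring : is_subring (adjoin S e).
Proof.
split.
- by have [S1 _ _] := sS; apply: sub_adjoin.
- move=> b c [m hb] [n hc]; exists (maxn m n); apply: poly_spanB.
    exact: poly_spanW (leq_maxl m n) hb.
  exact: poly_spanW (leq_maxr m n) hc.
- by move=> b c [m hb] [n hc]; exists (m + n)%N; apply: poly_spanM.
Qed.

(** Leading coefficients of the members of [I] that can be written as polynomials in [e] of degree
    at most [n]. As [e] may satisfy relations over [S], such a writing is not unique, and all of
    them count. *)
Definition leads n (I : set B) : set B :=
  [set s | S s /\ exists2 r, poly_span S e n r & I (s * e ^+ n + r)].

Lemma leads_ideal n I : ideal_of (adjoin S e) I -> ideal_of S (leads n I).
Proof.
move=> [_ I0 ID IM]; split.
- by move=> s [].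
- split; first exact: subring0.
  by exists 0; [exact: poly_span0|rewrite mul0r addr0].
- move=> a b [Sa [r hr Ir]] [Sb [t ht It]]; split; first exact: subringD.
  exists (r + t); first exact: poly_spanD.
  by rewrite mulrDl addrACA; apply: ID.
- move=> a b Sa [Sb [r hr Ir]]; split; first by have [_ _ SM] := sS; apply: SM.
  exists (a * r); first exact: poly_spanZ.
  by rewrite -mulrA -mulrDr; apply: IM => //; apply: sub_adjoin.
Qed.

Lemma leadsS n I : ideal_of (adjoin S e) I -> leads n I `<=` leads n.+1 I.
Proof.
move=> [_ I0 ID IM] a [Sa [r hr Ir]]; split=> //.
exists (e * r); first exact: poly_spanX.
by rewrite exprS mulrCA -mulrDr; apply: IM => //; apply: mem_adjoin.
Qed.

Lemma leads_sub n I J : I `<=` J -> leads n I `<=` leads n J.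
Proof. by move=> IJ a [Sa [r hr Ir]]; split=> //; exists r => //; apply: IJ. Qed.

(** From an element of [J] subtract one of [I] with the same leading coefficient: the difference is
    in [J] and of lower degree, so induction on the degree applies. *)
Lemma leads_eq I J : ideal_of (adjoin S e) I -> ideal_of (adjoin S e) J ->
  I `<=` J -> (forall n, leads n J `<=` leads n I) -> I = J.
Proof.
move=> [_ I0 ID IM] [JA J0 JD JM] IJ lJI; apply/seteqP; split=> // b Jb.
have [n] := JA _ Jb; elim: n b Jb => [|n IH] b Jb [c [Sc eb]].
  by rewrite eb big_ord0.
move: eb; rewrite big_ord_recr /= addrC; set r := \sum_(i < n) _ => eb.
have hr : poly_span S e n r by exists c.
have [_ [t ht It]] : leads n I (c n).
  by apply: lJI; split=> //; exists r; rewrite // -eb.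
have -> : b = (c n * e ^+ n + t) + (r - t) by rewrite eb; ring.
apply: ID => //; apply: IH; last exact: poly_spanB.
have -> : r - t = b + (-1) * (c n * e ^+ n + t) by rewrite eb; ring.
apply: JD => //; apply: JM; last exact: IJ.
by apply: sub_adjoin; apply: subringN => //; case: sS.
Qed.

(** Hilbert's basis theorem. The diagonal chain [leads n (I n)] is stationary from some [N] on,
    which settles all degrees from [N] up; the finitely many lower degrees each have their own
    bound. *)
Lemma noetherian_adjoin : noetherian S -> noetherian (adjoin S e).
Proof.
move=> nS I iI IS; have Im := chain_mono IS.
have lm n m : (n <= m)%N -> forall i j, (i <= j)%N -> leads n (I i) `<=` leads m (I j).
  move=> nm i j ij; have h := leads_sub (n := n) (Im _ _ ij); apply: subset_trans h _.
  by apply: (chain_mono (F := fun n => leads n (I j))) nm => k; apply: leadsS.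
have [|n|N hN] := nS (fun n => leads n (I n)); first by move=> n; apply: leads_ideal.
  exact: lm.
have /choice[M hM] : forall n, exists M, forall m, (M <= m)%N ->
    leads n (I m) = leads n (I M).
  move=> n; apply: (nS (fun m => leads n (I m))) => m; first exact: leads_ideal.
  exact: leads_sub.
pose K := maxn N (\max_(n < N) M n); exists K => m Km; apply/esym.
apply: leads_eq => // [|n]; first exact: Im.
have [nN|Nn] := ltnP n N.
  have MK : (M n <= K)%N.
    by rewrite leq_max (@leq_bigmax _ (fun n : 'I_N => M n) (Ordinal nN)) orbT.
  by rewrite !hM // (leq_trans MK).
have NK : (N <= K)%N by apply: leq_maxl.
have hj j : (N <= j)%N -> leads n (I j) = leads N (I N).
  move=> Nj; apply/seteqP; split; last exact: lm.
  rewrite -(hN (maxn n j)); last by rewrite leq_max Nn.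
  by apply: lm; rewrite ?leq_maxl ?leq_maxr.
by rewrite !hj // (leq_trans NK).
Qed.

End Adjoin.

Lemma noetherian_fg_algebra (k : fieldType) (u : {rmorphism k -> B}) :
  finitely_generated_algebra u -> noetherian setT.
Proof.
move=> [es gen].
have sk : is_subring (range u).
  split; first by exists 1; rewrite // rmorph1.
    by move=> _ _ [a _ <-] [b _ <-]; exists (a - b); rewrite // rmorphB.
  by move=> _ _ [a _ <-] [b _ <-]; exists (a * b); rewrite // rmorphM.
have nk : noetherian (range u).
  move=> I iI IS; have Im := chain_mono IS.
  have [[N [b Ib b0]]|all0] := pselect (exists N, exists2 b, I N b & b != 0).
    have allN n : (N <= n)%N -> I n = range u.
      move=> Nn; have [Iu _ _ IM] := iI n; apply/seteqP; split=> // c uc.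
      have [a _ ab] := Iu _ (Im _ _ Nn _ Ib).
      have a0 : a != 0 by apply: contraNneq b0 => a0; rewrite -ab a0 rmorph0.
      rewrite -[c]mulr1 -(rmorph1 u) -(mulVf a0) rmorphM mulrA ab.
      apply: IM; last exact: (Im _ _ Nn).
      by have [_ _ uM] := sk; apply: uM => //; exists a^-1.
    by exists N => n Nn; rewrite !allN.
  exists 0%N => n _; have z m : I m = [set 0].
    apply/seteqP; split=> b; last by move=> ->; have [] := iI m.
    by move=> Ib; apply/eqP/negPn/negP => b0; apply: all0; exists m, b.
  by rewrite !z.
pose A := foldl adjoin (range u) es.
have [sA nA uA eA] : [/\ is_subring A, noetherian A, range u `<=` A
    & forall e, e \in es -> A e].
  rewrite {}/A; elim: es (range u) sk nk {gen}.
    by move=> S sS nS; split.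
  move=> e es IH S sS nS /=.
  have [sA nA SA eA] := IH (adjoin S e) (adjoin_subring e sS) (noetherian_adjoin sS nS).
  split=> //; first by apply: subset_trans SA; apply: sub_adjoin.
  move=> e'; rewrite inE => /orP[/eqP->|/eA//].
  by apply: SA; apply: mem_adjoin.
suff <- : A = setT by [].
apply/seteqP; split=> // b _; apply: (gen A) => //.
- by move=> a; apply: uA; exists a.
- by move=> *; apply: subringD.
- by case: sA.
Qed.

End Noetherian.

Definition kmor (k : fieldType) (X : kscheme k) (U : opens X) :
    {rmorphism k -> sec U} :=
  res (@subsetT _ U : U `<=` opensT X) \o kstr X.

Definition vanishing (X : ringed_space) (U : opens X) (Z : set X) : set (sec U) :=
  [set s | forall x, oset U x -> Z x -> van x s].

Lemma vanishing_closed (X : ringed_space) (U : opens X) (Z : set X) x :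
  affine_open U -> closed Z -> oset U x -> (vanishing Z `<=` @van X U x) -> Z x.
Proof.
move=> aU cZ Ux sub; apply: contrapT => nZx.
have [g [nvg gZ]] := affine_basis aU (closed_openC cZ) nZx Ux.
apply/nvg/sub => y Uy Zy; apply: contrapT => nvy.
by apply: (gZ y).
Qed.

(** A closed set is recovered from its vanishing ideals on finitely many charts, and each chart has
    a noetherian ring. *)
Lemma closed_chain_stationary (k : fieldType) (X : kscheme k) (Z : nat -> set X) :
  finite_type X -> (forall n, closed (Z n)) -> (forall n, Z n.+1 `<=` Z n) ->
  exists N, forall n, (N <= n)%N -> Z n = Z N.
Proof.
move=> [r [U [cov hU]]] cZ ZS.
have /choice[N hN] : forall i, exists N, forall n, (N <= n)%N ->
    vanishing (U := U i) (Z n) = vanishing (Z N).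
  move=> i; have [aU fg] := hU i.
  apply: (@noetherian_fg_algebra _ _ (kmor (U i)) fg (fun n => vanishing (Z n))).
    move=> n; split=> // [x Ux _|a b ha hb x Ux Zx|a b _ hb x Ux Zx].
    - exact: idl0 (van_ideal aU Ux).
    - by apply: (idlD (van_ideal aU Ux)); [apply: ha|apply: hb].
    - by apply: (idlMl _ (van_ideal aU Ux)); apply: hb.
  by move=> n s hs x Ux Zx; apply: hs => //; apply: ZS.
pose K := \max_(i < r) N i; exists K => n Kn.
have NK i : (N i <= K)%N by apply: leq_bigmax.
suff sub m m' : (K <= m)%N -> (K <= m')%N -> Z m `<=` Z m'.
  by apply/seteqP; split; apply: sub.
move=> Km Km' x Zx; have [i Ux] := cov x; have [aU _] := hU i.
apply: (vanishing_closed aU (cZ m') Ux) => s.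
rewrite (hN i) ?(leq_trans (NK i)) // -(hN i m) ?(leq_trans (NK i)) //.
exact.
Qed.

Lemma minimal_closed (k : fieldType) (X : kscheme k) (P : set (set X)) Z0 :
  finite_type X -> closed Z0 -> P Z0 ->
  exists Z, [/\ closed Z, P Z, Z `<=` Z0
    & forall Y, closed Y -> Y `<=` Z -> P Y -> Y = Z].
Proof.
move=> ft c0 P0; apply: contrapT => nmin.
have /choice[g hg] : forall Z : set X, exists Y, closed Z -> P Z -> Z `<=` Z0 ->
    [/\ closed Y, P Y, Y `<=` Z & Y <> Z].
  move=> Z; have [[cZ PZ Z0Z]|h] := pselect [/\ closed Z, P Z & Z `<=` Z0]; last first.
    by exists Z => cZ PZ ZZ0; exfalso; apply: h.
  apply: contrapT => nY; apply: nmin; exists Z; split=> // Y cY YZ PY.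
  by apply: contrapT => YneZ; apply: nY; exists Y.
pose Z n := iter n g Z0.
have hZ n : [/\ closed (Z n), P (Z n) & Z n `<=` Z0].
  elim: n => [|n [cZ PZ ZZ0]] /=; [by split|have [cY PY YZ _] := hg _ cZ PZ ZZ0].
  by split=> //; apply: subset_trans YZ ZZ0.
have hS n : Z n.+1 `<=` Z n /\ Z n.+1 <> Z n.
  by have [cZ PZ ZZ0] := hZ n; have [] := hg _ cZ PZ ZZ0.
have [N hN] := closed_chain_stationary ft (fun n => let: And3 c _ _ := hZ n in c)
  (fun n => (hS n).1).
by have [_] := hS N; apply; rewrite (hN N.+1).
Qed.

(** On a chart meeting [Z] the vanishing ideal of [Z] is prime. Its point [z] is dense in the part
    of [Z] inside the chart, and irreducibility takes care of the rest. *)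
Lemma irreducible_generic_point (X : scheme) (Z : set X) :
  closed Z -> Z !=set0 ->
  (forall A B, closed A -> closed B -> Z `<=` A `|` B -> Z `<=` A \/ Z `<=` B) ->
  exists2 z, Z z & Z `<=` closure [set z].
Proof.
move=> cZ [x0 Zx0] irr; have [U Ux0 aU] := scheme_affine x0.
have cD s : closed [set x | ~ (oset U x /\ ~ @van X U x s)].
  exact: (open_closedC (affine_distinguished aU s)).
have pq : prime_ideal (@vanishing X U Z).
  split.
  - by move=> x Ux _; apply: idl0 (van_ideal aU Ux).
  - by move=> a b ha hb x Ux Zx; apply: (idlD (van_ideal aU Ux)); [apply: ha|apply: hb].
  - by move=> a b hb x Ux Zx; apply: (idlMl _ (van_ideal aU Ux)); apply: hb.
  - by move=> /(_ _ Ux0 Zx0); have [_ _ _ n1 _] := van_prime aU Ux0.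
  - move=> a b hab; have [|sub|sub] := irr _ _ (cD a) (cD b).
    + move=> x Zx /=; have [Ux|nUx] := pselect (oset U x); last by left=> -[].
      have [_ _ _ _ vM] := van_prime aU Ux.
      by have [va|vb] := vM _ _ (hab _ Ux Zx); [left=> -[]|right=> -[]].
    + by left=> x Ux Zx; apply: contrapT => nva; apply: (sub _ Zx).
    + by right=> x Ux Zx; apply: contrapT => nva; apply: (sub _ Zx).
have [z Uz vz] := van_onto aU pq; exists z.
  by apply: (vanishing_closed aU cZ Uz); rewrite vz.
have [|//|sub] := irr (closure [set z]) _ (@closed_closure _ _)
  (open_closedC (oset_open U)).
- move=> x Zx; have [Ux|nUx] := pselect (oset U x); last by right.
  by left; apply/(affine_specialize aU Uz Ux); rewrite vz => s; apply.
- by case: (sub _ Zx0).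
Qed.

Lemma closure_point_inj (X : scheme) (x y : X) :
  closure [set x] y -> closure [set y] x -> x = y.
Proof.
move=> xy yx; have [U Uy aU] := scheme_affine y.
have Ux : oset U x.
  by have [_ [->]] := xy _ (open_nbhs_nbhs (conj (oset_open U) Uy)).
apply: (van_inj aU) => //; apply/seteqP.
by split; apply/(affine_specialize aU).
Qed.

Section VarietyAffine.
Variables (k : fieldType) (X : variety k) (U : opens X) (aU : affine_open U).

Lemma affine_nonzero_point (s : sec U) : s <> 0 -> exists2 x, oset U x & ~ van x s.
Proof.
move=> s0; apply: contrapT => nex; apply: s0.
have [pr _ top loc] := affine_van aU.
have [_] := @distinguished_open X U (sec U) idfun _ (@variety_reduced _ X) pr top loc s.
apply; rewrite -subset0 => x [Ux nvx]; by apply: nex; exists x.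
Qed.

Lemma generic_van0 (z : X) (s : sec U) :
  generic_point z -> oset U z -> van z s -> s = 0.
Proof.
move=> gz Uz vs; apply: contrapT => /affine_nonzero_point[x Ux nvx].
have [] : [set x | oset U x /\ ~ van x s] z; last by [].
apply: (generic_point_open gz (affine_distinguished aU s)).
by exists x.
Qed.

Lemma affine_domain (s t : sec U) : s * t = 0 -> s = 0 \/ t = 0.
Proof.
move=> st0; apply: contrapT => /not_orP[s0 t0].
have [x Ux nvs] := affine_nonzero_point s0; have [y Uy nvt] := affine_nonzero_point t0.
have [] := irreducible_meet (variety_irreducible X) (affine_distinguished aU s)
  (affine_distinguished aU t); [by exists x|by exists y|].
move=> z [[Uz ns] [_ nt]]; apply: (prime_nmul (van_prime aU Uz) ns nt).
by rewrite st0; apply: idl0 (van_ideal aU Uz).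
Qed.

End VarietyAffine.

(** * Finite flat endomorphisms *)

Section AlgebraicFibre.
Variables (k : fieldType) (A B : comNzRingType).
Variables (c : {rmorphism k -> A}) (u : {rmorphism A -> B}) (m : set A).
Hypotheses (fu : module_finite u) (im : is_ideal m).
Hypothesis (cm : forall a, exists l, m (a - c l)).

(* [B / m B] is a finite-dimensional vector space over [k]. *)
Lemma fibre_algebraic (b : B) :
  exists2 p : {poly k}, p != 0 & ext u m (peval (u \o c) b p).
Proof.
have [n [e gen]] := fu; have iE := ext_ideal u m.
have /choice[a ha] : forall j : 'I_n.+1, exists a : 'I_n -> A,
    b ^+ j = \sum_i u (a i) * e i by move=> j; apply: gen.
have /choice[l hl] : forall ji : 'I_n.+1 * 'I_n, exists l, m (a ji.1 ji.2 - c l).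
  by move=> ji; apply: cm.
pose M : 'M[k]_(n.+1, n) := \matrix_(j, i) l (j, i).
have kM0 : kermx M != 0.
  rewrite kermx_eq0 /row_free; apply: contraTneq (rank_leq_col M) => ->.
  by rewrite ltnn.
pose v := nz_row (kermx M).
have v0 : v != 0 by rewrite nz_row_eq0.
have vM : v *m M = 0 by apply/sub_kermxP/nz_row_sub.
exists (\poly_(j < n.+1) v 0 (inord j)).
  apply: contraNneq v0 => p0; apply/eqP/rowP => j.
  have := congr1 (fun p : {poly k} => p`_j) p0.
  by rewrite coef_poly ltn_ord coef0 inord_val !mxE.
rewrite [peval _ _ _](_ : _ = \sum_(j < n.+1) u (c (v 0 j)) * b ^+ j); last first.
  rewrite poly_def rmorph_sum; apply: eq_bigr => j _ /=.
  by rewrite -mul_polyC rmorphM rmorphXn /= pevalC pevalX inord_val.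
have -> : \sum_(j < n.+1) u (c (v 0 j)) * b ^+ j =
    \sum_i u (\sum_(j < n.+1) c (v 0 j) * a j i) * e i.
  under eq_bigr => j _ do rewrite ha mulr_sumr.
  rewrite exchange_big; apply: eq_bigr => i _; rewrite rmorph_sum mulr_suml.
  by apply: eq_bigr => j _; rewrite rmorphM mulrA.
refine (@idl_sum _ (ext u m) _ _ _ _ iE _) => i _; apply: (idlMr _ iE); apply: ext_in.
have -> : \sum_(j < n.+1) c (v 0 j) * a j i =
    \sum_(j < n.+1) c (v 0 j) * (a j i - c (l (j, i))) + c ((v *m M) 0 i).
  rewrite mxE rmorph_sum -big_split; apply: eq_bigr => j _ /=.
  by rewrite mxE rmorphM -mulrDr subrK.
rewrite vM mxE rmorph0 addr0; apply: idl_sum => // j _; apply: idlMl => //.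
exact: hl (j, i).
Qed.

Lemma kconst_nprime (q : set B) l : prime_ideal q -> l != 0 -> ~ q (u (c l)).
Proof.
move=> pq l0 ql; have [_ _ _ nq1 _] := pq; apply: nq1.
rewrite -(rmorph1 u) -(rmorph1 c) -(mulVf l0) !rmorphM.
by apply: idlMl => //; apply: prime_is_ideal.
Qed.

(** A polynomial killing [b] modulo [m B] is [r] times a power of ['X] with [r] nonzero at 0. As [b]
    is in [q], the value of [r] at [b] is a nonzero constant modulo [q], so it may serve as [t]. *)
Lemma fibre_nilpotent (q : set B) (b : B) :
  prime_ideal q -> q b -> exists N t, ~ q t /\ ext u m (t * b ^+ N).
Proof.
move=> pq qb; have [p p0 Ep] := fibre_algebraic b; have iq := prime_is_ideal pq.
have [N [r]] := multiplicity_XsubC p 0; rewrite p0 /= => r0 ep.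
exists N, (peval (u \o c) b r); split; last first.
  move: Ep; rewrite ep subr0 rmorphM rmorphXn /= pevalX; exact.
move=> qr; have r00 : r.[0] != 0 by [].
apply: (kconst_nprime pq r00).
have /factor_theorem[s] : root (r - r.[0]%:P) 0.
  by rewrite /root hornerD hornerN hornerC subrr.
rewrite subr0 => /(congr1 (peval (u \o c) b)).
rewrite rmorphB rmorphM /= pevalX pevalC /= => e.
have -> : u (c r.[0]) = peval (u \o c) b r - peval (u \o c) b s * b.
  by rewrite -e opprB addrC subrK.
by apply: idlB => //; apply: idlMl.
Qed.

End AlgebraicFibre.

(** Modulo [m B], hence modulo [q], a nonzero polynomial over [k] kills [b]; it splits into linear
    factors, and one of them lies in the prime [q]. *)
Lemma fibre_rational (k : closedFieldType) (A B : comNzRingType)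
    (c : {rmorphism k -> A}) (u : {rmorphism A -> B}) (m : set A) (q : set B) b :
  module_finite u -> is_ideal m -> (forall a, exists l, m (a - c l)) ->
  prime_ideal q -> m `<=` u @^-1` q -> exists l, q (b - u (c l)).
Proof.
move=> fu im cm pq mq; have [p p0 Ep] := fibre_algebraic fu im cm b.
have iq := prime_is_ideal pq; have /(_ _ Ep) := ext_sub iq mq.
have [_ _ _ _ qM] := pq.
have [r ->] := closed_field_poly_normal p.
rewrite -mul_polyC rmorphM /= pevalC rmorph_prod => /qM[].
  by move=> /(kconst_nprime pq); rewrite lead_coef_eq0 => /(_ p0).
move=> /(prime_prod pq)[l _]; rewrite rmorphB /= pevalX pevalC => h.
by exists l.
Qed.

Lemma kconst_comor (k : fieldType) (X Y : kscheme k) (f : kmap X Y) (V : opens Y) c :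
  comor f V (kmor V c) = kmor (mpreim f V) c.
Proof.
have hV : mpreim f V `<=` mpreim f (opensT Y) by [].
rewrite /kmor /= (comor_res f _ hV) kmap_kstr /kconst.
exact: res_comp.
Qed.

Lemma rational_section (k : fieldType) (X : kscheme k) (x : X) (U : opens X)
    (s : sec U) :
  rational_point x -> oset U x -> exists l, van x (s - kmor U l).
Proof.
move=> rx Ux; have [l h] := rx (germ Ux s); exists l; apply/(vanE Ux).
apply: contra_not h; rewrite germD germN /kmor /= (germ_res (I : oset (opensT X) x)).
exact.
Qed.

Section FiniteFlat.
Variables (k : closedFieldType) (X : variety k) (f : kmap X X).
Hypotheses (f_finite : finite_map f) (f_flat : flat_map f).

Let aW V : affine_open V -> affine_open (mpreim f V).
Proof. by case: f_finite => h _; apply: h. Qed.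

Let fW V : affine_open V -> module_finite (comor f V).
Proof. by case: f_finite => _; apply. Qed.

Lemma van_preim (V : opens X) (y : X) : oset V (f y) ->
  comor f V @^-1` (@van X (mpreim f V) y) = van (f y).
Proof. by move=> Vy; apply/seteqP; split=> s /=; rewrite van_comor. Qed.

(** The case [I = 0], [b = 1] of flatness: in the domain [sec V] the colon ideal [(0 : s)] is 0
    unless [s] is, while its extension would have to contain an element not vanishing at [y]. *)
Lemma comor_inj (V : opens X) (y : X) (s : sec V) :
  affine_open V -> oset V (f y) -> comor f V s = 0 -> s = 0.
Proof.
move=> aV Vy us0; apply: contrapT => s0.
have i0 : is_ideal [set 0 : sec V].
  by split=> // [a b -> ->|a b ->]; rewrite ?addr0 ?mulr0.
have Wy : oset (mpreim f V) y by [].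
have iq := van_ideal (aW aV) Wy.
have [|t nqt] := @flat_colon_affine _ _ f V _ s 1 y f_flat aV (aW aV) Vy i0.
  by rewrite us0 mulr0; apply: (idl0 (ext_ideal _ _)).
rewrite mulr1 => et; apply: nqt; apply: (et _ iq) => a /=.
rewrite /colon /= => /(affine_domain aV)[->|//]; rewrite rmorph0; exact: idl0.
Qed.

(** A prime containing [p B] and avoiding the products [u s * t], with [s] outside [p] and [t]
    outside [q], lies over [p] and inside [q]. It exists by flatness: [u s * t] in [p B] would put
    some [t' * t], with [t'] outside [q], into [(p : s) B], which lies in [q] because
    [(p : s) = p]. *)
Lemma going_down (y z : X) :
  closure [set z] (f y) -> exists2 y', closure [set y'] y & f y' = z.
Proof.
move=> zy; have [V Vy aV] := scheme_affine (f y).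
have Vz : oset V z.
  by have [_ [->]] := zy _ (open_nbhs_nbhs (conj (oset_open V) Vy)).
have Wy : oset (mpreim f V) y by [].
set u := comor f V; set p := @van X V z; set q := @van X (mpreim f V) y.
have pp : prime_ideal p := van_prime aV Vz.
have pq : prime_ideal q := van_prime (aW aV) Wy.
have pq_sub : p `<=` u @^-1` q.
  by rewrite van_preim //; apply/(affine_specialize aV).
have [_ _ _ np1 pM] := pp; have [_ _ _ nq1 _] := pq.
pose S : set (sec (mpreim f V)) := [set u s * t | s in ~` p & t in ~` q].
have [|b b'|b|q' [pq' extq' q'S]] := @prime_avoiding _ (ext u p) S (ext_ideal _ _).
- by exists 1 => //; exists 1 => //; rewrite rmorph1 mulr1.
- move=> [s ns [t nt <-]] [s' ns' [t' nt' <-]].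
  exists (s * s'); first exact: prime_nmul.
  by exists (t * t'); [exact: prime_nmul|rewrite rmorphM; ring].
- move=> eb [s ns [t nt e]].
  have [|t' nt' et'] := @flat_colon_affine _ _ f V p s t y f_flat aV (aW aV) Vy
    (prime_is_ideal pp).
    by rewrite mulrC e.
  apply: (prime_nmul pq nt' nt).
  apply: (et' _ (prime_is_ideal pq)) => a; rewrite /colon /= => /pM[pa|//].
  exact: pq_sub.
have [y' Wy' vy'] := van_onto (aW aV) pq'.
exists y'.
  apply/(affine_specialize (aW aV) Wy' Wy); rewrite vy' => t qt'.
  apply: contrapT => nqt; apply: (q'S _ qt'); exists 1 => //; exists t => //.
  by rewrite rmorph1 mul1r.
apply: (van_inj aV) => //; rewrite -van_preim // vy'; apply/seteqP; split=> s /=.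
  move=> q's; apply: contrapT => nps; apply: (q'S _ q's).
  by exists s => //; exists 1 => //; rewrite mulr1.
by move=> ps; apply: extq'; apply: ext_in.
Qed.

Lemma going_up_affine (V : opens X) (y1 y : X) :
  affine_open V -> oset V (f y1) -> oset V y -> closure [set f y1] y ->
  exists y', [/\ f y' = y, closure [set y1] y'
    & @van X (mpreim f V) y1 `<=` van y'].
Proof.
move=> aV Vy1 Vy cl; have Wy1 : oset (mpreim f V) y1 by [].
have [|q' [pq' qq' mq']] := going_up (fW aV) (van_prime (aW aV) Wy1) (van_prime aV Vy).
  by rewrite van_preim //; apply/(affine_specialize aV).
have [y' Wy' vy'] := van_onto (aW aV) pq'; exists y'; rewrite vy'; split=> //.
  by apply: (van_inj aV) => //; rewrite -van_preim // vy'.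
by apply/(affine_specialize (aW aV)); rewrite // vy'.
Qed.

(* Openness of [f], restricted to the closure of a point. *)
Lemma going_up_open (y1 : X) (W : set X) : open W -> W y1 ->
  exists2 N : set X, open N & N (f y1) /\
  forall y, N y -> closure [set f y1] y ->
    exists y', [/\ f y' = y, closure [set y1] y' & W y'].
Proof.
move=> oW Wy1; have [V Vy1 aV] := scheme_affine (f y1).
have My1 : oset (mpreim f V) y1 by [].
have [b [nb bW]] := affine_basis (aW aV) oW Wy1 My1.
have pq := van_prime (aW aV) My1.
have [c [a [na qba]]] := integral_multiple (fW aV) pq nb.
exists [set y | oset V y /\ ~ van y a].
  exact: affine_distinguished.
split; first by split=> //; move: na; rewrite van_comor.
move=> y [Vy nya] cl; have [y' [fy' cl' sub]] := going_up_affine aV Vy1 Vy cl.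
have Vy' : oset V (f y') by rewrite fy'.
have My' : oset (mpreim f V) y' by [].
exists y'; split=> //; apply: bW => //= vb; apply: nya.
have iv := van_ideal (aW aV) My'.
rewrite -fy'; apply/(van_comor a Vy'); rewrite -[comor f V a](subKr (b * c)).
by apply: (idlB iv); [apply: (idlMr _ iv)|apply: sub].
Qed.

Let eta := generic_pt X.

(** Going down from any point gives [y1] over [eta]. As [eta] specializes to [y1], continuity makes
    [f eta] specialize to [eta], hence to every point. *)
Lemma preimage_generic : exists2 y, f y = eta & closure [set f eta] = setT.
Proof.
have [y0 _] : [set: X] !=set0 by case: (variety_irreducible X).
have [|y1 _ fy1] := @going_down y0 eta; first by rewrite (generic_ptP X).
exists y1 => //; apply/seteqP; split=> //; rewrite -(generic_ptP X) -/eta.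
have h : closure [set f eta] eta.
  rewrite -[X in closure _ X]fy1 => N; rewrite nbhsE => -[G [oG Gy] GN].
  have : closure [set eta] y1 by rewrite (generic_ptP X).
  move=> /(_ (f @^-1` G)) [].
    apply: open_nbhs_nbhs; split=> //; have /continuousP := @map_cont _ _ f; exact.
  by move=> _ [-> Geta]; exists (f eta); split=> //; apply: GN.
rewrite ((closure_id (closure [set f eta])).1 (@closed_closure _ _)).
by apply: closure_subset => _ ->.
Qed.

Lemma fixed_generic : f eta = eta.
Proof.
have [y fy cl] := preimage_generic.
by apply: closure_point_inj; rewrite ?cl // (generic_ptP X).
Qed.

Lemma finite_flat_onto (y : X) : exists y', f y' = y.
Proof.
have [V Vy aV] := scheme_affine y.
have Ve : oset V (f eta).
  rewrite fixed_generic; apply: (generic_point_open (generic_ptP X) (oset_open V)).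
  by exists y.
have [|y' [fy' _ _]] := going_up_affine aV Ve Vy; last by exists y'.
by rewrite fixed_generic (generic_ptP X).
Qed.

Lemma preimage_section (V : opens X) (y : X) (b : sec (mpreim f V)) :
  affine_open V -> oset V (f y) -> rational_point (f y) ->
  exists l, van y (b - kmor _ l).
Proof.
move=> aV Vy ry; have My : oset (mpreim f V) y by [].
have pm := van_prime aV Vy; have pq := van_prime (aW aV) My.
have cm := fun s => @rational_section _ _ _ _ s ry Vy.
suff [l h] : exists l, van y (b - comor f V (kmor V l)).
  by exists l; rewrite -kconst_comor.
have mq : van (f y) `<=` comor f V @^-1` (@van X (mpreim f V) y).
  by rewrite van_preim.
have := fW aV.
have [A EA] := nonzero_ring (prime_neq0 pm).
have [B EB] := nonzero_ring (prime_neq0 pq).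
move: (comor f V) (kmor V) (van (f y)) (@van X (mpreim f V) y) pm pq cm mq b.
rewrite EA EB => u c m q pm pq cm mq b fu.
exact: fibre_rational fu (prime_is_ideal pm) cm pq mq.
Qed.

(** A germ is a fraction [z / s] of sections, each congruent to a constant at [y]. This keeps the
    walk among the rational points. *)
Lemma preimage_rational (y : X) : rational_point (f y) -> rational_point y.
Proof.
move=> ry a; have [V Vy aV] := scheme_affine (f y).
have My : oset (mpreim f V) y by [].
have [s [z [ns e]]] := affine_stalk_frac (aW aV) My a.
have [l hl] := preimage_section s aV Vy ry.
have [l' hl'] := preimage_section z aV Vy ry.
have iq := van_ideal (aW aV) My.
have l0 : l != 0.
  by apply: contra_not_neq ns => l0; move: hl; rewrite l0 rmorph0 subr0.
exists (l' / l) => inv.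
have : van y (z - kmor _ (l' / l) * s).
  have -> : z - kmor (mpreim f V) (l' / l) * s =
      (z - kmor _ l') - kmor _ (l' / l) * (s - kmor _ l).
    rewrite mulrBr -rmorphM divfK //; ring.
  by apply: (idlB iq) => //; apply: (idlMl _ iq).
apply/(nvanE My); rewrite germD germN germM -e.
rewrite /kmor /= (germ_res (I : oset (opensT X) y)).
move: inv ns => [b ab] /(nvanE My)[b' sb'].
exists (b * b').
by rewrite -[RHS]mul1r -{1}ab -sb'; ring.
Qed.

End FiniteFlat.

(** * The degree of the function field extension *)

Section ExtensionDegree.
Variables (K L : fieldType) (iota : {rmorphism K -> L}).

Lemma extension_basis_dependent d (e : 'I_d -> L) n (g : 'I_n -> L) :
  extension_basis (range iota) e -> (d < n)%N ->
  exists2 a : 'I_n -> K, (exists i, a i != 0) & \sum_i iota (a i) * g i = 0.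
Proof.
move=> be dn.
have /choice[c hc] : forall i, exists c : 'I_d -> K, g i = \sum_l iota (c l) * e l.
  move=> i; have [a [[Fa ->] _]] := be (g i).
  have /choice[c ca] : forall l, exists c, iota c = a l.
    by move=> l; have [c _ <-] := Fa l; exists c.
  by exists c; apply: eq_bigr => l _; rewrite ca.
pose M : 'M[K]_(n, d) := \matrix_(i, l) c i l.
have kM0 : kermx M != 0.
  rewrite kermx_eq0 /row_free; apply: contraTneq (rank_leq_col M) => ->.
  by rewrite -ltnNge.
pose v := nz_row (kermx M).
have v0 : v != 0 by rewrite nz_row_eq0.
have vM : v *m M = 0 by apply/sub_kermxP/nz_row_sub.
exists (v 0).
  apply: contrapT => nex; move/eqP: v0; apply; apply/rowP => i; rewrite mxE.
  by apply/eqP/negPn/negP => vi; apply: nex; exists i.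
under eq_bigr => i _ do rewrite hc mulr_sumr.
rewrite exchange_big big1 // => l _.
have := congr1 (fun N : 'rV[K]_d => iota (N 0 l)) vM; rewrite !mxE rmorph0 rmorph_sum.
move=> /(congr1 (fun b => b * e l)); rewrite mul0r mulr_suml => E; rewrite -[RHS]E.
by apply: eq_bigr => i _; rewrite mxE rmorphM mulrA.
Qed.

Lemma extension_basis_free d (e : 'I_d -> L) (a : 'I_d -> K) :
  extension_basis (range iota) e -> \sum_i iota (a i) * e i = 0 -> forall i, a i = 0.
Proof.
move=> be ae i; have [b [_ uniq_b]] := be 0.
have b0 : b = (fun=> 0).
  apply: uniq_b; split; first by move=> j; exists 0; rewrite // rmorph0.
  by rewrite big1 // => j _; rewrite mul0r.
have ba : b = (fun j => iota (a j)).
  by apply: uniq_b; split=> // j; exists (a j).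
apply/eqP; rewrite -(fmorph_eq0 iota); apply/eqP.
by have := congr1 (fun h => h i) ba; rewrite b0.
Qed.

Lemma extension_degreeP d (e : 'I_d -> L) :
  extension_basis (range iota) e -> extension_degree (range iota) = d.
Proof.
move=> be; rewrite /extension_degree; apply: xget_unique.
  by exists e.
move=> d' [e' be']; apply/eqP; rewrite eqn_leq; apply/andP.
split; rewrite leqNgt; apply/negP.
  move=> /(extension_basis_dependent e' be)[a [i ai]] /(extension_basis_free be').
  by move=> a0; rewrite a0 eqxx in ai.
move=> /(extension_basis_dependent e be')[a [i ai]] /(extension_basis_free be).
by move=> a0; rewrite a0 eqxx in ai.
Qed.

Lemma poly_overP (p : {poly L}) :
  poly_over (range iota) p -> exists P : {poly K}, map_poly iota P = p.
Proof.
move=> Fp; have /choice[c hc] : forall i, exists c, iota c = p`_i.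
  by move=> i; have [c _ <-] := Fp i; exists c.
exists (\poly_(i < size p) c i); apply/polyP => i.
rewrite coef_map coef_poly; case: ltnP => [_|le_i]; first exact: hc.
by rewrite /= (rmorph0 iota) nth_default.
Qed.

Lemma minimal_polyP z : separable_extension (range iota) -> exists P : {poly K},
  [/\ P \is monic, separable_poly P, root (map_poly iota P) z
    & forall Q : {poly K}, Q != 0 -> root (map_poly iota Q) z ->
      (size P <= size Q)%N].
Proof.
move=> /(_ z)[p [pm /poly_overP[P eP] pz pmin] psep]; exists P.
rewrite -eP in pm pz pmin psep; split=> //.
- by rewrite map_monic in pm.
- by rewrite separable_map in psep.
- move=> Q Q0 Qz; have := pmin (map_poly iota Q).
  rewrite !size_map_poly map_poly_eq0; apply=> // i.
  by rewrite coef_map; exists Q`_i.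
Qed.

(** The gcd of [P] and [Q] does not vanish at [z], so its cofactor in [P] does; minimality makes the
    gcd constant, and a Bezout relation evaluated at [z] gives the inverse. *)
Lemma minimal_poly_irreducible z (P Q : {poly K}) : P \is monic ->
  root (map_poly iota P) z ->
  (forall Q : {poly K}, Q != 0 -> root (map_poly iota Q) z -> (size P <= size Q)%N) ->
  (map_poly iota Q).[z] != 0 -> exists V : {poly K},
  (map_poly iota V).[z] * (map_poly iota Q).[z] = 1.
Proof.
move=> Pm Pz Pmin Qz; have P0 := monic_neq0 Pm.
have : coprimep P Q.
  rewrite /coprimep; set D := gcdp P Q.
  have D0 : D != 0 by rewrite gcdp_eq0 (negPf P0).
  have /dvdpP[R PRD] : D %| P by apply: dvdp_gcdl.
  have /dvdpP[S QSD] : D %| Q by apply: dvdp_gcdr.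
  have Dz : (map_poly iota D).[z] != 0.
    by apply: contraNneq Qz => Dz; rewrite QSD rmorphM hornerM Dz mulr0.
  have R0 : R != 0 by apply: contraNneq P0 => R0; rewrite PRD R0 mul0r.
  have Rz : root (map_poly iota R) z.
    move: Pz; rewrite PRD rmorphM /= rootM => /orP[//|].
    by rewrite /root (negPf Dz).
  have := Pmin _ R0 Rz; rewrite PRD size_mul //.
  have : (0 < size R)%N by rewrite size_poly_gt0.
  have : (0 < size D)%N by rewrite size_poly_gt0.
  move: (size R) (size D) => r d; lia.
move=> /Bezout_eq1_coprimepP[[U V] /= UV]; exists V.
have := congr1 (fun p => (map_poly iota p).[z]) UV.
rewrite rmorphD !rmorphM rmorph1 hornerD !hornerM hornerC (rootP Pz) mulr0 add0r.
exact.
Qed.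

Lemma primitive_basis z (P : {poly K}) : P \is monic ->
  root (map_poly iota P) z ->
  (forall Q : {poly K}, Q != 0 -> root (map_poly iota Q) z -> (size P <= size Q)%N) ->
  (forall l, exists Q : {poly K}, (map_poly iota Q).[z] = l) ->
  extension_basis (range iota) (fun i : 'I_(size P).-1 => z ^+ i).
Proof.
move=> Pm Pz Pmin gen l; have P0 := monic_neq0 Pm.
(* [oapp a 0 (insub i)] extends the family [a] by 0 to all natural indices. *)
have hsum (a : 'I_(size P).-1 -> K) (Q := \poly_(i < (size P).-1) oapp a 0 (insub i)) :
    (map_poly iota Q).[z] = \sum_i iota (a i) * z ^+ i.
  rewrite /Q poly_def rmorph_sum horner_sum; apply: eq_bigr => i _ /=.
  by rewrite map_polyZ map_polyXn hornerZ hornerXn valK.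
have [Q Ql] := gen l; pose R := Q %% P.
have Rl : (map_poly iota R).[z] = l.
  rewrite -Ql [in RHS](divp_eq Q P) rmorphD rmorphM hornerD hornerM.
  by rewrite (rootP Pz) mulr0 add0r.
have sR : (size R < size P)%N by rewrite ltn_modp.
exists (fun i => iota R`_i); split.
  split; first by move=> i; exists R`_i.
  rewrite -Rl horner_coef size_map_poly.
  have sR' : (size R <= (size P).-1)%N by rewrite -ltnS prednK // size_poly_gt0.
  rewrite (big_ord_widen _ (fun i => (map_poly iota R)`_i * z ^+ i) sR') big_mkcond /=.
  apply: eq_bigr => i _; rewrite coef_map; case: ltnP => // le_i.
  by rewrite nth_default // rmorph0 mul0r.
move=> b [Fb bl]; apply/funext => i.
have /choice[c hc] : forall j, exists c, iota c = b j.
  by move=> j; have [c _ <-] := Fb j; exists c.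
pose S := \poly_(i < (size P).-1) oapp c 0 (insub i) - R.
have Sz : root (map_poly iota S) z.
  rewrite /root /S rmorphB hornerD hornerN Rl hsum bl subr_eq0; apply/eqP.
  by apply: eq_bigr => j _; rewrite hc.
have sS : (size S < size P)%N.
  apply: leq_ltn_trans (size_polyD _ _) _; rewrite gtn_max size_polyN sR andbT.
  by apply: leq_ltn_trans (size_poly _ _) _; rewrite prednK // size_poly_gt0.
have /eqP : S == 0.
  by apply: contraTT sS => S0; rewrite -leqNgt; apply: Pmin.
move=> /(congr1 (fun p : {poly K} => p`_i)).
rewrite coefB coef_poly ltn_ord valK /= coef0 => /eqP.
by rewrite subr_eq0 => /eqP <-; rewrite hc.
Qed.

End ExtensionDegree.

Lemma closed_field_fresh (k : closedFieldType) (s : seq k) : exists x, x \notin s.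
Proof.
pose p := \prod_(z <- s) ('X - z%:P) + 1 : {poly k}.
have [s0|s0] := eqVneq s [::]; first by exists 0; rewrite s0.
have sp : size (\prod_(z <- s) ('X - z%:P)) = (size s).+1 by rewrite size_prod_XsubC.
have /closed_rootP[x px] : size p != 1%N.
  by rewrite size_polyDl ?sp ?size_poly1 ?eqSS ?size_eq0 ?ltnS ?lt0n ?size_eq0.
exists x; apply: contraTN px => xs.
rewrite /root hornerD hornerC [_.[x]](_ : _ = 0) ?add0r ?oner_eq0 //.
by apply/eqP; rewrite -/(root _ _) root_prod_XsubC.
Qed.

Lemma closed_field_nonroot (k : closedFieldType) (L : fieldType)
    (c : {rmorphism k -> L}) (r : {poly L}) : r != 0 -> exists l, ~~ root r (c l).
Proof.
move=> r0; apply: contrapT => nex.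
have all_root l : root r (c l) by apply/negPn/negP => h; apply: nex; exists l.
have [s us ss] : exists2 s : seq k, uniq s & size s = size r.
  elim: (size r) => [|n [s us ss]]; first by exists [::].
  by have [x xs] := closed_field_fresh s; exists (x :: s); rewrite /= ?xs ?us ?ss.
suff h : (size (map c s) < size r)%N by rewrite size_map ss ltnn in h.
apply: max_poly_roots => //; last by rewrite map_inj_uniq //; apply: fmorph_inj.
by apply/allP => _ /mapP[l _ ->].
Qed.

(** No nonzero constant lies in [m], so the constant congruent to [a] is unique, which makes a
    choice of it a ring morphism. *)
Lemma residue_morphism (k : fieldType) (A : comPzRingType) (c : {rmorphism k -> A})
    (m : set A) : prime_ideal m -> (forall a, exists l, m (a - c l)) ->
  exists ev : {rmorphism A -> k}, (forall l, ev (c l) = l) /\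
    (forall a, ev a = 0 <-> m a).
Proof.
move=> pm /choice[ev hev]; have im := prime_is_ideal pm.
have c0 l : m (c l) -> l = 0.
  move=> ml; apply: contrapT => /eqP l0; have [_ _ _ nm1 _] := pm; apply: nm1.
  by rewrite -(rmorph1 c) -(mulVf l0) rmorphM; apply: idlMl.
have evP a l : m (a - c l) -> ev a = l.
  move=> ml; apply/eqP; rewrite -subr_eq0; apply/eqP/c0; rewrite rmorphB.
  have -> : c (ev a) - c l = (a - c l) - (a - c (ev a)) by ring.
  exact: idlB.
have evB : zmod_morphism ev.
  move=> a b; apply: evP; rewrite rmorphB.
  have -> : a - b - (c (ev a) - c (ev b)) = (a - c (ev a)) - (b - c (ev b)) by ring.
  exact: idlB.
have evM : monoid_morphism ev.
  split; first by apply: evP; rewrite rmorph1 subrr; apply: idl0.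
  move=> a b; apply: evP; rewrite rmorphM.
  have -> : a * b - c (ev a) * c (ev b) =
    b * (a - c (ev a)) + c (ev a) * (b - c (ev b)) by ring.
  by apply: idlD => //; apply: idlMl.
pose evm : {rmorphism A -> k} := HB.pack ev
  (GRing.isZmodMorphism.Build A k ev evB) (GRing.isMonoidMorphism.Build A k ev evM).
exists evm; split=> [l|a].
  by apply: evP; rewrite subrr; apply: idl0.
split=> [ea|ma]; last by apply: evP; rewrite rmorph0 subr0.
by have := hev a; rewrite [ev a]ea rmorph0 subr0.
Qed.

(** * The generic fibre of a finite separable extension of domains *)

Section GenericFibre.
Variables (k : closedFieldType) (K L : fieldType) (iota : {rmorphism K -> L}).
Variables (A B : comNzRingType) (c : {rmorphism k -> A}) (u : {rmorphism A -> B}).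
Variable (H : {rmorphism B -> L}).
Hypotheses (fu : module_finite u) (H_inj : injective H) (u_inj : injective u).
(** [K] and [L] act as the fraction fields of [A] and [B], and [iota] as the pullback of rational
    functions. *)
Hypothesis HA : forall a, exists x, iota x = H (u a).
Hypothesis HK : forall x, exists s a, s <> 0 /\ iota x * H (u s) = H (u a).
Hypothesis HB : forall l, exists s z, s <> 0 /\ l * H s = H z.
Hypothesis sep : separable_extension (range iota).

Let gen (z l : L) := exists Q : {poly K}, (map_poly iota Q).[z] = l.

Let genD z l l' : gen z l -> gen z l' -> gen z (l + l').
Proof.
by move=> [Q <-] [Q' <-]; exists (Q + Q'); rewrite rmorphD hornerD.
Qed.

Let genM z l l' : gen z l -> gen z l' -> gen z (l * l').
Proof.
by move=> [Q <-] [Q' <-]; exists (Q * Q'); rewrite rmorphM hornerM.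
Qed.

Let gen_trans z y l : gen z y -> gen y l -> gen z l.
Proof.
move=> [Q <-] [Q' <-]; exists (Q' \Po Q).
by rewrite map_comp_poly horner_comp.
Qed.

(** Elements are adjoined one at a time. The multiplier is taken among the constants [k], infinitely
    many, so that one of them avoids the roots of [r]; the new generator [u (c l) * t - b] then
    stays in [B]. *)
Lemma primitive_element_seq (s : seq B) :
  exists t : B, forall b, b \in s -> gen (H t) (H b).
Proof.
elim: s => [|b s [t ht]]; first by exists 0.
have [p [/monic_neq0 p0 _ pb _]] := minimal_polyP (H b) sep.
have [q [_ qsep qt _]] := minimal_polyP (H t) sep.
have [r r0 hr] := large_field_PET p0 pb qt qsep.
have [l hl] := @closed_field_nonroot k L (H \o (u \o c)) r r0.
have [x hx] := HA (c l).
have [] := hr x; first by rewrite hx.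
rewrite hx -rmorphM -rmorphB => gb gt; exists (u (c l) * t - b) => b'.
by rewrite inE => /orP[/eqP ->|/ht]; [|exact: gen_trans].
Qed.

Lemma primitive_element : exists t : B, forall l, gen (H t) l.
Proof.
have [n [e ge]] := fu; have [t ht] := primitive_element_seq (codom e).
exists t.
have genB b : gen (H t) (H b).
  have [a ->] := ge b; rewrite rmorph_sum.
  apply: big_ind => [|x y|i _]; first by exists 0; rewrite rmorph0 horner0.
    exact: genD.
  rewrite rmorphM; apply: genM; last by apply: ht; apply: codom_f.
  have [x hx] := HA (a i); exists x%:P.
  by rewrite map_polyC hornerC.
move=> l; have [s [z [/eqP s0 e1]]] := HB l.
have Hs0 : H s != 0 by rewrite -(rmorph0 H) (inj_eq H_inj).
have [p [pm _ pt pmin]] := minimal_polyP (H t) sep.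
have [Q Qs] := genB s.
have [|V VQ] := @minimal_poly_irreducible _ _ iota _ _ Q pm pt pmin.
  by rewrite Qs.
have -> : l = H z * (map_poly iota V).[H t].
  by rewrite -e1 -mulrA [H s * _]mulrC -Qs VQ mulr1.
by apply: genM => //; exists V.
Qed.

Lemma clear_denominators (Q : {poly K}) : exists (h : A) (R : {poly A}),
  h <> 0 /\ map_poly (H \o u) R = H (u h) *: map_poly iota Q.
Proof.
have dom (a b : A) : a <> 0 -> b <> 0 -> a * b <> 0.
  move=> /eqP a0 /eqP b0; apply/eqP.
  apply: contra_neq (mulf_neq0 (x := H (u a)) (y := H (u b)) _ _).
  - by move=> ab0; rewrite -!rmorphM ab0 !rmorph0.
  - by rewrite -(rmorph0 H) (inj_eq H_inj) -(rmorph0 u) (inj_eq u_inj).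
  - by rewrite -(rmorph0 H) (inj_eq H_inj) -(rmorph0 u) (inj_eq u_inj).
elim/poly_ind: Q => [|Q x [h [R [h0 e]]]].
  exists 1, 0; split; first by apply/eqP/oner_neq0.
  by rewrite !rmorph0 scaler0.
have [s [a [s0 es]]] := HK x.
exists (h * s), ((s *: R) * 'X + (h * a)%:P); split; first exact: dom.
rewrite !rmorphD !rmorphM /= !map_polyX !map_polyC map_polyZ e /= scalerDr.
rewrite -!mul_polyC -es !polyCM; ring.
Qed.

(** Let [t] in [B] generate [L], with minimal polynomial [P]. Away from [h] the reduction of [P] at
    [m] keeps its degree and its separability, so it has [[L : K]] distinct roots in [k]. Going up
    along the map from [{poly A}] to [B] sending ['X] to [t] gives, for each root [l], a prime over
    [m] at which [t] takes the value [l]; distinct roots give distinct primes. *)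
Lemma generic_fibre : exists h : A, h <> 0 /\
  forall m : set A, prime_ideal m -> (forall a, exists l, m (a - c l)) -> ~ m h ->
  exists q : 'I_(extension_degree (range iota)) -> set B,
    injective q /\ forall i, prime_ideal (q i) /\ u @^-1` (q i) = m.
Proof.
have [t ht] := primitive_element.
have [P [Pm Psep Pt Pmin]] := minimal_polyP (H t) sep.
have degP := extension_degreeP (primitive_basis Pm Pt Pmin ht).
have G_inj : injective (H \o u) by apply: inj_comp.
have G0 a : a <> 0 -> (H \o u) a != 0.
  by move=> /eqP a0; rewrite -(rmorph0 (H \o u)) (inj_eq G_inj).
have sG (R : {poly A}) : size (map_poly (H \o u) R) = size R.
  by apply: size_map_inj_poly => //; rewrite rmorph0.
have P0 := monic_neq0 Pm.
have [hP [R [hP0 eR]]] := clear_denominators P.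
move: Psep; rewrite unlock => /Bezout_eq1_coprimepP[[U V] /= UV].
have [hU [RU [hU0 eU]]] := clear_denominators U.
have [hV [RV [hV0 eV]]] := clear_denominators V.
have map_inj : injective (map_poly (H \o u)).
  by apply: map_inj_poly => //; rewrite rmorph0.
(* The leading coefficient of [R], and the denominators of a Bezout relation between [P] and its
   derivative. *)
exists (hP * hU * hV); split.
  move=> /(congr1 (H \o u)); rewrite rmorph0 !rmorphM => /eqP.
  by rewrite !mulf_eq0 !(negPf (G0 _ _)).
move=> m pm cm nmh.
have im := prime_is_ideal pm.
have [ev [evc ev0]] := residue_morphism pm cm.
have [evP evU evV] : [/\ ev hP != 0, ev hU != 0 & ev hV != 0].
  by split; apply: contra_not_neq nmh => /ev0 mh;
    [rewrite mulrC; apply: idlMl => //; rewrite mulrC|rewrite -mulrA mulrCA mulrC|];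
    apply: idlMl => //; rewrite mulrC; apply: idlMl.
have RBezout : hV *: (RU * R) + hU *: (RV * R^`()) = (hP * hU * hV)%:P.
  apply: map_inj; rewrite rmorphD /= !map_polyZ !rmorphM /= -deriv_map eU eR eV derivZ.
  have := congr1 (map_poly iota) UV.
  rewrite rmorphD !rmorphM rmorph1 /= -deriv_map => UV'.
  rewrite !map_polyC /= -[RHS]mulr1 -UV' -!mul_polyC; ring.
have leadR : lead_coef R = hP.
  apply: G_inj; rewrite lead_coefE -coef_map eR coefZ coef_map.
  rewrite -sG eR size_scale ?G0 // size_map_poly -lead_coefE (monicP Pm).
  by rewrite /= rmorph1 mulr1.
pose p := map_poly ev R.
have sp : size p = size P.
  rewrite size_map_poly_id0 ?leadR // -sG eR size_scale ?G0 //.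
  exact: size_map_poly.
have psep : separable_poly p.
  rewrite unlock; apply/Bezout_coprimepP.
  exists (ev hV *: map_poly ev RU, ev hU *: map_poly ev RV) => /=.
  have := congr1 (map_poly ev) RBezout.
  rewrite rmorphD /= !map_polyZ !rmorphM /= -deriv_map !map_polyC /= -!scalerAl => ->.
  by rewrite -!polyCM polyC_eqp1 !mulf_neq0.
have [r er] := closed_field_poly_normal p.
have lp0 : lead_coef p != 0 by rewrite lead_coef_eq0 separable_poly_neq0.
have ur : uniq r.
  rewrite -separable_prod_XsubC; apply: dvdp_separable psep.
  by rewrite er dvdpZr.
have sr : size r = extension_degree (range iota).
  by rewrite degP -sp er size_scale // size_prod_XsubC.
have rootR l : l \in r -> root p l.
  by move=> lr; rewrite er rootZ // root_prod_XsubC.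
have Rt0 Q : peval u t Q = 0 -> (size Q < size R)%N -> Q = 0.
  move=> Qt sQ; apply: map_inj; rewrite rmorph0; apply/eqP/negPn/negP => Q0.
  have [|S eS] := @poly_overP _ _ iota (map_poly (H \o u) Q).
    by move=> i; rewrite coef_map /=; have [x <-] := HA Q`_i; exists x.
  have := Pmin S; rewrite -(map_poly_eq0 iota) -(size_map_poly iota S) eS => /(_ Q0).
  have -> : root (map_poly (H \o u) Q) (H t).
    by rewrite map_poly_comp /root horner_map /= -[_.[t]]/(peval u t Q) Qt rmorph0.
  move=> /(_ isT); rewrite sG leqNgt -(size_map_poly iota P).
  by rewrite -(size_scale _ (G0 _ hP0)) -eR sG sQ.
have Rt : peval u t R = 0.
  apply: H_inj; rewrite rmorph0 /peval /horner_morph -horner_map -map_poly_comp eR.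
  by rewrite hornerZ (rootP Pt) mulr0.
have B0 : prime_ideal [set 0 : B].
  split=> // [a b -> ->|a b ->||a b /= ab]; rewrite ?addr0 ?mulr0 //.
    by apply/eqP/oner_neq0.
  have /eqP := congr1 H ab; rewrite rmorphM rmorph0 mulf_eq0.
  by rewrite -(rmorph0 H) !(inj_eq H_inj) => /orP[] /eqP; [left|right].
have pfin : module_finite (peval u t).
  have [n [e ge]] := fu; exists n, e => b; have [a ->] := ge b.
  by exists (fun i => (a i)%:P); apply: eq_bigr => i _; rewrite pevalC.
have fibre l : l \in r -> exists q : set B,
    [/\ prime_ideal q, u @^-1` q = m & q (t - u (c l))].
  move=> lr; pose ml : set {poly A} := [set Q | (map_poly ev Q).[l] = 0].
  have pml : prime_ideal ml.
    split; rewrite /ml /=.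
    - by rewrite rmorph0 horner0.
    - by move=> a b a0 b0; rewrite rmorphD hornerD a0 b0 addr0.
    - by move=> a b b0; rewrite rmorphM hornerM b0 mulr0.
    - by rewrite rmorph1 hornerC; apply/eqP/oner_neq0.
    - move=> a b; rewrite rmorphM hornerM => /eqP; rewrite mulf_eq0.
      by move=> /orP[] /eqP; [left|right].
  have [|q [pq _ eq_ml]] := going_up pfin B0 pml.
    (* If [Q] kills [t], pseudo-division by [R] leaves a remainder that kills [t], hence 0 by
       minimality of [P]. The power of [hP] it introduces is not in [m], so the reduction of [Q]
       vanishes at [l]. *)
    move=> Q /= Qt; have := Pdiv.ComRing.rdivp_eq R Q.
    set D := Pdiv.Ring.rdivp Q R; set S := Pdiv.Ring.rmodp Q R => QR.
    have S0 : S = 0.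
      apply: Rt0; last first.
        by rewrite Pdiv.Ring.ltn_rmodp -lead_coef_eq0 leadR; apply/eqP.
      have := congr1 (peval u t) QR.
      by rewrite -mul_polyC rmorphD !rmorphM /= Qt Rt !mulr0 add0r.
    have := congr1 (fun Q => (map_poly ev Q).[l]) QR.
    rewrite S0 addr0 map_polyZ rmorphM hornerM /= (rootP (rootR _ lr)) mulr0 hornerZ.
    by move=> /eqP; rewrite leadR mulf_eq0 rmorphXn expf_eq0 (negPf evP) andbF => /eqP.
  exists q; split=> //.
    apply/seteqP; split=> a /=;
      rewrite -(pevalC u t) -[q _]/((peval u t @^-1` q) _) eq_ml.
      by rewrite /ml /= map_polyC hornerC => /ev0.
    by move=> ma; rewrite /ml /= map_polyC hornerC; apply/ev0.
  have : ml ('X - (c l)%:P).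
    by rewrite /ml /= rmorphB /= map_polyX map_polyC /= hornerD hornerN hornerX hornerC
      evc subrr.
  by rewrite -eq_ml /= rmorphB /= pevalX pevalC.
have /choice[q hq] : forall i : 'I_(extension_degree (range iota)), exists q : set B,
    [/\ prime_ideal q, u @^-1` q = m & q (t - u (c (nth 0 r i)))].
  by move=> i; apply: fibre; rewrite mem_nth // sr.
exists q; split=> [i j eq_q|i]; last by have [] := hq i.
have [pi mi ti] := hq i; have [_ _] := hq j; rewrite -eq_q => tj.
apply/ord_inj/eqP; rewrite -(nth_uniq 0 _ _ ur) ?sr //; apply/eqP.
have : m (c (nth 0 r i) - c (nth 0 r j)).
  rewrite -mi /= rmorphB.
  have -> : u (c (nth 0 r i)) - u (c (nth 0 r j)) =
    (t - u (c (nth 0 r j))) - (t - u (c (nth 0 r i))) by ring.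
  by apply: idlB => //; apply: prime_is_ideal.
rewrite -rmorphB => /ev0; rewrite evc => /eqP; rewrite subr_eq0 => /eqP; exact.
Qed.

(** A relation over [K] turns into one over [A] after multiplication by the product of all
    denominators. *)
Lemma independent_bound n (E : 'I_n -> B) :
  (forall a : 'I_n -> A, \sum_i u (a i) * E i = 0 -> forall i, a i = 0) ->
  (n <= extension_degree (range iota))%N.
Proof.
move=> indep; have [t ht] := primitive_element.
have [P [Pm _ Pt Pmin]] := minimal_polyP (H t) sep.
have be := primitive_basis Pm Pt Pmin ht; rewrite (extension_degreeP be) leqNgt.
apply/negP => /(extension_basis_dependent (fun i => H (E i)) be)[a [i0 ai0] ae].
have /choice[sz hsz] : forall i, exists sz : A * A,
    sz.1 <> 0 /\ iota (a i) * H (u sz.1) = H (u sz.2).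
  by move=> i; have [s [z h]] := HK (a i); exists (s, z).
have G0 b : b <> 0 -> H (u b) != 0.
  by move=> /eqP b0; rewrite -(rmorph0 H) (inj_eq H_inj) -(rmorph0 u) (inj_eq u_inj).
pose S := \prod_i (sz i).1; pose b i := (sz i).2 * \prod_(j | j != i) (sz j).1.
have HS : H (u S) != 0.
  by rewrite !rmorph_prod; apply/prodf_neq0 => i _; apply: G0; have [] := hsz i.
have Hb i : iota (a i) * H (u S) = H (u (b i)).
  rewrite /S /b (bigD1 i) //= !rmorphM mulrA; congr (_ * _).
  by have [] := hsz i.
have b0 : b i0 = 0.
  apply: indep; apply: H_inj; rewrite rmorph0 rmorph_sum.
  rewrite (eq_bigr (fun i => H (u S) * (iota (a i) * H (E i)))).
    by rewrite -mulr_sumr ae mulr0.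
  by move=> i _; rewrite rmorphM -Hb; ring.
have /eqP := Hb i0; rewrite b0 !rmorph0 mulf_eq0 (negPf HS) orbF fmorph_eq0.
by rewrite (negPf ai0).
Qed.

End GenericFibre.

(** * Cardinality of the fibres *)

(** Both rings map to the field [L] and so are nonzero; this carries the two bounds over to rings of
    sections. *)
Lemma generic_fibre_bounds (k : closedFieldType) (K L : fieldType)
    (iota : {rmorphism K -> L}) (A B : comPzRingType) (c : {rmorphism k -> A})
    (u : {rmorphism A -> B}) (H : {rmorphism B -> L}) :
  module_finite u -> injective H -> injective u ->
  (forall a, exists x, iota x = H (u a)) ->
  (forall x, exists s a, s <> 0 /\ iota x * H (u s) = H (u a)) ->
  (forall l, exists s z, s <> 0 /\ l * H s = H z) ->
  separable_extension (range iota) ->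
  (forall n (E : 'I_n -> B),
    (forall a : 'I_n -> A, \sum_i u (a i) * E i = 0 -> forall i, a i = 0) ->
    (n <= extension_degree (range iota))%N) /\
  exists h : A, h <> 0 /\
  forall m : set A, prime_ideal m -> (forall a, exists l, m (a - c l)) -> ~ m h ->
  exists q : 'I_(extension_degree (range iota)) -> set B,
    injective q /\ forall i, prime_ideal (q i) /\ u @^-1` (q i) = m.
Proof.
have [B' EB] : exists B' : comNzRingType, B = B'.
  apply: nonzero_ring => /(congr1 H); rewrite rmorph1 rmorph0 => /eqP.
  by rewrite oner_eq0.
have [A' EA] : exists A' : comNzRingType, A = A'.
  apply: nonzero_ring => /(congr1 (H \o u)); rewrite rmorph1 rmorph0 => /eqP.
  by rewrite oner_eq0.
move: c u H; rewrite EA EB => c u H fu H_inj u_inj HA HK HB sep; split.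
  by move=> n E hE; apply: (independent_bound c fu H_inj u_inj HA HK HB sep hE).
exact: (generic_fibre c fu H_inj u_inj HA HK HB sep).
Qed.

Definition germ_hom (X : ringed_space) (x : X) (U : opens X) (Ux : oset U x)
    (s : sec U) : stalk x := germ Ux s.

Lemma germ_hom_zmod_morphism (X : ringed_space) (x : X) (U : opens X)
    (Ux : oset U x) : zmod_morphism (germ_hom Ux).
Proof. by move=> s t; rewrite /germ_hom germD germN. Qed.

Lemma germ_hom_monoid_morphism (X : ringed_space) (x : X) (U : opens X)
    (Ux : oset U x) : monoid_morphism (germ_hom Ux).
Proof. by split=> [|s t]; rewrite /germ_hom ?germ1 ?germM. Qed.

HB.instance Definition _ (X : ringed_space) (x : X) (U : opens X) (Ux : oset U x) :=
  GRing.isZmodMorphism.Build _ _ (germ_hom Ux) (germ_hom_zmod_morphism Ux).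
HB.instance Definition _ (X : ringed_space) (x : X) (U : opens X) (Ux : oset U x) :=
  GRing.isMonoidMorphism.Build _ _ (germ_hom Ux) (germ_hom_monoid_morphism Ux).

Section Fibres.
Variables (k : closedFieldType) (X : variety k) (f : kmap X X).
Hypotheses (f_finite : finite_map f) (f_flat : flat_map f).

Let aW V : affine_open V -> affine_open (mpreim f V).
Proof. by case: f_finite => h _; apply: h. Qed.

Let fW V : affine_open V -> module_finite (comor f V).
Proof. by case: f_finite => _; apply. Qed.

(* Functions separating the points of the fibre, each nilpotent at the other
   points modulo the maximal ideal of [x], are linearly independent: by flatness
   a relation between them puts each coefficient, up to a unit, into the maximal
   ideal times the ideal of the other coefficients. *)
Lemma fibre_independent (V : opens X) (x : X) n (y : 'I_n -> X) :
  affine_open V -> oset V x -> rational_point x -> injective y ->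
  (forall i, f (y i) = x) ->
  exists E : 'I_n -> sec (mpreim f V), forall a : 'I_n -> sec V,
    \sum_i comor f V (a i) * E i = 0 -> forall i, a i = 0.
Proof.
move=> aV Vx rx y_inj fy; set u := comor f V.
have Vy i : oset V (f (y i)) by rewrite fy.
have Wy i : oset (mpreim f V) (y i) := Vy i.
pose q i := @van X (mpreim f V) (y i).
have pq i : prime_ideal (q i) := van_prime (aW aV) (Wy i).
have iq i := prime_is_ideal (pq i).
pose m := @van X V x; have pm : prime_ideal m := van_prime aV Vx.
have im := prime_is_ideal pm.
have mq i : u @^-1` q i = m by rewrite /u /q van_preim // fy.
have nq1 i : ~ q i 1 by have [] := pq i.
(* The points of the fibre have residue field [k], so their primes are pairwise incomparable. *)
have q_inj i j : q j `<=` q i -> i = j.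
  move=> qji; apply: y_inj; apply: (van_inj (aW aV)) => //; apply/seteqP; split=> // b qib.
  have ry : rational_point (f (y j)) by rewrite fy.
  have [l hl] := preimage_section f_finite b aV (Vy j) ry.
  have ql : q i (kmor _ l).
    have -> : kmor _ l = b - (b - kmor (mpreim f V) l) by ring.
    by apply: (idlB (iq i)) => //; apply: qji.
  have l0 : l = 0.
    apply: contrapT => /eqP l0; apply: (nq1 i).
    rewrite -(rmorph1 (kmor (mpreim f V))) -(mulVf l0) rmorphM.
    exact: (idlMl _ (iq i)).
  by move: hl; rewrite l0 rmorph0 subr0.
have /choice[g hg] : forall ij : 'I_n * 'I_n, exists g : sec (mpreim f V),
    ~ q ij.1 g /\ (ij.1 != ij.2 -> q ij.2 g).
  move=> [i j] /=; have [->|ij] := eqVneq i j; first by exists 1.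
  have /existsNP[g /not_implyP[qjg nqig]] : ~ (q j `<=` q i).
    by move=> /q_inj e; rewrite e eqxx in ij.
  by exists g.
pose e i := \prod_j g (i, j).
have nqe i : ~ q i (e i).
  by move=> /(prime_prod (pq i))[j _]; have [] := hg (i, j).
have qe i j : i != j -> q j (e i).
  move=> ij; rewrite /e (bigD1 j) //=; apply: (idlMr _ (iq j)).
  by have [_] := hg (i, j); apply.
have /choice[Nt hNt] : forall ij : 'I_n * 'I_n, exists Nt : nat * sec (mpreim f V),
    ~ q ij.2 Nt.2 /\ (ij.1 != ij.2 -> ext u m (Nt.2 * e ij.1 ^+ Nt.1)).
  move=> [i j] /=; have [->|ij] := eqVneq i j; first by exists (0%N, 1); split.
  suff [N [t [nqt h]]] : exists N t, ~ q j t /\ ext u m (t * e i ^+ N).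
    by exists (N, t); split.
  have cm : forall s, exists l, m (s - kmor V l).
    by move=> s; apply: rational_section.
  move: (qe i j ij) (pq j) (fW aV) im cm; rewrite -/u.
  move: (e i) (q j) (u) (m) (kmor V).
  have [A EA] := nonzero_ring (prime_neq0 pm).
  have [B EB] := nonzero_ring (prime_neq0 (pq j)).
  rewrite EA EB => b Q v M c Qb pQ fv iM cM.
  refine (fibre_nilpotent fv iM cM pQ Qb).
(* A common exponent, so that [t (i, j)] brings [E i] into [m B] for every [j] other than [i]. *)
pose N := \max_ij (Nt ij).1; pose t ij := (Nt ij).2.
pose E i := e i ^+ N.
have iE := ext_ideal u m.
have tE i j : i != j -> ext u m (t (i, j) * E i).
  move=> ij; have [_ /(_ ij) h] := hNt (i, j).
  have NN : ((Nt (i, j)).1 <= N)%N by apply: (leq_bigmax (i, j)).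
  rewrite /E -(subnKC NN) exprD mulrA; exact: (idlMr _ iE).
exists E => a ae.
pose I i := [set s | exists c : 'I_n -> sec V,
  [/\ forall j, m (c j), c i = 0 & s = \sum_j c j * a j]].
have iI i : is_ideal (I i).
  split.
  - exists (fun=> 0); split=> // [_|]; first exact: (idl0 im).
    by rewrite big1 // => j _; rewrite mul0r.
  - move=> _ _ [c [mc c0 ->]] [d [md d0 ->]]; exists (fun j => c j + d j); split.
    + by move=> j; apply: (idlD im).
    + by rewrite c0 d0 addr0.
    + by rewrite -big_split; apply: eq_bigr => j _; rewrite mulrDl.
  - move=> b _ [c [mc c0 ->]]; exists (fun j => b * c j); split.
    + by move=> j; apply: (idlMl _ im).
    + by rewrite c0 mulr0.
    + by rewrite mulr_sumr; apply: eq_bigr => j _; rewrite mulrA.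
(* Multiplied by [T], each [E l] with [l] other than [i] lies in [m B], so the relation puts
   [T * E i * u (a i)] into the extension of [I i]. By flatness the extension of [(I i : a i)] then
   has an element outside [q i], hence [(I i : a i)] is not contained in [m]. *)
have key i : exists s, ~ m s /\ I i (s * a i).
  have iEI := ext_ideal u (I i).
  pose T := \prod_(l | l != i) t (l, i).
  have nqT : ~ q i T.
    rewrite /T big_mkcond => /(prime_prod (pq i))[l _]; case: ifP => _; last exact: nq1.
    by have [] := hNt (l, i).
  have h1 : ext u (I i) (T * E i * u (a i)).
    have -> : T * E i * u (a i) = - \sum_(l | l != i) T * E l * u (a l).
      have : \sum_l T * E l * u (a l) = 0.
        rewrite (eq_bigr (fun l => T * (u (a l) * E l))).
          by rewrite -mulr_sumr ae mulr0.
        by move=> j _; ring.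
      by rewrite (bigD1 i) //= => /eqP; rewrite addr_eq0 => /eqP.
    apply: (idlN iEI); refine (@idl_sum _ _ _ _ _ _ iEI _) => r ri.
    rewrite /T (bigD1 r) //=.
    rewrite -[_ * E r]mulrA [_ * E r]mulrC mulrA -mulrA [_ * u _]mulrC mulrA.
    apply: (idlMr _ iEI).
    apply: (tE r i ri [set b | ext u (I i) (b * u (a r))]).
      split=> /=.
      - by rewrite mul0r; apply: (idl0 iEI).
      - by move=> b d hb hd; rewrite mulrDl; apply: (idlD iEI).
      - by move=> b d hd; rewrite -mulrA; apply: (idlMl _ iEI).
    move=> b mb /=; rewrite -rmorphM; apply: ext_in.
    exists (fun j => if j == r then b else 0); split.
    + by move=> j; case: ifP => // _; apply: (idl0 im).
    + by rewrite eq_sym (negPf ri).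
    + by rewrite (bigD1 r) //= eqxx big1 ?addr0 // => j /negPf ->; rewrite mul0r.
  have [t' nt' et'] := flat_colon_affine f_flat aV (aW aV) (Vy i) (iI i) h1.
  apply: contrapT => nex.
  apply: (prime_nmul (pq i) nt' (prime_nmul (pq i) nqT _) (et' _ (iq i) _)).
    by move=> /(prime_exp (pq i))/nqe.
  move=> s Is; suff : m s by rewrite -(mq i).
  by apply: contrapT => nms; apply: nex; exists s.
have /choice[s hs] := key.
have /choice[c hc] : forall i, exists c : 'I_n -> sec V,
    [/\ forall j, m (c j), c i = 0 & s i * a i = \sum_j c j * a j].
  by move=> i; have [_] := hs i.
(* The vector [a] is killed by this matrix, whose determinant is [\prod_i s i] modulo [m], hence
   nonzero in a domain. *)
pose M : 'M[sec V]_n := \matrix_(i, j) ((i == j)%:R * s i - c i j).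
have dM : m (\det M - \prod_i s i).
  apply: (det_diagonal_mod im) => i j; rewrite mxE addrAC subrr add0r.
  by apply: (idlN im); have [] := hc i.
have nd : \det M <> 0.
  move=> d0; have : m (\prod_i s i).
    by move: dM; rewrite d0 sub0r => /(idlN im); rewrite opprK.
  by move=> /(prime_prod pm)[i _]; have [] := hs i.
have i0 : is_ideal [set 0 : sec V].
  by split=> // [b d -> ->|b d ->]; rewrite ?addr0 ?mulr0.
have Ma i : [set 0 : sec V] (\sum_j idfun (M i j) * a j).
  have [_ _ e1] := hc i.
  rewrite /= (eq_bigr (fun j => (i == j)%:R * s i * a j - c i j * a j)).
    rewrite sumrB -e1 (bigD1 i) //= eqxx mul1r big1 ?addr0 ?subrr // => l li.
    by rewrite eq_sym (negPf li) !mul0r.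
  by move=> l _; rewrite mxE mulrBl.
move=> j; have /= := det_ideal i0 Ma j.
by case/(affine_domain aV).
Qed.

Let eta := generic_pt X.

(** [stalk_map] starts at the stalk of [f eta], which is the function field only through the
    equation [f eta = eta]; generalizing over [z] lets this equation be eliminated. *)
Lemma pullback_morphism : exists iota : {rmorphism function_field X -> function_field X},
  range iota = pullback_field f.
Proof.
suff h z : f eta = z -> exists g : {rmorphism stalk z -> stalk eta},
    range g = range (@stalk_map X X f eta).
  exact: (h eta (fixed_generic f_finite f_flat)).
by case: z /; exists (@stalk_map X X f eta).
Qed.

Hypothesis f_separable : separable_extension (pullback_field f).

Lemma chart_bounds (V : opens X) : affine_open V -> oset V eta ->
  (forall n (E : 'I_n -> sec (mpreim f V)),
    (forall a : 'I_n -> sec V, \sum_i comor f V (a i) * E i = 0 -> forall i, a i = 0) ->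
    (n <= topological_degree f)%N) /\
  exists h : sec V, h <> 0 /\
  forall m : set (sec V), prime_ideal m -> (forall a, exists l, m (a - kmor V l)) ->
  ~ m h ->
  exists q : 'I_(topological_degree f) -> set (sec (mpreim f V)),
    injective q /\ forall i, prime_ideal (q i) /\ comor f V @^-1` (q i) = m.
Proof.
move=> aV Veta; have [iota Eiota] := pullback_morphism.
have Vfeta : oset V (f eta) by rewrite fixed_generic.
have Weta : oset (mpreim f V) eta := Vfeta.
have geta : generic_point eta := generic_ptP X.
rewrite /topological_degree -Eiota.
have S_germ a : @stalk_map X X f eta (germ Vfeta a) = germ Weta (comor f V a).
  by rewrite stalk_mapE; apply: germ_irr.
have nz_van (x : X) (U : opens X) (s : sec U) :
    affine_open U -> oset U x -> ~ van x s -> s <> 0.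
  by move=> aU Ux nvs s0; apply: nvs; rewrite s0; apply: (idl0 (van_ideal aU Ux)).
apply: (@generic_fibre_bounds k _ _ iota _ _ (kmor V) (comor f V) (germ_hom Weta)).
- exact: fW.
- move=> s t st; apply/eqP; rewrite -subr_eq0; apply/eqP.
  have [|w nw] := @affine_germ0 _ _ (aW aV) _ Weta (s - t).
    by rewrite germD germN [germ _ s]st subrr.
  by move=> /(affine_domain (aW aV))[w0|//]; case: (nz_van _ _ _ (aW aV) Weta nw).
- move=> s t st; apply/eqP; rewrite -subr_eq0; apply/eqP.
  by apply: (comor_inj f_finite f_flat aV Vfeta); rewrite rmorphB st subrr.
- move=> a; have [x _ hx] : range iota (germ_hom Weta (comor f V a)).
    by rewrite Eiota /pullback_field -[germ_hom _ _]S_germ; exists (germ Vfeta a).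
  by exists x.
- move=> x; have : pullback_field f (iota x) by rewrite -Eiota; exists x.
  move=> [g _ <-]; have [s [a [ns e]]] := affine_stalk_frac aV Vfeta g.
  exists s, a; split; first exact: nz_van aV Vfeta ns.
  rewrite -[_ (comor f V s)]S_germ -[_ (comor f V a)]S_germ -e.
  by rewrite (rmorphM (@stalk_map X X f eta)).
- move=> l; have [s [z [ns e]]] := affine_stalk_frac (aW aV) Weta l.
  by exists s, z; split; first exact: nz_van (aW aV) Weta ns.
- by rewrite Eiota.
Qed.

Lemma generic_point_in (V : opens X) x : oset V x -> oset V eta.
Proof.
move=> Vx; apply: (generic_point_open (generic_ptP X) (oset_open V)).
by exists x.
Qed.

Lemma fibre_le (x : X) n (y : 'I_n -> X) : rational_point x -> injective y ->
  (forall i, f (y i) = x) -> (n <= topological_degree f)%N.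
Proof.
move=> rx y_inj fy; have [V Vx aV] := scheme_affine x.
have [E indep] := fibre_independent aV Vx rx y_inj fy.
by have [h _] := chart_bounds aV (generic_point_in Vx); apply: h indep.
Qed.

Lemma fibre_ge : exists2 U : set X, open U & U !=set0 /\
  forall x, U x -> rational_point x ->
  exists y : 'I_(topological_degree f) -> X, injective y /\ forall i, f (y i) = x.
Proof.
have [V Veta aV] := scheme_affine eta.
have [_ [h [h0 hh]]] := chart_bounds aV Veta.
exists [set x | oset V x /\ ~ van x h]; first exact: affine_distinguished.
split.
  exists eta; split=> // vh; apply: h0.
  exact: (generic_van0 aV (generic_ptP X) Veta vh).
move=> x [Vx nvx] rx.
have [q [q_inj hq]] := hh _ (van_prime aV Vx) (fun s => rational_section s rx Vx) nvx.
have /choice[y hy] : forall i, exists y, oset (mpreim f V) y /\ van y = q i.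
  by move=> i; have [pq _] := hq i; have [y Wy vy] := van_onto (aW aV) pq; exists y.
exists y; split=> [i j yij|i].
  by apply: q_inj; have [_ <-] := hy i; have [_ <-] := hy j; rewrite yij.
have [Wy vy] := hy i; have [_ mq] := hq i.
by apply: (van_inj aV) => //; rewrite -van_preim // vy mq.
Qed.

End Fibres.

(** * The backward random walk *)

Section BackwardWalk.
Variables (R : realType) (T : choiceType) (f : T -> T).
Implicit Types (h g : T -> R) (y z : T) (S : set T).

Definition fib y : {fset T} := fset_set (f @^-1` [set y]).

(* The Markov operator of the walk jumping from [y] to a uniformly chosen
   preimage of [y]. *)
Definition walk h y : R := (#|` fib y|%:R)^-1 * \sum_(z <- fib y) h z.

Lemma walk_ge0 h y : (forall z, 0 <= h z) -> 0 <= walk h y.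
Proof. by move=> h0; rewrite mulr_ge0 ?invr_ge0 // sumr_ge0. Qed.

Lemma walk_le1 h y : (forall z, h z <= 1) -> walk h y <= 1.
Proof.
move=> h1; have : \sum_(z <- fib y) h z <= #|` fib y|%:R.
  apply: le_trans (ler_sum _ (fun z _ => h1 z)) _.
  by rewrite big_const_seq count_predT iter_addr_0.
(* [fib y] is empty also when the fibre is infinite; [walk] is 0 there. *)
have [c0|c0] := posnP #|` fib y|; first by rewrite /walk c0 invr0 mul0r.
by move=> le_s; rewrite /walk mulrC ler_pdivrMr ?ltr0n // mul1r.
Qed.

Lemma walkD h g y : walk (fun z => h z + g z) y = walk h y + walk g y.
Proof. by rewrite /walk big_split mulrDr. Qed.

Lemma walkZ (a : R) h y : walk (fun z => a * h z) y = a * walk h y.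
Proof. by rewrite /walk -mulr_sumr mulrCA. Qed.

Lemma iter_walk_ge0 n h y : (forall z, 0 <= h z) -> 0 <= iter n walk h y.
Proof. by move=> h0; elim: n y => [|n IH] y //=; apply: walk_ge0. Qed.

Lemma iter_walk_le1 n h y : (forall z, h z <= 1) -> iter n walk h y <= 1.
Proof. by move=> h0; elim: n y => [|n IH] y //=; apply: walk_le1. Qed.

Lemma iter_walkD n h g y :
  iter n walk (fun z => h z + g z) y = iter n walk h y + iter n walk g y.
Proof.
elim: n y => [|n IH] y //=; rewrite -walkD; congr (walk _ y).
exact/funext.
Qed.

Lemma iter_walkZ n (a : R) h y :
  iter n walk (fun z => a * h z) y = a * iter n walk h y.
Proof.
by elim: n y => [|n IH] y //=; rewrite -walkZ; congr (walk _ y); apply/funext.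
Qed.

(** In the application [G] is the set of rational points, on which the fibres are finite and
    nonempty. *)
Variables (G : set T) (d : nat).
Hypothesis G_pre : forall z, G (f z) -> G z.
Hypothesis fib_fin : forall y, G y -> finite_set (f @^-1` [set y]).
Hypothesis fib_onto : forall y, G y -> exists z, f z = y.
Hypothesis fib_le : forall y, G y -> (#|` fib y| <= d)%N.

Lemma mem_fib y z : G y -> (z \in fib y) = (f z == y).
Proof.
move=> Gy; rewrite in_fset_set; last exact: fib_fin.
by apply/idP/eqP; rewrite inE.
Qed.

Lemma fib_gt0 y : G y -> (0 < #|` fib y|)%N.
Proof.
move=> Gy; have [z fz] := fib_onto Gy; rewrite cardfs_gt0; apply/fset0Pn.
by exists z; rewrite mem_fib // fz.
Qed.

Lemma degree_gt0 y : G y -> (0 < d)%N.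
Proof. by move=> Gy; apply: leq_trans (fib_gt0 Gy) (fib_le Gy). Qed.

Lemma G_fib y z : G y -> z \in fib y -> G z.
Proof. by move=> Gy; rewrite mem_fib // => /eqP fz; apply: G_pre; rewrite fz. Qed.

Lemma walk_le h g y : G y -> (forall z, G z -> h z <= g z) -> walk h y <= walk g y.
Proof.
move=> Gy hg; rewrite ler_pM2l ?invr_gt0 ?ltr0n ?fib_gt0 //.
by rewrite !big_seq; apply: ler_sum => z zy; apply/hg/(G_fib Gy).
Qed.

Lemma iter_walk_le n h g y : G y -> (forall z, G z -> h z <= g z) ->
  iter n walk h y <= iter n walk g y.
Proof.
by move=> Gy hg; elim: n y Gy => [|n IH] y Gy /=; [apply: hg|apply: walk_le].
Qed.

Lemma walk1 y : G y -> walk (fun=> 1) y = 1.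
Proof.
move=> Gy; rewrite /walk big_const_seq count_predT iter_addr_0 mulVf //.
by rewrite pnatr_eq0 -lt0n fib_gt0.
Qed.

Lemma iter_walk1 n y : G y -> iter n walk (fun=> 1) y = 1.
Proof.
elim: n y => [|n IH] y Gy //; rewrite iterS -[RHS](walk1 Gy).
by apply/eqP; rewrite eq_le; apply/andP; split; apply: walk_le => // z Gz; rewrite IH.
Qed.

Lemma walk_comp h g y : G y -> walk (fun z => h (f z) * g z) y = h y * walk g y.
Proof.
move=> Gy; rewrite /walk mulrCA; congr (_ * _); rewrite mulr_sumr !big_seq.
by apply: eq_bigr => z; rewrite mem_fib // => /eqP ->.
Qed.

(** Each preimage is chosen with probability at least [d^-1]. *)
Lemma walk_escape h y z : G y -> (forall w, 0 <= h w) -> f z = y ->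
  d%:R^-1 * h z <= walk h y.
Proof.
move=> Gy h0 fz; have zy : z \in fib y by rewrite mem_fib // fz.
apply: ler_pM => //.
  by rewrite lef_pV2 ?posrE ?ltr0n ?(degree_gt0 Gy) ?fib_gt0 // ler_nat fib_le.
by rewrite (big_fsetD1 z zy) /= lerDl sumr_ge0.
Qed.

Lemma iter_walk_escape n h y z : G y -> (forall w, 0 <= h w) -> iter n f z = y ->
  d%:R^-1 ^+ n * h z <= iter n walk h y.
Proof.
elim: n h y => [|n IH] h y Gy h0 /= fz; first by rewrite -fz expr0 mul1r.
apply: le_trans (walk_escape Gy _ fz); last by move=> w; apply: iter_walk_ge0.
rewrite exprS -mulrA ler_wpM2l ?invr_ge0 //; apply: IH => //.
by apply: G_pre; rewrite fz.
Qed.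

Lemma iter_walk0 n h y : G y -> (forall z, iter n f z = y -> h z = 0) ->
  iter n walk h y = 0.
Proof.
elim: n y => [|n IH] y Gy h0 /=; first exact: h0.
rewrite /walk big_seq big1 ?mulr0 // => z zy; apply: IH; first exact: G_fib zy.
move=> w hw; apply: h0; rewrite /= hw.
by move: zy; rewrite mem_fib // => /eqP.
Qed.

Variables (x : T) (Gx : G x).

Definition visit h n : R := n.+1%:R^-1 * \sum_(i < n.+1) iter i walk h x.

Lemma visit_ge0 h n : (forall z, 0 <= h z) -> 0 <= visit h n.
Proof.
by move=> h0; rewrite mulr_ge0 ?invr_ge0 // sumr_ge0 // => i _; apply: iter_walk_ge0.
Qed.

Lemma visit_le1 h n : (forall z, h z <= 1) -> visit h n <= 1.
Proof.
move=> h1; rewrite /visit mulrC ler_pdivrMr ?ltr0n // mul1r.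
apply: (@le_trans _ _ (\sum_(i < n.+1) 1)); last by rewrite sumr_const card_ord.
by apply: ler_sum => i _; apply: iter_walk_le1.
Qed.

Lemma visit_le h g n : (forall z, G z -> h z <= g z) -> visit h n <= visit g n.
Proof.
move=> hg; rewrite ler_pM2l ?invr_gt0 ?ltr0n //; apply: ler_sum => i _.
exact: iter_walk_le.
Qed.

Lemma visitD h g n : visit (fun z => h z + g z) n = visit h n + visit g n.
Proof.
rewrite /visit -mulrDr -big_split; congr (_ * _).
by apply: eq_bigr => i _; apply: iter_walkD.
Qed.

Lemma visitZ (a : R) h n : visit (fun z => a * h z) n = a * visit h n.
Proof.
rewrite /visit mulrCA [in RHS]mulr_sumr; congr (_ * _).
by apply: eq_bigr => i _; apply: iter_walkZ.
Qed.

(** The sums telescope to their end terms; that this difference is of order [1 / n] makes the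
    limiting mean invariant under the walk. *)
Lemma visit_walk h n : visit (walk h) n - visit h n =
  n.+1%:R^-1 * (iter n.+1 walk h x - h x).
Proof.
rewrite /visit -mulrBr; congr (_ * _).
rewrite big_ord_recr [X in _ - X]big_ord_recl /=.
rewrite (eq_bigr (fun i : 'I_n => iter (bump 0 i) walk h x)).
  by rewrite -iterS iterSr; ring.
by move=> i _; rewrite -iterSr.
Qed.

Variables (F : set_system nat) (FU : UltraFilter F) (Finf : \oo `<=` F).

Definition umean h : R := lim (visit h n @[n --> F]).

Definition unit_fun h : Prop := (forall z, 0 <= h z) /\ (forall z, h z <= 1).

(** Cesaro means need not converge, but along an ultrafilter every sequence with values in the
    compact [[0, 1]] does. *)
Lemma umean_cvg h : unit_fun h -> visit h n @[n --> F] --> umean h.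
Proof.
move=> [h0 h1]; have := @segment_compact R 0 1; rewrite compact_ultra.
have FF : ProperFilter (visit h @ F) by apply: fmap_proper_filter.
have VU : UltraFilter (visit h @ F).
  split=> // H PH sub; apply/seteqP; split=> // A HA.
  have [//|FnA] := in_ultra_setVsetC (visit h @^-1` A) FU.
  have /(filterI HA) : H (~` A) by apply: sub.
  by rewrite setICr => /filter_ex[].
move=> /(_ (visit h @ F) VU)[].
  apply: (@filterS _ F _ setT) => [n _|]; last exact: filterT.
  by rewrite /= in_itv /= visit_ge0 // visit_le1.
by move=> l [_ hl]; have -> : umean h = l by apply: cvg_lim.
Qed.

Lemma umean_le h g : unit_fun h -> unit_fun g -> (forall z, G z -> h z <= g z) ->
  umean h <= umean g.
Proof.
move=> uh ug hg; apply: (@ler_cvg_to _ F _ R (visit h) (visit g)).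
- exact: umean_cvg.
- exact: umean_cvg.
- by apply: filterS filterT => n _; apply: visit_le.
Qed.

Lemma umean_walk h : unit_fun h -> umean (walk h) = umean h.
Proof.
move=> uh; have [h0 h1] := uh.
have uw : unit_fun (walk h) by split=> z; [apply: walk_ge0|apply: walk_le1].
have small : visit (walk h) n - visit h n @[n --> F] --> (0 : R).
  apply: (@squeeze_cvgr _ F _ R (fun n => - harmonic n) harmonic).
  - apply: filterS filterT => n _; rewrite visit_walk -ler_norml normrM.
    rewrite ger0_norm ?invr_ge0 //; apply: ler_piMr; first by rewrite invr_ge0.
    have a0 := iter_walk_ge0 n.+1 x h0; have a1 := iter_walk_le1 n.+1 x h1.
    rewrite ler_norml; have := h0 x; have := h1 x; move: a0 a1.
    move: (iter _ _ _ _) (h x) => a b; lra.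
  - rewrite -[0]oppr0; apply: cvgN; apply: cvg_trans cvg_harmonic.
    by move=> A; apply: Finf.
  - by apply: cvg_trans cvg_harmonic => A; apply: Finf.
apply: cvg_lim => //; rewrite -[umean h]add0r.
rewrite (_ : visit (walk h) = (fun n => visit (walk h) n - visit h n) \+ visit h).
  exact: cvgD small (umean_cvg uh).
by apply/funext => n /=; rewrite subrK.
Qed.

Lemma umean_iter_walk n h : unit_fun h -> umean (iter n walk h) = umean h.
Proof.
move=> uh; elim: n => [|n IH] //=; rewrite umean_walk //; have [h0 h1] := uh.
by split=> z; [apply: iter_walk_ge0|apply: iter_walk_le1].
Qed.

(* Limiting frequency, along [F], of the visits of the walk to [S]. *)
Definition freq S : R := umean (\1_S).

Lemma indic_unit S : unit_fun (\1_S : T -> R).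
Proof. by split=> z; rewrite indicE; case: (_ \in _). Qed.

Lemma freq_ge0 S : 0 <= freq S.
Proof.
apply: (limr_ge (F := F)).
  by apply/cvg_ex; eexists; apply: umean_cvg (indic_unit S).
by apply: filterS filterT => n _; apply: visit_ge0; have [] := indic_unit S.
Qed.

Lemma freqT : freq setT <= 1.
Proof.
apply: (limr_le (F := F)).
  by apply/cvg_ex; eexists; apply: umean_cvg (indic_unit setT).
by apply: filterS filterT => n _; apply: visit_le1; have [] := indic_unit setT.
Qed.

Lemma freq_modular S S' : freq (S `|` S') + freq (S `&` S') = freq S + freq S'.
Proof.
have c1 := cvgD (umean_cvg (indic_unit (S `|` S'))) (umean_cvg (indic_unit (S `&` S'))).
have c2 := cvgD (umean_cvg (indic_unit S)) (umean_cvg (indic_unit S')).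
suff E : (visit \1_(S `|` S') : nat -> R) \+ visit \1_(S `&` S') =
    visit \1_S \+ visit \1_S'.
  rewrite -(cvg_lim (@Rhausdorff R) (c1 _)) -(cvg_lim (@Rhausdorff R) (c2 _)).
  by congr (lim (_ @ F)); exact: E.
apply/funext => n /=; rewrite -!visitD; congr (visit _ n); apply/funext => z.
rewrite !indicE in_setU in_setI.
by case: (z \in S); case: (z \in S'); rewrite /= ?addr0 ?add0r.
Qed.

Lemma freq_le S S' : S `<=` S' -> freq S <= freq S'.
Proof.
move=> SS'; apply: umean_le => // z _; rewrite !indicE ler_nat.
case: (boolP (z \in S)) => //; rewrite inE => /SS' S'z.
by rewrite mem_set.
Qed.

(** From [z] in [G] a step of the walk lands in [f^-1 S] exactly when [z] is in [S], so invariance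
    under the walk becomes invariance under [f]. *)
Lemma freq_preimage S : freq (f @^-1` S) = freq S.
Proof.
rewrite /freq -umean_walk //; apply/eqP; rewrite eq_le.
have uw : unit_fun (walk (\1_(f @^-1` S) : T -> R)).
  by have [h0 h1] := indic_unit (f @^-1` S); split=> z; [apply: walk_ge0|apply: walk_le1].
have E z : G z -> walk (\1_(f @^-1` S) : T -> R) z = \1_S z.
  move=> Gz; rewrite -[RHS]mulr1 -(walk1 Gz) -walk_comp //; congr (walk _ z).
  by apply/funext => w; rewrite mulr1 !indicE.
by apply/andP; split; apply: umean_le => // z Gz; rewrite E.
Qed.

Lemma freq_null S : (forall n z, iter n f z = x -> ~ S z) -> freq S = 0.
Proof.
move=> nS; apply: cvg_lim => //; rewrite (_ : visit _ = fun=> 0); first exact: cvg_cst.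
apply/funext => n; rewrite /visit big1 ?mulr0 // => i _.
by apply: iter_walk0 => // z /nS nSz; rewrite indicE memNset.
Qed.

(** From [y] in [V] the walk is outside [Z] after [n] steps with probability at least [d^-n], and
    its position then lies over [y], hence in [f^-n Z]. Invariance under the walk turns this into an
    inequality of frequencies. *)
Lemma freq_escape n V Z : V `<=` Z ->
  (forall y, G y -> V y -> exists2 z, ~ Z z & iter n f z = y) ->
  d%:R^-1 ^+ n * freq V <= freq ((iter n f @^-1` Z) `&` ~` Z).
Proof.
move=> VZ esc; set S := _ `&` _; have d1 := degree_gt0 Gx.
have dn0 : 0 <= d%:R^-1 ^+ n :> R by rewrite exprn_ge0 ?invr_ge0.
have dn1 : d%:R^-1 ^+ n <= 1 :> R.
  by rewrite exprn_ile1 ?invr_ge0 // invf_le1 ?ltr0n // ler1n.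
have uV := indic_unit V.
have uh : unit_fun (fun z => d%:R^-1 ^+ n * \1_V z : R).
  have [h0 h1] := uV; split=> z; first by rewrite mulr_ge0.
  by rewrite mulr_ile1.
have -> : d%:R^-1 ^+ n * freq V = umean (fun z => d%:R^-1 ^+ n * \1_V z).
  apply/esym; apply: cvg_lim => //.
  rewrite (_ : visit _ = fun m => d%:R^-1 ^+ n * visit \1_V m).
    by apply: cvgMr; apply: umean_cvg.
  by apply/funext => m; rewrite visitZ.
rewrite /freq -(umean_iter_walk n (indic_unit S)); apply: umean_le => //.
  have [h0 h1] := indic_unit S.
  by split=> z; [apply: iter_walk_ge0|apply: iter_walk_le1].
move=> y Gy; have [h0 _] := indic_unit S.
rewrite indicE; have [|_] := boolP (y \in V); last first.
  by rewrite mulr0; apply: iter_walk_ge0.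
rewrite inE => Vy; have [z nZz fz] := esc y Gy Vy.
have := iter_walk_escape Gy h0 fz; rewrite indicE mem_set //.
by split=> //=; rewrite fz; apply: VZ.
Qed.

End BackwardWalk.

(** * Closed sets are visited with frequency zero *)

Section Recurrence.
Variables (R : realType) (T : Type) (f : T -> T) (mu : set T -> R).
Hypothesis mu_ge0 : forall S, 0 <= mu S.
Hypothesis mu_le1 : mu setT <= 1.
Hypothesis mu_le : forall S S', S `<=` S' -> mu S <= mu S'.
Hypothesis mu_modular : forall S S', mu (S `|` S') + mu (S `&` S') = mu S + mu S'.
Hypothesis mu_preimage : forall S, mu (f @^-1` S) = mu S.

Lemma mu_iter_preimage n S : mu (iter n f @^-1` S) = mu S.
Proof.
elim: n => [|n IH] //; rewrite -IH -[RHS]mu_preimage; congr mu.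
by apply/seteqP; split=> z; rewrite /= -iterSr.
Qed.

Lemma mu_setU S S' : mu (S `|` S') <= mu S + mu S'.
Proof. by rewrite -mu_modular lerDl. Qed.

(** If all returns were null, the preimages [f^-i Z] would have pairwise null intersections and the
    same mass, and more than [1 / mu Z] of them would exceed the total mass 1. *)
Lemma poincare_recurrence Z : 0 < mu Z ->
  exists2 p, (0 < p)%N & 0 < mu (Z `&` iter p f @^-1` Z).
Proof.
move=> Zpos; apply: contrapT => nrec.
have null p : (0 < p)%N -> mu (Z `&` iter p f @^-1` Z) = 0.
  move=> p0; apply/eqP; rewrite eq_le mu_ge0 andbT leNgt; apply/negP => h.
  by apply: nrec; exists p.
pose E i := iter i f @^-1` Z.
have nullE i j : (i < j)%N -> mu (E i `&` E j) = 0.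
  move=> ij; rewrite -(null (j - i)%N) ?subn_gt0 // -[RHS](mu_iter_preimage i).
  congr mu; rewrite /E -{1}(subnK (ltnW ij)).
  by apply/seteqP; split=> z; rewrite /= iterD.
have big N : exists2 U, N%:R * mu Z <= mu U &
    forall j, (N <= j)%N -> mu (U `&` E j) = 0.
  elim: N => [|N [U leU nullU]].
    exists set0; first by rewrite mul0r.
    move=> j _; rewrite set0I; apply/eqP; rewrite eq_le mu_ge0 andbT -(null 1) //.
    by apply: mu_le.
  exists (U `|` E N).
    rewrite -natr1 mulrDl mul1r -[mu (U `|` _)]addr0 -(nullU N) // mu_modular.
    by rewrite lerD // mu_iter_preimage.
  move=> j Nj; apply/eqP; rewrite eq_le mu_ge0 andbT setIUl.
  by apply: le_trans (mu_setU _ _) _; rewrite nullU 1?ltnW // nullE // addr0.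
have [U leU _] := big (Num.bound (mu Z)^-1).
have : (mu Z)^-1 < (Num.bound (mu Z)^-1)%:R by apply: archi_boundP; rewrite invr_ge0.
rewrite -(ltr_pM2r Zpos) mulVf ?gt_eqF // ltNge => /negP; apply.
apply: le_trans leU _; apply: le_trans mu_le1; exact: mu_le.
Qed.

End Recurrence.

Lemma closed_finite_union (T : topologicalType) (C : nat -> set T) p :
  (forall i, closed (C i)) ->
  exists2 Y, closed Y & forall z, Y z <-> exists2 i, (i < p)%N & C i z.
Proof.
move=> cC; elim: p => [|p [Y cY hY]].
  by exists set0; [exact: closed0|move=> z; split=> // -[]].
exists (Y `|` C p); first exact: closedU.
move=> z; split=> [[/hY[i ip Cz]|Cz]|[i]].
- by exists i => //; apply: ltnW.
- by exists p.
- by rewrite ltnS leq_eqVlt => /orP[/eqP->|ip] Cz; [right|left; apply/hY; exists i].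
Qed.

Lemma irreducible_finite_union (T : topologicalType) (C : nat -> set T) p :
  irreducible_space T -> (forall i, closed (C i)) ->
  (forall z, exists2 i, (i < p)%N & C i z) -> exists2 i, (i < p)%N & C i = setT.
Proof.
move=> [[z0 _] irr] cC; elim: p => [|p IH] cov; first by case: (cov z0).
have [Y cY hY] := closed_finite_union p cC.
have [|YT|CT] := irr Y (C p) cY (cC p); last by exists p.
  apply/seteqP; split=> // z _; have [i] := cov z.
  by rewrite ltnS leq_eqVlt => /orP[/eqP->|ip] Cz; [right|left; apply/hY; exists i].
have [|i ip CT] := IH; first by move=> z; apply/hY; rewrite YT.
by exists i => //; apply: ltnW.
Qed.

Lemma iter_fixed_set (T : Type) (g : T -> T) (Z : set T) n :
  g @^-1` Z = Z -> iter n g @^-1` Z = Z.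
Proof.
move=> gZ; elim: n => [|n IH] //.
by rewrite -[RHS]IH -[in RHS]gZ; apply/seteqP; split=> z.
Qed.

(* A backward orbit meeting a closed set [Z] with [f^-p Z = Z] stays in the
   union of the [f^-i Z] with [i < p]. *)
Lemma periodic_backward_orbit (T : topologicalType) (f : T -> T) (Z : set T) p
    (x z : T) n :
  irreducible_space T -> continuous f -> closed Z -> (0 < p)%N ->
  iter p f @^-1` Z = Z -> dense (\bigcup_i (iter i f @^-1` [set x])) ->
  iter n f z = x -> Z z -> Z = setT.
Proof.
move=> irr cf cZ p0 pZ dx nz Zz.
have citer i : continuous (iter i f).
  elim: i => [|i IH]; first by move=> w; apply: cvg_id.
  by move=> w; apply: (continuous_comp (IH w)); apply: cf.
have cC i : closed (iter i f @^-1` Z) by apply: closed_comp => // w _; apply: citer.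
have qZ q w : Z (iter (q * p) f w) <-> Z w.
  by rewrite -[X in Z X]/(iter (q * p) f w) iterM -[X in _ <-> X w](iter_fixed_set q pZ).
(* The exponents add up to a multiple of [p]: the point reached from [x] is the image of [z] under
   [f^(np)]. *)
have [i Zi] : exists i, Z (iter i f x).
  exists (n * p - n)%N; rewrite -nz -iterD subnK; first exact/qZ.
  by rewrite leq_pmulr.
have inY m w : iter m f w = x -> exists2 j, (j < p)%N & Z (iter j f w).
  move=> mw; exists ((i + m) %% p)%N; first by rewrite ltn_pmod.
  apply/(qZ ((i + m) %/ p)%N); rewrite -iterD -divn_eq iterD mw.
  exact: Zi.
have [Y cY hY] := closed_finite_union p cC.
have YT w : Y w.
  apply: contrapT => nYw; have [|v [nYv [m _ mv]]] := dx (~` Y) _ (closed_openC cY).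
    by exists w.
  by apply: nYv; apply/hY; apply: inY mv.
(* By irreducibility one of the [f^-j Z] is everything, and then [f^p] maps everything into [Z]. *)
have [|j jp jT] := irreducible_finite_union irr cC (p := p).
  by move=> w; apply/hY.
apply/seteqP; split=> // w _; rewrite -pZ /= -(subnKC (ltnW jp)) iterD.
by rewrite -[Z _]/((iter j f @^-1` Z) _) jT.
Qed.

Section VisitsVanish.
Variables (R : realType) (T : topologicalType) (f : T -> T) (G : set T) (d : nat).
Hypothesis f_cont : continuous f.
Hypothesis T_irr : irreducible_space T.
(** This and [f_open] isolate the geometric input, so that the section is purely topological;
    [minimal_closed] and [escaping_preimages] supply them. *)
Hypothesis T_min : forall (P : set (set T)) Z0, closed Z0 -> P Z0 ->
  exists Z, [/\ closed Z, P Z, Z `<=` Z0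
    & forall Y, closed Y -> Y `<=` Z -> P Y -> Y = Z].
Hypothesis f_open : forall (Z : set T) p y0, closed Z ->
  (forall A B, closed A -> closed B -> Z `<=` A `|` B -> Z `<=` A \/ Z `<=` B) ->
  ~ Z y0 -> Z (iter p f y0) -> exists Z', [/\ closed Z', Z' `<=` Z, Z' <> Z
    & forall y, Z y -> ~ Z' y -> exists2 z, ~ Z z & iter p f z = y].
Hypothesis G_pre : forall z, G (f z) -> G z.
Hypothesis fib_fin : forall y, G y -> finite_set (f @^-1` [set y]).
Hypothesis fib_onto : forall y, G y -> exists z, f z = y.
Hypothesis fib_le : forall y, G y -> (#|` fib f y| <= d)%N.
Variables (x : T) (Gx : G x).
Hypothesis x_dense : dense (\bigcup_i (iter i f @^-1` [set x])).

Lemma visits_vanish Z0 : closed Z0 -> Z0 <> setT ->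
  visit f x (\1_Z0 : T -> R) n @[n --> \oo] --> (0 : R).
Proof.
move=> cZ0 nT; apply/cvgrPdist_lt => e e0; apply: contrapT => nnear.
pose v n : R := visit f x \1_Z0 n.
have v0 n : 0 <= v n by apply: visit_ge0; have [] := indic_unit R Z0.
(* If the frequencies do not tend to 0, the times with frequency at least [e] are infinitely many,
   and an ultrafilter finer than [\oo] contains them. *)
pose D : set nat := [set n | e <= v n].
have PW : ProperFilter (within D \oo).
  apply: Build_ProperFilter_ex => A WA; apply: contrapT => nA; apply: nnear.
  apply: (@filterS _ \oo _ [set n | D n -> A n]) => [n DA|]; last exact: WA.
  rewrite /= sub0r normrN ger0_norm; last exact: v0.
  by rewrite ltNge; apply/negP => /DA An; apply: nA; exists n.
have [F [FU WF]] := ultraFilterLemma PW.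
have Finf : \oo `<=` F.
  by move=> A A_oo; apply: WF; apply: (@filterS _ \oo _ A) => [n|]; last exact: A_oo.
have FD : F D.
  by apply: WF; apply: (@filterS _ \oo _ setT) => [n _|]; last exact: filterT.
pose mu := freq R f x F.
have mu0 S : 0 <= mu S := freq_ge0 R f x FU S.
have mu1 : mu setT <= 1 := freqT R f x FU.
have muD S S' : mu (S `|` S') + mu (S `&` S') = mu S + mu S' := freq_modular R f x FU S S'.
have muS S S' : S `<=` S' -> mu S <= mu S'.
  exact: (freq_le R G_pre fib_fin fib_onto Gx FU).
have muf S : mu (f @^-1` S) = mu S.
  exact: (freq_preimage R G_pre fib_fin fib_onto Gx FU Finf).
have mu_null S : (forall n z, iter n f z = x -> ~ S z) -> mu S = 0.
  exact: (freq_null R G_pre fib_fin Gx FU).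
have mu_set0 : mu set0 = 0 by apply: mu_null => n z _ [].
have muU S S' : mu (S `|` S') <= mu S + mu S' := mu_setU mu0 muD S S'.
have posZ0 : 0 < mu Z0.
  have c : v n @[n --> F] --> mu Z0 := umean_cvg (f := f) (x := x) FU (indic_unit R Z0).
  apply: lt_le_trans e0 _; rewrite -(cvg_lim (@Rhausdorff R) c).
  by apply: limr_ge; [apply/cvg_ex; exists (mu Z0)|exact: FD].
have [Z [cZ posZ ZZ0 minZ]] := T_min cZ0 (P := fun Z => 0 < mu Z) posZ0.
have null_sub Y : closed Y -> Y `<=` Z -> Y <> Z -> mu Y = 0.
  move=> cY YZ nYZ; apply/eqP; rewrite eq_le mu0 andbT leNgt; apply/negP => posY.
  by apply: nYZ; apply: minZ.
(* Two proper closed pieces of [Z] would be null by minimality, and so would [Z]. *)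
have irrZ A B : closed A -> closed B -> Z `<=` A `|` B -> Z `<=` A \/ Z `<=` B.
  move=> cA cB ZAB; apply: contrapT => /not_orP[nA nB].
  have nullI C : closed C -> ~ Z `<=` C -> mu (Z `&` C) = 0.
    move=> cC nC; apply: null_sub; [exact: closedI|exact: subIsetl|].
    by move=> E; apply: nC; rewrite -E; apply: subIsetr.
  move: posZ; rewrite ltNge => /negP; apply.
  have -> : Z = (Z `&` A) `|` (Z `&` B) by rewrite -setIUr; apply/esym/setIidl.
  by apply: le_trans (muU _ _) _; rewrite !nullI // addr0.
have [p p0 rec] := poincare_recurrence mu0 mu1 muS muD muf posZ.
have citer i : continuous (iter i f).
  elim: i => [|i IH]; first by move=> w; apply: cvg_id.
  by move=> w; apply: (continuous_comp (IH w)); apply: f_cont.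
have cpZ : closed (iter p f @^-1` Z) by apply: closed_comp => // w _; apply: citer.
have ZpZ : Z `<=` iter p f @^-1` Z.
  have E : Z `&` iter p f @^-1` Z = Z.
    by apply: minZ => //; apply: closedI.
  by move=> w; rewrite -{1}E => -[].
have pZ : iter p f @^-1` Z = Z.
  apply/seteqP; split=> // y0 Zpy0; apply: contrapT => nZy0.
  have [Z' [cZ' Z'Z nZ'Z esc]] := f_open cZ irrZ nZy0 Zpy0.
  have VZ : Z `\` Z' `<=` Z by move=> y [].
  have escV y : G y -> (Z `\` Z') y -> exists2 z, ~ Z z & iter p f z = y.
    by move=> _ [Zy nZ'y]; apply: esc.
  have := freq_escape R G_pre fib_fin fib_onto fib_le Gx FU Finf VZ escV.
  rewrite -/(mu _) -/(mu _) => escape.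
  have posV : 0 < mu (Z `\` Z').
    apply: lt_le_trans posZ _; rewrite -[X in _ <= X]addr0 -(null_sub Z') //.
    rewrite -[X in mu X <= _](setDUK Z'Z) setUC; exact: muU.
  (* By invariance [f^-p Z] has the same mass as its subset [Z]. *)
  have : mu (iter p f @^-1` Z `&` ~` Z) = 0.
    have := muD (iter p f @^-1` Z `&` ~` Z) Z.
    rewrite -setIA setICl setI0 mu_set0 addr0.
    have -> : iter p f @^-1` Z `&` ~` Z `|` Z = iter p f @^-1` Z.
      by rewrite -setDE setUC setDUK.
    rewrite (mu_iter_preimage muf) => /eqP; rewrite -subr_eq0 opprD addrCA subrr addr0.
    by rewrite oppr_eq0 => /eqP.
  move=> E0; move: escape; rewrite E0 leNgt => /negP; apply.
  rewrite mulr_gt0 // exprn_gt0 // invr_gt0 ltr0n.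
  by rewrite (degree_gt0 fib_fin fib_onto fib_le Gx).
have [n [z [nz Zz]]] : exists n z, iter n f z = x /\ Z z.
  apply: contrapT => nex; move: posZ; rewrite mu_null ?ltxx // => n z nz Zz.
  by apply: nex; exists n, z.
have ZT := periodic_backward_orbit T_irr f_cont cZ p0 pZ x_dense nz Zz.
by apply: nT; apply/seteqP; split=> // w _; apply: ZZ0; rewrite ZT.
Qed.

End VisitsVanish.

(** * Growth of the number of preimages *)

Lemma card_fset_set_seq (T : choiceType) (S : set T) (s : seq T) :
  uniq s -> (forall w, w \in s <-> S w) -> #|` fset_set S| = size s.
Proof.
move=> us hs; have fS : finite_set S.
  by rewrite (_ : S = [set` s]); [exact: finite_seq|apply/seteqP; split=> w /hs].
rewrite -(undup_id us) -card_fseq; congr #|` _|; apply/fsetP => w.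
rewrite in_fset_set // !inE; apply/idP/idP; first by rewrite inE => /hs.
by move=> /hs Sw; rewrite inE.
Qed.

Section Counting.
Variables (R : realType) (T : choiceType) (f : T -> T) (G : set T) (d : nat).
Hypothesis G_pre : forall z, G (f z) -> G z.
Hypothesis fib_fin : forall y, G y -> finite_set (f @^-1` [set y]).
Hypothesis fib_onto : forall y, G y -> exists z, f z = y.
Hypothesis fib_le : forall y, G y -> (#|` fib f y| <= d)%N.

Definition count_preim n y : nat := #|` fset_set (iter n f @^-1` [set y])|.

Lemma finite_iter_preimage n y : G y -> finite_set (iter n f @^-1` [set y]).
Proof.
elim: n y => [|n IH] y Gy; first exact: finite_set1.
rewrite (_ : _ @^-1` _ = \bigcup_(z in f @^-1` [set y]) (iter n f @^-1` [set z])).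
  apply: bigcup_finite; first exact: fib_fin.
  by move=> z fz; apply: IH; apply: G_pre; rewrite fz.
by apply/seteqP; split=> [w /= fw|w [z fz wz]]; [exists (iter n f w)|rewrite /= wz].
Qed.

Lemma count_preim0 y : count_preim 0 y = 1%N.
Proof.
rewrite /count_preim (@card_fset_set_seq _ _ [:: y]) // => w.
by rewrite inE; split=> /eqP.
Qed.

Lemma count_preimS n y : G y ->
  count_preim n.+1 y = (\sum_(z <- fib f y) count_preim n z)%N.
Proof.
move=> Gy; rewrite /count_preim (@card_fset_set_seq _ _
  [seq w | z <- fib f y, w <- fset_set (iter n f @^-1` [set z])]).
- by rewrite size_allpairs_dep sumnE big_map.
- apply: allpairs_uniq_dep => [|z _|[z w] [z' w']]; try exact: fset_uniq.
  move=> /allpairsPdep[z1 [w1 [zy1 wz1 ->]]] /allpairsPdep[z2 [w2 [zy2 wz2 ->]]] /= ww.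
  move: wz1 wz2; rewrite !in_fset_set;
    try exact: finite_iter_preimage (G_fib G_pre fib_fin Gy _).
  by rewrite ww !inE /= => <- <-.
- move=> w; split.
    move=> /allpairsPdep[z [w' [zy wz ->]]]; move: wz.
    rewrite in_fset_set; last exact: finite_iter_preimage (G_fib G_pre fib_fin Gy zy).
    by rewrite inE /= => ->; move: zy; rewrite (mem_fib fib_fin) // => /eqP.
  move=> /= fw; have zy : iter n f w \in fib f y by rewrite (mem_fib fib_fin) // fw.
  apply/allpairsPdep; exists (iter n f w), w; split=> //.
  rewrite in_fset_set; first by rewrite inE.
  exact: finite_iter_preimage (G_fib G_pre fib_fin Gy zy).
Qed.

Lemma count_preim_gt0 n y : G y -> (0 < count_preim n y)%N.
Proof.
elim: n y => [|n IH] y Gy; first by rewrite count_preim0.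
have [z fz] := fib_onto Gy.
have zy : z \in fib f y by rewrite (mem_fib fib_fin) // fz.
rewrite count_preimS // (big_fsetD1 z zy) /= ltn_addr //.
by apply: IH; apply: G_pre; rewrite fz.
Qed.

Lemma count_preim_le n y : G y -> (count_preim n y <= d ^ n)%N.
Proof.
elim: n y => [|n IH] y Gy; first by rewrite count_preim0.
rewrite count_preimS // expnS; apply: (@leq_trans (\sum_(z <- fib f y) d ^ n)).
  rewrite big_seq [X in (_ <= X)%N]big_seq; apply: leq_sum => z zy.
  exact/IH/(G_fib G_pre fib_fin Gy zy).
by rewrite big_const_seq count_predT iter_addn_0 mulnC leq_mul2r fib_le ?orbT.
Qed.

Variable U : set T.
Hypothesis fib_ge : forall y, G y -> U y -> (d <= #|` fib f y|)%N.

(* Concavity of the logarithm: the entropy of the [n] first steps of the walk is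
   at most [ln] of the number of its possible outcomes. *)
Lemma ln_count_preim_ge n y : G y ->
  ln d%:R * \sum_(i < n) iter i (walk f) (\1_U : T -> R) y <=
  ln (count_preim n y)%:R.
Proof.
elim: n y => [|n IH] y Gy; first by rewrite big_ord0 mulr0 count_preim0 ln1.
have d0 := degree_gt0 fib_fin fib_onto fib_le Gy.
have lnd : 0 <= ln d%:R :> R by rewrite ln_ge0 // ler1n.
have N0 := fib_gt0 fib_fin fib_onto Gy.
set N : R := #|` fib f y|%:R; have Npos : 0 < N by rewrite ltr0n.
set W := fun z => \sum_(i < n) iter i (walk f) (\1_U : T -> R) z.
have -> : \sum_(i < n.+1) iter i (walk f) (\1_U : T -> R) y = \1_U y + walk f W y.
  rewrite big_ord_recl /=; congr (_ + _).
  by rewrite /walk /W exchange_big mulr_sumr; apply: eq_bigr.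
set C := \sum_(z <- fib f y) (count_preim n z)%:R : R.
have eC : (count_preim n.+1 y)%:R = C by rewrite count_preimS // natr_sum.
have Cpos : 0 < C by rewrite -eC ltr0n count_preim_gt0.
pose M := C / N; have Mpos : 0 < M by rewrite divr_gt0.
(* Jensen's inequality from the tangent of [ln] at the mean [M]: [ln c <= ln M + (c / M - 1)], where
   the last terms add up to 0. *)
have jensen : \sum_(z <- fib f y) ln (count_preim n z)%:R <= N * ln M.
  have : \sum_(z <- fib f y) ln (count_preim n z)%:R <=
      \sum_(z <- fib f y) (ln M + ((count_preim n z)%:R / M - 1)).
    rewrite big_seq [X in _ <= X]big_seq; apply: ler_sum => z zy.
    have cz : 0 < (count_preim n z)%:R :> R.
      by rewrite ltr0n count_preim_gt0 //; apply: (G_fib G_pre fib_fin Gy zy).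
    have q0 : 0 < (count_preim n z)%:R / M by rewrite divr_gt0.
    have := ln_div cz Mpos; move: q0; set q := _ / M => q0 lnq.
    have : ln (1 + (q - 1)) <= q - 1 by apply: le_ln1Dx; lra.
    by rewrite addrC subrK lnq; lra.
  have CM : C / M = N by rewrite /M invf_div mulrC divfK // gt_eqF.
  rewrite !big_split /= -mulr_suml -/C CM sumrN !big_const_seq !count_predT.
  by rewrite !iter_addr_0 subrr addr0 -[ln _ *+ _]mulr_natl.
rewrite eC; have -> : C = N * M by rewrite /M mulrC divfK // gt_eqF.
(* [ln N] pays for the first step, being at least [ln d] on [U] and nonnegative elsewhere; [ln M]
   pays for the later ones. *)
rewrite lnM ?posrE // mulrDr; apply: lerD.
  have lnN : 0 <= ln N by rewrite ln_ge0 // ler1n.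
  rewrite indicE; have [|_] := boolP (y \in U); last by rewrite mulr0.
  rewrite inE mulr1 => Uy; rewrite ler_ln ?posrE ?ltr0n // ler_nat.
  exact: fib_ge.
rewrite -(ler_pM2l Npos); apply: le_trans jensen.
rewrite /walk mulrCA !mulrA mulfK ?gt_eqF // mulr_sumr.
rewrite big_seq [X in _ <= X]big_seq; apply: ler_sum => z zy.
exact/IH/(G_fib G_pre fib_fin Gy zy).
Qed.

Lemma count_preim_growth x : G x ->
  visit f x (\1_(~` U) : T -> R) n @[n --> \oo] --> (0 : R) ->
  (count_preim n x)%:R `^ (n%:R)^-1 @[n --> \oo] --> (d%:R : R).
Proof.
move=> Gx vis; have d0 := degree_gt0 fib_fin fib_onto fib_le Gx.
have dR : 0 < d%:R :> R by rewrite ltr0n.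
have lnd : 0 <= ln d%:R :> R by rewrite ln_ge0 // ler1n.
(* The shift matches [visit], whose index [n] averages over [n.+1] terms, and passes over the
   default value of the exponent at 0. *)
rewrite -cvg_shiftS /=.
have e n : (count_preim n.+1 x)%:R `^ (n.+1%:R)^-1 =
    expR (n.+1%:R^-1 * ln (count_preim n.+1 x)%:R) :> R.
  by rewrite /powR pnatr_eq0 -leqn0 leqNgt count_preim_gt0.
under eq_fun do rewrite e.
have <- : expR (ln d%:R) = d%:R :> R by rewrite lnK // posrE.
apply: continuous_cvg; first exact: continuous_expR.
apply: (@squeeze_cvgr _ _ _ R
  (fun n => ln d%:R * (1 - visit f x \1_(~` U) n)) (fun=> ln d%:R)).
- apply: filterS filterT => n _; apply/andP; split.
    have -> : 1 - visit f x (\1_(~` U) : T -> R) n = visit f x (\1_U : T -> R) n.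
      have visit1 : visit f x (fun=> 1) n = 1 :> R.
        rewrite /visit (eq_bigr (fun=> 1)).
          by rewrite sumr_const card_ord mulVf // pnatr_eq0.
        by move=> i _; apply: (iter_walk1 _ G_pre fib_fin fib_onto).
      suff <- : visit f x (\1_U : T -> R) n + visit f x (\1_(~` U) : T -> R) n = 1.
        by rewrite addrK.
      rewrite -visitD -visit1; congr (visit _ _ _ n); apply/funext => z.
      rewrite !indicE in_setC; by case: (z \in U); rewrite ?addr0 ?add0r.
    by rewrite /visit mulrCA ler_pM2l ?invr_gt0 ?ltr0n // ln_count_preim_ge.
  rewrite mulrC ler_pdivrMr ?ltr0n // [X in _ <= X]mulr_natr -lnXn //.
  rewrite ler_ln ?posrE ?exprn_gt0 ?ltr0n ?count_preim_gt0 //.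
  by rewrite -natrX ler_nat count_preim_le.
- have : ln d%:R * (1 - visit f x (\1_(~` U) : T -> R) n) @[n --> \oo]
      --> ln d%:R * (1 - 0 : R).
    by apply: cvgMr; apply: cvgB => //; apply: cvg_cst.
  by rewrite subr0 mulr1.
- exact: cvg_cst.
Qed.

End Counting.

(** * Iterated going down and going up, and the growth of the preimages *)

Section FiniteFlatDynamics.
Variables (k : closedFieldType) (X : variety k) (f : kmap X X).
Hypotheses (f_finite : finite_map f) (f_flat : flat_map f).

Lemma going_down_iter p (y z : X) : closure [set z] (iter p f y) ->
  exists2 y', closure [set y'] y & iter p f y' = z.
Proof.
elim: p y => [|p IH] y; first by exists z.
rewrite iterSr => /IH[w cw <-]; have [y' cy' fy'] := going_down f_finite f_flat cw.
by exists y' => //; rewrite iterSr fy'.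
Qed.

Lemma going_up_open_iter p (y1 : X) (W : set X) : open W -> W y1 ->
  exists2 N : set X, open N & N (iter p f y1) /\
  forall y, N y -> closure [set iter p f y1] y -> exists2 y', W y' & iter p f y' = y.
Proof.
move=> oW Wy1; elim: p => [|p [M oM [My1 hM]]].
  by exists W => //; split=> // y Wy _; exists y.
have [N oN [Ny1 hN]] := going_up_open f_finite oM My1.
exists N => //; split=> // y Ny cy; have [w [<- cw Mw]] := hN _ Ny cy.
by have [y' Wy' <-] := hM _ Mw cw; exists y'.
Qed.

(** Let [z] be generic in [Z]. Going down from [y0] gives [w] over [z] specializing to [y0], so [w]
    is outside the closed set [Z]. Going up openly from [w] into the complement of [Z] serves all
    points of [Z] in a neighbourhood [N] of [z], and [Z'] is the rest of [Z]. *)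
Lemma escaping_preimages (Z : set X) p (y0 : X) : closed Z ->
  (forall A B, closed A -> closed B -> Z `<=` A `|` B -> Z `<=` A \/ Z `<=` B) ->
  ~ Z y0 -> Z (iter p f y0) -> exists Z', [/\ closed Z', Z' `<=` Z, Z' <> Z
    & forall y, Z y -> ~ Z' y -> exists2 z, ~ Z z & iter p f z = y].
Proof.
move=> cZ irr nZy0 Zpy0.
have [z Zz Zcl] := irreducible_generic_point cZ (ex_intro _ _ Zpy0) irr.
have [w cw pw] := going_down_iter (Zcl _ Zpy0).
have nZw : ~ Z w.
  move=> Zw; apply: nZy0; rewrite ((closure_id Z).1 cZ).
  by apply: closure_subset cw => _ ->.
have [N oN [Nw hN]] := going_up_open_iter p (closed_openC cZ) nZw.
exists (Z `&` ~` N); split.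
- by apply: closedI => //; apply: open_closedC.
- exact: subIsetl.
- by rewrite pw in Nw; move=> E; move: Zz; rewrite -E => -[].
- move=> y Zy /not_andP[//|/contrapT Ny].
  by apply: hN => //; rewrite pw; apply: Zcl.
Qed.

Hypothesis f_separable : separable_extension (pullback_field f).

(** Stated for finite subsets of the fibre so that it also gives finiteness, without which
    [fset_set] would be empty. *)
Lemma fibre_fset_le (y : X) (B : {fset X}) : rational_point y ->
  [set` B] `<=` f @^-1` [set y] -> (#|` B| <= topological_degree f)%N.
Proof.
move=> ry sub.
apply: (fibre_le f_finite f_flat f_separable (y := fun i : 'I_#|` B| => nth y B i) ry).
  move=> i j /eqP; rewrite nth_uniq ?fset_uniq // => /eqP; exact: ord_inj.
by move=> i; apply: sub; rewrite /= mem_nth.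
Qed.

Lemma finite_fibre (y : X) : rational_point y -> finite_set (f @^-1` [set y]).
Proof.
move=> ry; apply: contrapT => /(infinite_set_fset (topological_degree f).+1)[B sub].
by rewrite ltnNge (fibre_fset_le ry sub).
Qed.

Lemma fibre_card_le (y : X) :
  rational_point y -> (#|` fib f y| <= topological_degree f)%N.
Proof.
move=> ry; apply: (fibre_fset_le ry) => z /=.
by rewrite in_fset_set ?inE //; apply: finite_fibre.
Qed.

Lemma fibre_card_ge (y : X) (g : 'I_(topological_degree f) -> X) :
  rational_point y -> injective g -> (forall i, f (g i) = y) ->
  (topological_degree f <= #|` fib f y|)%N.
Proof.
move=> ry g_inj fg; rewrite -[X in (X <= _)%N](size_enum_ord) -(size_map g).
apply: uniq_leq_size; first by rewrite map_inj_uniq // enum_uniq.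
move=> _ /mapP[i _ ->]; rewrite in_fset_set; last exact: finite_fibre.
by rewrite inE /= fg.
Qed.

End FiniteFlatDynamics.

(** The preimages are taken among all points of the scheme. As [x] is rational, they are rational
    too and finite in number, so [fset_set] counts them faithfully. *)
Theorem corollary1p21 (R : realType) (k : closedFieldType) (X : variety k)
    (f : kmap X X) (f_finite : finite_map f) (f_flat : flat_map f)
    (f_separable : separable_extension (pullback_field f))
    (x : X) (x_rational : rational_point x)
    (x_dense : dense (\bigcup_i (iter i f @^-1` [set x]))) :
  (#|` fset_set (iter n f @^-1` [set x])|%:R `^ (n%:R)^-1)
    @[n --> \oo] --> ((topological_degree f)%:R : R).
Proof.
pose G : set X := [set y | rational_point y].
have G_pre z : G (f z) -> G z by apply: preimage_rational.
have fin y : G y -> finite_set (f @^-1` [set y]) by apply: finite_fibre.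
have onto y : G y -> exists z, f z = y by move=> _; apply: finite_flat_onto.
have le y : G y -> (#|` fib f y| <= topological_degree f)%N by apply: fibre_card_le.
have [U oU [U0 hU]] := fibre_ge f_finite f_flat f_separable.
have ge y : G y -> U y -> (topological_degree f <= #|` fib f y|)%N.
  by move=> Gy Uy; have [g [g_inj fg]] := hU y Uy Gy; apply: fibre_card_ge fg.
apply: (count_preim_growth G_pre fin onto le ge) => //.
apply: (visits_vanish (G := G) (d := topological_degree f)) => //.
- exact: map_cont.
- exact: variety_irreducible.
- by move=> P Z0; apply: minimal_closed; apply: variety_finite_type.
- exact: escaping_preimages.
- exact: open_closedC.
- by move=> UT; case: U0 => u Uu; have : (~` U) u by rewrite UT.
Qed.
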